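(* Let $S_1,S_2$ be non-plane rooted trees such that $S_1\subseteq S_2$. Then, with limits taken as $n\to\infty$ through odd values, $$\lim_{n\to\infty}\sqrt{n}\,\frac{g_{\mathcal{V}_n}(S_1)}{a_{\mathcal{V}_n}(S_1)}\le\lim_{n\to\infty}\sqrt{n}\,\frac{g_{\mathcal{V}_n}(S_2)}{a_{\mathcal{V}_n}(S_2)}.$$
   Context: $\mathcal{V}_n$ is the set of non-plane (unordered) binary trees with $n$ nodes (every node has $0$ or $2$ children); it is empty for even $n$. A rooted tree is viewed as a poset with $v\le w$ iff $w$ is an ancestor of $v$ or equal to it. A non-plane embedding of $S$ into a non-plane tree $T$ is a vertex subset of $T$ whose induced subposet is isomorphic to the poset of $S$; subsets mapped onto each other by an automorphism of $T$ count as the same embedding. $S\subseteq T$ means at least one embedding of $S$ into $T$ exists. An embedding is good if it contains the root of $T$. $a_{\mathcal{V}_n}(S)$ (resp. $g_{\mathcal{V}_n}(S)$) is the total number of embeddings (resp. good embeddings) of $S$ into all trees of $\mathcal{V}_n$. *)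

(* Defs.v *)
From HB Require Import structures.
From mathcomp Require Import all_boot all_order all_algebra all_fingroup.
From mathcomp Require Import all_classical all_reals all_analysis.
Set Implicit Arguments. Unset Strict Implicit. Unset Printing Implicit Defensive.
Import Order.TTheory GRing.Theory Num.Theory.

(* Rooted trees, given by a (plane) rose tree.  A non-plane rooted tree is an
   isomorphism class of such trees; all notions below are invariant under
   reordering of children. *)
Inductive tree := Node of seq tree.

(* Vertices of a tree, as addresses (paths of child indices from the root).
   The root is [::], the first element of the list. *)
Fixpoint verts (t : tree) : seq (seq nat) :=
  let: Node ts := t in
  [::] :: (fix aux (i : nat) (l : seq tree) : seq (seq nat) :=
             match l with
             | [::] => [::]
             | u :: l' => map (cons i) (verts u) ++ aux i.+1 l'
             end) 0 ts.

Definition nverts (t : tree) : nat := size (verts t).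
Definition vtx (t : tree) := 'I_(nverts t).
Definition addr (t : tree) (i : vtx t) : seq nat := nth [::] (verts t) i.

(* Tree poset: v <= w iff w is an ancestor of v or equal to v,
   i.e. the address of w is a prefix of the address of v. *)
Definition tle (t : tree) (v w : vtx t) : bool := prefix (addr w) (addr v).

Definition is_root (t : tree) (v : vtx t) : bool := addr v == [::].

Definition is_emb (S T : tree) (U : {set vtx T}) : bool :=
  [exists f : {ffun vtx S -> vtx T},
    [&& injectiveb f, f @: setT == U &
        [forall i, forall j, tle i j == tle (f i) (f j)]]].

(* Automorphisms of T (as a rooted tree = as a poset). *)
Definition is_aut (T : tree) (g : {perm vtx T}) : bool :=
  [forall i, forall j, tle (g i) (g j) == tle i j].

Definition aut_equiv (T : tree) (U U' : {set vtx T}) : bool :=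
  [exists g : {perm vtx T}, is_aut g && (g @: U == U')].

Definition norbits (T : tree) (A : {set {set vtx T}}) : nat :=
  #|[set [set U' in A | aut_equiv U U'] | U in A]|.

Definition embs (S T : tree) : {set {set vtx T}} := [set U | @is_emb S T U].
Definition good_embs (S T : tree) : {set {set vtx T}} :=
  [set U | @is_emb S T U & [exists v in U, is_root v]].

Definition nemb (S T : tree) : nat := norbits (embs S T).
Definition ngood (S T : tree) : nat := norbits (good_embs S T).

Definition subtree (S T : tree) : bool := [exists U, @is_emb S T U].

Definition tiso (S T : tree) : bool :=
  (nverts S == nverts T) &&
  [exists f : {ffun vtx S -> vtx T},
    injectiveb f && [forall i, forall j, tle i j == tle (f i) (f j)]].

(* All plane full binary trees (every node has 0 or 2 children) with n nodes
   (fuel-driven enumeration; fuel n suffices). *)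
Fixpoint bt (fuel n : nat) : seq tree :=
  match fuel with
  | 0 => [::]
  | fuel'.+1 =>
      if n == 1 then [:: Node [::]] else
      flatten [seq [seq Node [:: l; r] | l <- bt fuel' k, r <- bt fuel' (n.-1 - k)]
              | k <- iota 1 n.-2]
  end.
Definition pbintrees (n : nat) : seq tree := bt n n.

(* Sum over the non-plane trees of V_n: each plane representative T is weighted
   by 1 / (number of plane trees isomorphic to T), so that every isomorphism
   class contributes exactly once. *)
Definition sumV (R : numFieldType) (n : nat) (F : tree -> nat) : R :=
  \sum_(T <- pbintrees n) (F T)%:R / (count (tiso T) (pbintrees n))%:R.

Definition aV (R : numFieldType) (n : nat) (S : tree) : R := sumV R n (nemb S).
Definition gV (R : numFieldType) (n : nat) (S : tree) : R := sumV R n (ngood S).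

Definition ratio_odd (R : realType) (S : tree) (k : nat) : R :=
  Num.sqrt (k.*2.+1)%:R * (gV R k.*2.+1 S / aV R k.*2.+1 S).

(* Main.v *)
(** An orbit of embeddings of S into the trees with k internal nodes is a
    non-plane binary tree with a set of marked vertices whose induced poset is S.
    More generally let A_F be the generating function, by internal nodes, of
    marked trees with marked forest F, and V the series of all trees (the case of
    the empty F).  Splitting a marked tree at its root gives, up to multiples of
    the series A_F'(x^2), whose radius of convergence is larger,
      (1 - x V) A_S = G_S,   (1 - x V) A_F = (x/2) sum_(F = F1 + F2) A_F1 A_F2,
    with G_S the series of good embeddings.  As (1 - x V)^2 = 1 - 2x - x^2 V(x^2)
    has a simple zero at the radius of convergence r, 1 / (1 - x V) behaves like
    K (1 - x/r)^(-1/2), and by induction A_F behaves like C_F (1 - x/r)^(-e/2)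
    where e = -1 + sum of (vertices + leaves) over the trees of F.  The exponents
    for G_S and A_S are e - 1 and e, so the limit is the limit of
    sqrt(2k+1) c_(e-1)(k) / c_e(k), divided by the constant K, where c_e(k) is the
    coefficient of x^k in (1 - x)^(-e/2).  This increases with e, and an embedding
    of S1 into S2 increases both the number of vertices and of leaves.

    The singular expansion needs no complex analysis: rescaled to radius 1, x V satisfies
    (1 - x V)^2 = (1 - x) q where q is so close to 1 in a weighted l^1 norm that
    its square root and the inverse of the latter lie in that Banach algebra. *)
Require Import Defs.
From HB Require Import structures.
From mathcomp Require Import all_boot all_order all_algebra all_fingroup.
From mathcomp Require Import all_classical all_reals all_analysis.
From mathcomp Require Import zify ring lra.
Set Implicit Arguments. Unset Strict Implicit. Unset Printing Implicit Defensive.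
Import Order.TTheory GRing.Theory Num.Theory numFieldNormedType.Exports.

(** * Isomorphism codes of prefix-ordered sets *)

(** The statement counts vertex sets modulo permutations, inside plane trees with rational weights.
    To reach a recursion, posets and marked trees are encoded by natural numbers that agree exactly
    on isomorphic objects; ordering siblings by code then selects one plane representative of each
    non-plane marked tree. The analytic obstacle is that 1 - p, with p the rescaled x V, vanishes at
    the singularity, so its inverse is not absolutely summable there. Dividing 1 - p by (1 -
    x)^(1/2) removes the zero. The weight in the norm grows linearly because the quotients of the
    coefficients of (1 - x)^(-1/2) of indices n - i and n are bounded by 2 i + 1; its slope must
    keep the norm of q - 1 below 1. The weight 1 + n/10 meets both demands, given r <= 1/2 and p(1)
    <= 1. The one-vertex pattern is exceptional: its good embeddings have exponent 0, and its limit
    is 0 because the rescaled coefficients of V are o(1/n). This comes from differentiating (1 -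
    p)^2 = 1 - f. *)

Definition wt (n : nat) : nat := head 0 (CodeSeq.decode n).

Definition wts (L : seq nat) : nat := sumn (map wt L).

(* The code of a tree whose root has colour [c] and whose root branches have
   codes [L].  The first entry, nverts + nleaves for a code of a tree, is stored
   so that it can be read off the code. *)
Definition node (c : nat) (L : seq nat) : nat :=
  CodeSeq.code [:: if nilp L then 2 else (wts L).+1; c; CodeSeq.code (sort leq L)].

Lemma wt_node c L : wt (node c L) = if nilp L then 2 else (wts L).+1.
Proof. by rewrite /wt /node CodeSeq.codeK. Qed.

Lemma perm_sort_leq (L M : seq nat) : (sort leq L == sort leq M) = perm_eq L M.
Proof.
apply/eqP/idP => [/perm_sortP|h].
  by apply; [exact: leq_total|exact: leq_trans|exact: anti_leq].
by apply/perm_sortP => //; [exact: leq_total|exact: leq_trans|exact: anti_leq].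
Qed.

(** The stored weight is a symmetric function of [L], so it never separates codes with equal colours
    and equal multisets of branches. *)
Lemma node_eq c d L M : (node c L == node d M) = (c == d) && perm_eq L M.
Proof.
apply/eqP/andP => [/(can_inj CodeSeq.codeK) [_ -> /(can_inj CodeSeq.codeK) h]|].
  by rewrite -perm_sort_leq h.
case=> /eqP -> h; rewrite /node /wts.
have -> : nilp L = nilp M by rewrite /nilp (perm_size h).
rewrite (perm_sumn (perm_map wt h)).
by congr (CodeSeq.code [:: _; _; CodeSeq.code _]); apply/eqP; rewrite perm_sort_leq.
Qed.

Notation address := (seq nat).

Definition roots (X : seq address) : seq address :=
  [seq x <- X | all (fun y => prefix y x ==> (y == x)) X].

Definition below (X : seq address) (x : address) : seq address :=
  [seq y <- X | prefix x y && (y != x)].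

(** [X] need not be a tree: under the prefix order any finite set of addresses is a forest, rooted
    at its minimal addresses. The result lists the codes of its components; [k] is fuel, and
    [size X] suffices. *)
Fixpoint pcodes (k : nat) (c : address -> nat) (X : seq address) : seq nat :=
  if k is k'.+1 then [seq node (c x) (pcodes k' c (below X x)) | x <- roots X]
  else [::].

(** Isomorphism of coloured forests. A constant colouring gives isomorphism of posets; colouring by
    membership in a vertex set gives equivalence of marked trees. *)
Definition piso (c : address -> nat) X (d : address -> nat) Y : Prop :=
  exists h : address -> address,
    [/\ {in X &, forall x y, prefix (h x) (h y) = prefix x y},
        perm_eq (map h X) Y & {in X, forall x, d (h x) = c x}].

Lemma prefix_anti (x y : address) : prefix x y -> prefix y x -> x = y.
Proof.
move=> /prefixP[u ->] /prefixP[v /eqP].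
rewrite -catA -[X in X == _]cats0 eqseq_cat // eqxx /= eq_sym.
by case: u => //; rewrite cats0.
Qed.

Lemma prefix_total (x y z : address) :
  prefix x z -> prefix y z -> prefix x y || prefix y x.
Proof.
rewrite !prefixE => /eqP hx /eqP hy.
case/orP: (leq_total (size x) (size y)) => h.
  have -> : take (size x) y = x by rewrite -[X in take _ X]hy take_takel.
  by rewrite eqxx.
have -> : take (size y) x = y by rewrite -[X in take _ X]hx take_takel.
by rewrite eqxx orbT.
Qed.

Lemma roots_sub X x : x \in roots X -> x \in X.
Proof. by rewrite mem_filter => /andP[]. Qed.

Lemma pcodes_perm k c X Y : perm_eq X Y -> perm_eq (pcodes k c X) (pcodes k c Y).
Proof.
elim: k X Y => [|k IH] X Y h //=.
have -> : roots X = [seq x <- X | all (fun y => prefix y x ==> (y == x)) Y].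
  by apply: eq_filter => x; apply: perm_all.
have -> : [seq node (c x) (pcodes k c (below Y x)) | x <- roots Y] =
          [seq node (c x) (pcodes k c (below X x)) | x <- roots Y].
  apply: eq_map => x; apply/eqP; rewrite node_eq eqxx /=.
  by rewrite perm_sym; apply: IH; apply: perm_filter.
by apply: perm_map; apply: perm_filter.
Qed.

Lemma piso_inj (X : seq address) (h : address -> address) : {in X &, forall x y, prefix (h x) (h y) = prefix x y} ->
  {in X &, injective h}.
Proof.
by move=> hh x y xX yX e; apply: prefix_anti; rewrite -hh // e prefix_refl.
Qed.

Lemma pcodes_map k c d (X : seq address) (h : address -> address) :
  {in X &, forall x y, prefix (h x) (h y) = prefix x y} ->
  {in X, forall x, d (h x) = c x} -> pcodes k d (map h X) = pcodes k c X.
Proof.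
elim: k X => [|k IH] X hh hc //=.
have hi := piso_inj hh.
have -> : roots (map h X) = map h (roots X).
  rewrite /roots filter_map; congr map; apply: eq_in_filter => x xX /=.
  rewrite all_map; apply: eq_in_all => y yX /=; rewrite hh //.
  by rewrite (inj_in_eq hi).
rewrite -map_comp; apply/eq_in_map => x /roots_sub xX /=; rewrite hc //.
have -> : below (map h X) (h x) = map h (below X x).
  rewrite /below filter_map; congr map; apply: eq_in_filter => y yX /=.
  by rewrite hh // (inj_in_eq hi).
rewrite IH // => [y z|y].
  by rewrite !mem_filter => /andP[_ yX] /andP[_ zX]; apply: hh.
by rewrite !mem_filter => /andP[_ yX]; apply: hc.
Qed.

Lemma piso_pcodes k c d X Y : piso c X d Y -> perm_eq (pcodes k c X) (pcodes k d Y).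
Proof.
case=> h [hh hp hc]; rewrite -(pcodes_map _ hh hc); exact: pcodes_perm.
Qed.

(** Used to match the roots of two forests whose multisets of codes agree. *)
Lemma perm_map_pairing (I J T : eqType) (y0 : J) (s : seq I) (t : seq J) (f : I -> T) (g : J -> T) :
  uniq s -> perm_eq (map f s) (map g t) ->
  exists2 p : I -> J, perm_eq (map p s) t & {in s, forall x, g (p x) = f x}.
Proof.
elim: s t => [|x s IH] t /=.
  by move=> _; rewrite perm_sym => /perm_nilP; case: t => // _; exists (fun=> y0).
move=> /andP[xs us] hp.
have : f x \in map g t by rewrite -(perm_mem hp) inE eqxx.
case/mapP=> y yt e.
have ht := perm_to_rem yt.
have : perm_eq (map f s) (map g (rem y t)).
  rewrite -(perm_cons (f x)); apply: (perm_trans hp).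
  by rewrite e -map_cons; apply: perm_map.
case/(IH _ us) => p hp1 hp2.
exists (fun z => if z == x then y else p z).
  have -> : map (fun z => if z == x then y else p z) s = map p s.
    apply/eq_in_map => z zs.
    by case: eqP => // zx; rewrite -zx zs in xs.
  by rewrite eqxx perm_sym (perm_trans ht) // perm_cons perm_sym.
move=> z; rewrite inE; case: eqP => [-> _|_ /= zs]; [by rewrite e|exact: hp2].
Qed.

Lemma root_exists X x : x \in X -> exists2 r, r \in roots X & prefix r x.
Proof.
have [n] := ubnP (size x); elim: n x => // n IH x xn xX.
have [h|] := boolP (all (fun y => prefix y x ==> (y == x)) X).
  by exists x; [rewrite mem_filter h|exact: prefix_refl].
case/allPn => y yX; rewrite negb_imply => /andP[yx ne].
have [] := IH y => //.
  apply: leq_trans (xn : size x <= n); case/prefixP: yx ne => z ->.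
  by case: z => [|a z]; rewrite ?cats0 ?eqxx // size_cat /= addnS ltnS leq_addr.
by move=> r rX ry; exists r => //; apply: prefix_trans yx.
Qed.

Lemma roots_comparable X x y : x \in roots X -> y \in roots X -> prefix x y -> x = y.
Proof.
by rewrite !mem_filter => /andP[_ xX] /andP[/allP/(_ x xX)/implyP h _] /h/eqP.
Qed.

Lemma mem_below X x y : (y \in below X x) = [&& y \in X, prefix x y & y != x].
Proof. by rewrite mem_filter andbC. Qed.

Lemma below_uniq X x : uniq X -> uniq (below X x).
Proof. exact: filter_uniq. Qed.

Lemma size_below X x : x \in X -> size (below X x) < size X.
Proof.
move=> xX; rewrite size_filter.
rewrite -(count_predC (fun y => prefix x y && (y != x)) X).
rewrite -[X in X < _]addn0 ltn_add2l -has_count; apply/hasP; exists x => //=.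
by rewrite eqxx andbF.
Qed.

Lemma uniq_map_inj (I J : eqType) (f : I -> J) (s : seq I) :
  uniq (map f s) -> {in s &, injective f}.
Proof.
elim: s => //= x s IH /andP[xs us] y z; rewrite !inE.
case: eqP => [-> _|_ /= ys]; case: eqP => [-> _|_ /= zs] // e.
- by rewrite e map_f in xs.
- by rewrite -e map_f in xs.
- exact: IH.
Qed.

(** Roots with equal codes are matched by [s], induction gives isomorphisms of the parts strictly
    below them, and [H] glues these. Gluing works because each address lies below exactly one root,
    here [rt y], and addresses below different roots are incomparable. *)
Lemma pcodes_piso k c d X Y : uniq X -> uniq Y -> size X <= k -> size Y <= k ->
  perm_eq (pcodes k c X) (pcodes k d Y) -> piso c X d Y.
Proof.
elim: k X Y => [|k IH] X Y uX uY.
  by rewrite !leqn0 !size_eq0 => /eqP-> /eqP-> _; exists id.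
move=> sX sY /= hp.
have [s hs1 hs2] :
  exists2 s, perm_eq (map s (roots X)) (roots Y) &
    {in roots X, forall x, node (d (s x)) (pcodes k d (below Y (s x))) =
       node (c x) (pcodes k c (below X x))}.
  exact: (perm_map_pairing [::] (filter_uniq _ uX) hp).
have sr x : x \in roots X -> s x \in roots Y.
  by move=> xr; rewrite -(perm_mem hs1) map_f.
have sinj : {in roots X &, injective s}.
  by apply: uniq_map_inj; rewrite (perm_uniq hs1) filter_uniq.
have hb x : exists h : address -> address, x \in roots X ->
    [/\ {in below X x &, forall x y, prefix (h x) (h y) = prefix x y},
        perm_eq (map h (below X x)) (below Y (s x)) & {in below X x, forall x, d (h x) = c x}].
  have [xr|_] := boolP (x \in roots X); last by exists id.
  have /eqP := hs2 x xr; rewrite eq_sym node_eq => /andP[_ hx].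
  have [||||//|h hh] := IH (below X x) (below Y (s x)); try exact: below_uniq.
  - by rewrite -ltnS (leq_trans _ sX) // size_below // roots_sub.
  - by rewrite -ltnS (leq_trans _ sY) // size_below // roots_sub // sr.
  by exists h.
have [hb' hbP] := choice hb.
pose rt y := head [::] [seq x <- roots X | prefix x y].
have rtP y : y \in X -> rt y \in roots X /\ prefix (rt y) y.
  move=> yX; have [r rX ry] := root_exists yX.
  have : r \in [seq x <- roots X | prefix x y] by rewrite mem_filter ry.
  rewrite /rt; case E : [seq _ <- _ | _] => [|z l] // _ /=.
  have : z \in [seq x <- roots X | prefix x y] by rewrite E inE eqxx.
  by rewrite mem_filter => /andP[].
have rtE r y : r \in roots X -> y \in X -> prefix r y -> rt y = r.
  move=> rX yX ry; have [h1 h2] := rtP y yX.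
  case/orP: (prefix_total ry h2) => h; first by rewrite (roots_comparable rX h1 h).
  exact: roots_comparable h1 rX h.
pose H y := if y == rt y then s y else hb' (rt y) y.
have Hroot r : r \in roots X -> H r = s r.
  move=> rX; rewrite /H (rtE r r) ?eqxx ?prefix_refl //; exact: roots_sub.
have below_r y : y \in X -> y != rt y -> y \in below X (rt y).
  by move=> yX ne; rewrite mem_below yX ne (rtP y yX).2.
have Hbelow y : y \in X -> y != rt y -> H y \in below Y (s (rt y)).
  move=> yX ne; rewrite /H (negPf ne); have [rX _] := rtP y yX.
  by have [_ h _] := hbP _ rX; rewrite -(perm_mem h) map_f // below_r.
have HY y : y \in X -> H y \in Y.
  move=> yX; have [e|ne] := eqVneq y (rt y).
    by have [rX _] := rtP y yX; rewrite e Hroot //; exact/roots_sub/sr.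
  by have := Hbelow y yX ne; rewrite mem_below => /and3P[].
have Hpre y : y \in X -> prefix (s (rt y)) (H y).
  move=> yX; have [e|ne] := eqVneq y (rt y).
    by rewrite {2}e (Hroot (rt y)) ?prefix_refl // (rtP y yX).1.
  by have := Hbelow y yX ne; rewrite mem_below => /and3P[].
have sroot r t z : r \in roots X -> t \in roots X -> prefix (s r) z -> prefix (s t) z -> r = t.
  move=> rX tX h1 h2; apply: sinj => //.
  case/orP: (prefix_total h1 h2) => h; first exact: roots_comparable (sr _ rX) (sr _ tX) h.
  by rewrite (roots_comparable (sr _ tX) (sr _ rX) h).
have HH : {in X &, forall x y, prefix (H x) (H y) = prefix x y}.
  move=> x y xX yX; have [xr xp] := rtP x xX; have [yr yp] := rtP y yX.
  have [e|ne] := eqVneq (rt x) (rt y); last first.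
    have -> : prefix x y = false.
      apply/negP => h; move/eqP: ne; apply.
      by rewrite (rtE (rt x) y) //; apply: prefix_trans h.
    apply/negP => h; move/eqP: ne; apply.
    by apply: (sroot _ _ (H y)) => //; [apply: prefix_trans h; exact: Hpre|exact: Hpre].
  have [ex|nx] := eqVneq x (rt x).
    rewrite {1}ex Hroot // e Hpre // ex e; exact/esym.
  have [ey|ny] := eqVneq y (rt y).
    rewrite {1}ey (Hroot (rt y)) //; have := Hbelow x xX nx; rewrite mem_below => /and3P[_ h1 h2].
    rewrite -e; apply/idP/idP => h.
      by rewrite (prefix_anti h h1) eqxx in h2.
    by rewrite ey -e in h; case/eqP: nx; exact: prefix_anti.
  have [h _ _] := hbP _ xr.
  have yb := below_r y yX ny; rewrite -e in yb.
  by rewrite /H (negPf nx) (negPf ny) -e h // below_r.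
exists H; split=> //.
- apply: uniq_perm => //; first by rewrite map_inj_in_uniq //; exact: piso_inj.
  move=> z; apply/mapP/idP => [[y yX ->]|zY]; first exact: HY.
  have [w wY wz] := root_exists zY.
  have : w \in map s (roots X) by rewrite (perm_mem hs1).
  case/mapP=> r rX e; have [ez|nz] := eqVneq z w.
    by exists r; [exact: roots_sub|rewrite Hroot // ez].
  have : z \in below Y (s r) by rewrite mem_below zY -e wz nz.
  have [_ h _] := hbP _ rX; rewrite -(perm_mem h) => /mapP[y yb ->]; exists y.
    by move: yb; rewrite mem_below => /andP[].
  move: yb; rewrite mem_below => /and3P[yX ry ne].
  by rewrite /H (rtE r y) // (negPf ne).
- move=> x xX; have [xr xp] := rtP x xX; have [ex|nx] := eqVneq x (rt x).
    rewrite ex Hroot //; have /eqP := hs2 _ xr; rewrite node_eq => /andP[/eqP-> _] //.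
  rewrite /H (negPf nx); have [_ _ h] := hbP _ xr; exact/h/below_r.
Qed.

(** * Trees as sets of addresses *)

Lemma tree_nested_ind (P : tree -> Prop) :
  (forall ts, foldr (fun t Q => P t /\ Q) True ts -> P (Node ts)) -> forall t, P t.
Proof.
move=> H; fix IH 1 => -[ts]; apply: H; elim: ts => [|t ts IHts]; first exact: I.
by split; [exact: IH|exact: IHts].
Qed.

Fixpoint tcode (t : tree) : nat := let: Node ts := t in node 0 (map tcode ts).

Fixpoint vforest (i : nat) (l : seq tree) : seq address :=
  if l is u :: l' then map (cons i) (verts u) ++ vforest i.+1 l' else [::].

Lemma vertsE ts : verts (Node ts) = [::] :: vforest 0 ts.
Proof. by []. Qed.

Lemma vforestP i ts a : a \in vforest i ts ->
  exists j b, a = j :: b /\ i <= j.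
Proof.
elim: ts i => [|t ts IH] i //=; rewrite mem_cat => /orP[/mapP[b _ ->]|/IH[j [b [-> ij]]]].
  by exists i, b.
by exists j, b; rewrite (ltnW ij).
Qed.

Lemma map_cons_uniq (i : nat) (X : seq address) : uniq (map (cons i) X) = uniq X.
Proof. by apply: map_inj_uniq => x y []. Qed.

Lemma verts_uniq t : uniq (verts t).
Proof.
elim/tree_nested_ind: t => ts H; rewrite vertsE cons_uniq; apply/andP; split.
  by apply/negP => /vforestP[j [b []]].
elim: ts 0 H => [|t ts IH] i //= [ht /(IH i.+1) hts].
rewrite cat_uniq map_cons_uniq ht hts andbT /=.
by apply/hasPn => a /vforestP[j [b [-> ij]]]; apply/mapP => -[x _ [e _]]; rewrite e ltnn in ij.
Qed.

Lemma pcodes_cat k c X Y :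
  {in X & Y, forall x y, ~~ prefix x y && ~~ prefix y x} ->
  pcodes k c (X ++ Y) = pcodes k c X ++ pcodes k c Y.
Proof.
case: k => [|k] //= H; rewrite /roots filter_cat map_cat; congr (_ ++ _).
  set s := (X in map _ X = _); have -> : s = roots X.
    apply: eq_in_filter => x xX; rewrite all_cat; apply: andb_idr => _.
    by apply/allP => y yY; have /andP[_ /negPf->] := H x y xX yY.
  apply/eq_in_map => x /roots_sub xX; congr (node _ (pcodes _ _ _)).
  rewrite /below filter_cat -[RHS]cats0; congr (_ ++ _).
  apply/eqP; rewrite -[_ == _]negbK -has_filter; apply/hasPn => y yY.
  by have /andP[/negPf-> _] := H x y xX yY.
set s := (X in map _ X = _); have -> : s = roots Y.
  apply: eq_in_filter => y yY; rewrite all_cat; apply: andb_idl => _.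
  by apply/allP => x xX; have /andP[/negPf-> _] := H x y xX yY.
apply/eq_in_map => y /roots_sub yY; congr (node _ (pcodes _ _ _)).
rewrite /below filter_cat -[RHS]cat0s; congr (_ ++ _).
apply/eqP; rewrite -[_ == _]negbK -has_filter; apply/hasPn => x xX.
by have /andP[_ /negPf->] := H x y xX yY.
Qed.

Lemma pcodes_root k c X : [::] \notin X ->
  pcodes k.+1 c ([::] :: X) = [:: node (c [::]) (pcodes k c X)].
Proof.
move=> nX /=; have -> : roots ([::] :: X) = [:: [::]].
  rewrite /roots /=; have -> : all (fun y => prefix y [::] ==> (y == [::])) X.
    by apply/allP => -[|y l].
  congr cons; apply/eqP; rewrite -[_ == _]negbK -has_filter; apply/hasPn => y yX /=.
  by case: y yX => // yX; rewrite yX in nX.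
congr [:: node _ (pcodes _ _ _)] => /=.
by apply/all_filterP/allP => -[|y l] //= h; rewrite h in nX.
Qed.

Lemma pcodes_cons k c i X :
  pcodes k c (map (cons i) X) = pcodes k (c \o cons i) X.
Proof. by apply: pcodes_map => // x y _ _; rewrite prefix_cons eqxx. Qed.

Lemma cons_incomparable i (X Y : seq address) : {in Y, forall y, exists j b, y = j :: b /\ i < j} ->
  {in map (cons i) X & Y, forall x y, ~~ prefix x y && ~~ prefix y x}.
Proof.
move=> H x y /mapP[z _ ->] /H [j [b [-> ij]]]; rewrite !prefix_cons.
by rewrite (ltn_eqF ij) eq_sym (ltn_eqF ij).
Qed.

Lemma pcodes_verts k t : nverts t <= k -> pcodes k (fun=> 0) (verts t) = [:: tcode t].
Proof.
elim/tree_nested_ind: t k => ts H [|k]; first by rewrite /nverts vertsE.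
rewrite /nverts vertsE ltnS => hk; rewrite pcodes_root; last first.
  by apply/negP => /vforestP[j [b []]].
congr [:: node _ _]; move: hk.
have : forall i, size (vforest i ts) <= k ->
    pcodes k (fun=> 0) (vforest i ts) = map tcode ts.
  elim: ts H => [|t ts IH] /=; first by case: k.
  move=> [ht hts] i; rewrite size_cat size_map => hk.
  rewrite pcodes_cat; last by apply: cons_incomparable => y /vforestP.
  rewrite pcodes_cons (ht k); last by apply: leq_trans hk; exact: leq_addr.
  by rewrite IH // (leq_trans _ hk) // leq_addl.
exact.
Qed.

Lemma nverts_gt0 t : 0 < nverts t. Proof. by case: t. Qed.

Definition toV (t : tree) (a : address) : vtx t :=
  insubd (Ordinal (nverts_gt0 t)) (index a (verts t)).

Lemma addr_in t (v : vtx t) : addr v \in verts t.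
Proof. by rewrite /addr mem_nth // ltn_ord. Qed.

Lemma toVK t a : a \in verts t -> addr (toV t a) = a.
Proof. by move=> h; rewrite /addr /toV val_insubd /nverts index_mem h nth_index. Qed.

Lemma toV_addr t : cancel (@addr t) (@toV t).
Proof.
move=> v; apply: val_inj; rewrite /toV val_insubd /addr index_uniq ?verts_uniq //.
by rewrite ltn_ord.
Qed.

Definition addrs (t : tree) (U : {set vtx t}) : seq address := [seq addr v | v in U].

Lemma mem_addrs t (U : {set vtx t}) v : (addr v \in addrs U) = (v \in U).
Proof. by rewrite /addrs (fintype.mem_image (can_inj (@toV_addr t))). Qed.

Lemma addrs_sub t (U : {set vtx t}) a : a \in addrs U -> a \in verts t.
Proof. by case/fintype.imageP => v _ ->; exact: addr_in. Qed.

Lemma addrs_uniq t (U : {set vtx t}) : uniq (addrs U).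
Proof. by rewrite map_inj_uniq ?enum_uniq //; exact: can_inj (@toV_addr t). Qed.

Lemma size_addrs t (U : {set vtx t}) : size (addrs U) <= nverts t.
Proof. by rewrite size_map -cardE -[leqRHS]card_ord max_card. Qed.

Lemma mem_addrsT t : addrs [set: vtx t] =i verts t.
Proof.
move=> a; apply/idP/idP => [/addrs_sub//|h].
by rewrite -(toVK h) mem_addrs inE.
Qed.

Lemma perm_addrsT t : perm_eq (addrs [set: vtx t]) (verts t).
Proof. by apply: uniq_perm; [exact: addrs_uniq|exact: verts_uniq|exact: mem_addrsT]. Qed.

(** The bridge between the definitions, whose vertices are ordinals, and the codes, which only see
    addresses. *)
Lemma piso_addrs S T c d (U : {set vtx S}) (U' : {set vtx T}) :
  piso c (addrs U) d (addrs U') <->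
  exists f : {ffun vtx S -> vtx T},
    [/\ {in U &, forall i j, tle (f i) (f j) = tle i j}, f @: U = U' &
        {in U, forall i, d (addr (f i)) = c (addr i)}].
Proof.
split=> [[h [h1 h2 h3]]|[f [f1 f2 f3]]].
  have hU i : i \in U -> h (addr i) \in addrs U'.
    by move=> iU; rewrite -(perm_mem h2) map_f // mem_addrs.
  pose f : {ffun vtx S -> vtx T} := [ffun i => toV T (h (addr i))].
  have fE i : i \in U -> addr (f i) = h (addr i).
    by move=> iU; rewrite ffunE toVK // (addrs_sub (hU i iU)).
  exists f; split.
  - by move=> i j iU jU; rewrite /tle !fE // h1 // mem_addrs.
  - apply/setP => v; rewrite -[v \in U']mem_addrs -(perm_mem h2); apply/imsetP/mapP.
      move=> [i iU ->]; exists (addr i); [by rewrite mem_addrs|exact: fE].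
    case=> a /fintype.imageP[i iU ->] e; exists i => //.
    by apply: (can_inj (@toV_addr T)); rewrite e fE.
  - by move=> i iU; rewrite fE // h3 // mem_addrs.
pose h a := addr (f (toV S a)).
have hh : {in addrs U &, forall x y, prefix (h x) (h y) = prefix x y}.
  by move=> x y /fintype.imageP[i iU ->] /fintype.imageP[j jU ->]; rewrite /h !toV_addr; exact: f1.
exists h; split=> //; last by move=> x /fintype.imageP[i iU ->]; rewrite /h toV_addr f3.
apply: uniq_perm; first by rewrite map_inj_in_uniq ?addrs_uniq //; exact: piso_inj.
  exact: addrs_uniq.
move=> a; apply/mapP/fintype.imageP => [[x /fintype.imageP[i iU ->] ->]|[v vU ->]].
  by exists (f i); rewrite /h ?toV_addr // -f2 imset_f.
move: vU; rewrite -f2 => /imsetP[i iU ->].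
by exists (addr i); rewrite /h ?toV_addr ?mem_addrs.
Qed.

Lemma pisoP S T c d k (U : {set vtx S}) (U' : {set vtx T}) :
  nverts S <= k -> nverts T <= k ->
  perm_eq (pcodes k c (addrs U)) (pcodes k d (addrs U')) <->
  exists f : {ffun vtx S -> vtx T},
    [/\ {in U &, forall i j, tle (f i) (f j) = tle i j}, f @: U = U' &
        {in U, forall i, d (addr (f i)) = c (addr i)}].
Proof.
move=> kS kT; split=> [h|/piso_addrs]; last exact: piso_pcodes.
apply/piso_addrs; apply: (pcodes_piso (addrs_uniq U) (addrs_uniq U') _ _ h).
  exact: leq_trans (size_addrs U) kS.
exact: leq_trans (size_addrs U') kT.
Qed.

Lemma tle_anti t (i j : vtx t) : tle i j -> tle j i -> i = j.
Proof. by move=> h1 h2; apply: (can_inj (@toV_addr t)); apply: prefix_anti. Qed.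

Lemma tle_refl t (i : vtx t) : tle i i.
Proof. exact: prefix_refl. Qed.

(* [setT] denotes the classical full set in [is_emb]. *)
Lemma imset_classicalT (aT rT : finType) (f : aT -> rT) :
  f @: (@classical_sets.setT aT) = f @: [set: aT]%SET.
Proof.
apply/setP => v; apply/imsetP/imsetP => -[x _ ->]; exists x => //.
exact: classical_sets.in_setT.
Qed.

Lemma is_embP S T (U : {set vtx T}) k : nverts S <= k -> nverts T <= k ->
  is_emb S U = perm_eq [:: tcode S] (pcodes k (fun=> 0) (addrs U)).
Proof.
move=> kS kT; rewrite -(pcodes_verts kS).
rewrite -(permPl (pcodes_perm k (fun=> 0) (perm_addrsT S))).
apply/existsP/idP => [[f /and3P[_ /eqP f2 /forallP f3]]|].
  apply/pisoP => //; exists f; split=> [i j _ _||//]; last by rewrite -imset_classicalT.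
  by have /forallP/(_ j)/eqP := f3 i.
move/(pisoP (fun=> 0) (fun=> 0) _ _ kS kT) => [f [f1 f2 _]]; exists f; apply/and3P; split.
- apply/injectiveP => i j e; apply: tle_anti; rewrite -f1 ?inE // e; exact: tle_refl.
- by rewrite imset_classicalT; exact/eqP.
- by apply/forallP => i; apply/forallP => j; rewrite f1 ?inE.
Qed.

Lemma tisoP S T : tiso S T = (tcode S == tcode T).
Proof.
pose k := nverts S + nverts T.
have kS : nverts S <= k by exact: leq_addr.
have kT : nverts T <= k by exact: leq_addl.
transitivity (perm_eq [:: tcode S] [:: tcode T]); last first.
  by apply/idP/eqP => [/perm_mem/(_ (tcode S))|->] //; rewrite !inE eqxx => /esym/eqP.
rewrite -(pcodes_verts kS) -(pcodes_verts kT).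
rewrite -(permPl (pcodes_perm k (fun=> 0) (perm_addrsT S))).
rewrite -(permPr (pcodes_perm k (fun=> 0) (perm_addrsT T))).
apply/andP/idP => [[/eqP e /existsP[f /andP[/injectiveP fi /forallP f2]]]|].
  apply/pisoP => //; exists f; split=> // [i j _ _|].
    by have /forallP/(_ j)/eqP := f2 i.
  by apply/eqP; rewrite eqEcard finset.subsetT /= card_imset // !cardsT !card_ord e.
move/(pisoP (fun=> 0) (fun=> 0) _ _ kS kT) => [f [f1 f2 _]].
have fi : injective f.
  by move=> i j e; apply: tle_anti; rewrite -f1 ?inE // e; exact: tle_refl.
split; first by rewrite -[X in X == _]card_ord -cardsT -(card_imset _ fi) f2 cardsT card_ord.
apply/existsP; exists f; apply/andP; split; first exact/injectiveP.
by apply/forallP => i; apply/forallP => j; rewrite f1 ?inE.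
Qed.

(** An automorphism carrying [U] to [U'] is the same as an isomorphism of [T] onto itself that
    respects the colourings by membership in [U] and in [U']. *)
Lemma aut_equivP T (U U' : {set vtx T}) k : nverts T <= k ->
  aut_equiv U U' = perm_eq (pcodes k (fun a => a \in addrs U : nat) (verts T))
                           (pcodes k (fun a => a \in addrs U' : nat) (verts T)).
Proof.
move=> kT.
rewrite -(permPl (pcodes_perm k _ (perm_addrsT T))).
rewrite -(permPr (pcodes_perm k _ (perm_addrsT T))).
apply/existsP/idP => [[g /andP[/forallP g1 /eqP g2]]|].
  apply/pisoP => //; exists (finfun g); split=> [i j _ _||i _].
  - by rewrite !ffunE; have /forallP/(_ j)/eqP := g1 i.
  - apply/setP => v; rewrite inE; apply/imsetP; exists ((g^-1)%g v) => //.
    by rewrite ffunE permKV.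
  - by rewrite ffunE !mem_addrs -g2 mem_imset //; exact: perm_inj.
move/(pisoP _ _ _ _ kT kT) => [f [f1 f2 f3]].
have fi : injective f.
  by move=> i j e; apply: tle_anti; rewrite -f1 ?inE // e; exact: tle_refl.
exists (perm fi); apply/andP; split.
  by apply/forallP => i; apply/forallP => j; rewrite !permE f1 ?inE.
apply/eqP/setP => v.
have [w ->] : exists w, v = perm fi w by exists ((perm fi)^-1%g v); rewrite permKV.
rewrite mem_imset; last exact: perm_inj.
have := f3 w (finset.in_setT _); rewrite -permE !mem_addrs => h.
by move: h; do 2 case: (_ \in _).
Qed.

(** * Marked binary trees *)

Inductive mtree := ML of bool | MN of bool & mtree & mtree.

HB.instance Definition _ := gen_eqMixin mtree.
HB.instance Definition _ := gen_eqMixin tree.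

Fixpoint msize (m : mtree) : nat :=
  if m is MN _ l r then (msize l + msize r).+1 else 0.

Fixpoint shape (m : mtree) : tree :=
  if m is MN _ l r then Node [:: shape l; shape r] else Node [::].

Definition rootmark (m : mtree) : bool := match m with ML b => b | MN b _ _ => b end.

Fixpoint marked (m : mtree) : seq address :=
  match m with
  | ML b => nseq b [::]
  | MN b l r => nseq b [::] ++ (map (cons 0) (marked l) ++ map (cons 1) (marked r))
  end.

Fixpoint mk (t : tree) (c : address -> bool) : mtree :=
  if t is Node [:: l; r] then MN (c [::]) (mk l (c \o cons 0)) (mk r (c \o cons 1))
  else ML (c [::]).

(* [mcode m] is the isomorphism type of the marked non-plane tree [m], and
   [fcode m] the isomorphism type of the forest of its marked vertices. *)
Fixpoint mcode (m : mtree) : nat :=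
  match m with
  | ML b => node b [::]
  | MN b l r => node b [:: mcode l; mcode r]
  end.

Fixpoint fcode (m : mtree) : seq nat :=
  match m with
  | ML b => nseq b (node 0 [::])
  | MN b l r => if b then [:: node 0 (fcode l ++ fcode r)] else fcode l ++ fcode r
  end.

Arguments verts : simpl never.

Lemma verts_ML b : verts (shape (ML b)) = [:: [::]].
Proof. by []. Qed.

Lemma verts_MN b l r : verts (shape (MN b l r)) =
  [::] :: (map (cons 0) (verts (shape l)) ++ map (cons 1) (verts (shape r))).
Proof. by rewrite /= vertsE /= cats0. Qed.

Lemma nverts_shape m : nverts (shape m) = (msize m).*2.+1.
Proof.
elim: m => [b|b l IHl r IHr] //; rewrite /nverts verts_MN in IHl IHr *.
by rewrite /= size_cat !size_map IHl IHr; lia.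
Qed.

Lemma shape_mk m c : shape (mk (shape m) c) = shape m.
Proof. by elim: m c => [b|b l IHl r IHr] c //=; rewrite IHl IHr. Qed.

Lemma rootmark_mk m c : rootmark (mk (shape m) c) = c [::].
Proof. by case: m. Qed.

Lemma eq_mk m c d : {in verts (shape m), c =1 d} -> mk (shape m) c = mk (shape m) d.
Proof.
elim: m c d => [b|b l IHl r IHr] c d H; rewrite ?(verts_ML, verts_MN) in H; rewrite /= H //.
by congr MN; [apply: IHl|apply: IHr] => a ha; apply: H;
  rewrite inE mem_cat map_f ?orbT.
Qed.

Lemma marked_sub m : {subset marked m <= verts (shape m)}.
Proof.
elim: m => [[]|b l IHl r IHr] // a; rewrite verts_MN inE !mem_cat.
case/or3P => [|/mapP[x /IHl h ->]|/mapP[x /IHr h ->]].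
- by case: b => //; rewrite inE => ->.
- by rewrite map_f // orbT.
- by rewrite map_f // !orbT.
Qed.

Lemma cons_notin_map (i j : nat) a X : i != j -> (i :: a \in map (cons j) X) = false.
Proof. by move=> ne; apply/negP => /mapP[x _ [e _]]; rewrite e eqxx in ne. Qed.

Lemma nil_notin_map (i : nat) X : ([::] \in map (cons i) X) = false.
Proof. by apply/negP => /mapP[]. Qed.

Lemma mem_map_cons (i : nat) a X : (i :: a \in map (cons i) X) = (a \in X).
Proof. by rewrite mem_map // => x y []. Qed.

Lemma mk_marked m : mk (shape m) (fun a => a \in marked m) = m.
Proof.
elim: m => [[]|b l IHl r IHr] //=; rewrite !mem_cat !nil_notin_map !orbF.
have -> : ([::] \in nseq b [::]) = b by case: b.
congr MN; rewrite -[RHS](IHl, IHr); apply: eq_mk => a _ /=;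
  rewrite !mem_cat mem_map_cons cons_notin_map // ?orbF /=.
  by case: b.
by case: b.
Qed.

Lemma marked_uniq m : uniq (marked m).
Proof.
elim: m => [[]|b l IHl r IHr] //=; rewrite !cat_uniq !map_cons_uniq IHl IHr andbT.
apply/and3P; split; first by case: b.
  by apply/hasPn => a; rewrite mem_cat => /orP[]/mapP[x _ ->]; case: b.
by apply/hasPn => a /mapP[x _ ->]; rewrite cons_notin_map.
Qed.

Lemma mem_marked_mk m c a : a \in verts (shape m) ->
  (a \in marked (mk (shape m) c)) = c a.
Proof.
elim: m c a => [b|b l IHl r IHr] c a; rewrite ?(verts_ML, verts_MN) inE.
  by move/eqP => -> /=; case: (c _).
rewrite mem_cat => /or3P[/eqP->|/mapP[x h ->]|/mapP[x h ->]].
- by rewrite !mem_cat !nil_notin_map !orbF; case: (c _).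
- rewrite !mem_cat mem_map_cons cons_notin_map // orbF IHl //=.
  by case: (c [::]).
- rewrite !mem_cat mem_map_cons cons_notin_map // IHr //=.
  by case: (c [::]).
Qed.

Lemma pcodes_shape m k (c : address -> bool) : nverts (shape m) <= k ->
  pcodes k (fun a => c a : nat) (verts (shape m)) = [:: mcode (mk (shape m) c)].
Proof.
elim: m k c => [b|b l IHl r IHr] k c.
  by case: k => // k _; rewrite verts_ML pcodes_root //; case: k.
case: k => // k; rewrite /nverts verts_MN [size _]/= ltnS size_cat !size_map => hk.
rewrite pcodes_root; last by rewrite mem_cat !nil_notin_map.
rewrite pcodes_cat; last first.
  by apply: cons_incomparable => y /mapP[x _ ->]; exists 1, x.
by rewrite !pcodes_cons (IHl _ (c \o cons 0)) ?(IHr _ (c \o cons 1)) //;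
  rewrite (leq_trans _ hk) // ?leq_addl ?leq_addr.
Qed.

Lemma pcodes_marked m k : nverts (shape m) <= k ->
  pcodes k (fun=> 0) (marked m) = fcode m.
Proof.
elim: m k => [b|b l IHl r IHr] [|k] //.
  by case: b => //= _; case: k.
rewrite /nverts verts_MN [size _]/= ltnS size_cat !size_map => hk.
have hc k' : k <= k' -> pcodes k' (fun=> 0) (map (cons 0) (marked l) ++ map (cons 1) (marked r)) =
    fcode l ++ fcode r.
  move=> kk; rewrite pcodes_cat; last first.
    by apply: cons_incomparable => y /mapP[x _ ->]; exists 1, x.
  rewrite !pcodes_cons IHl ?IHr //; apply: leq_trans kk; apply: leq_trans hk;
  by rewrite ?leq_addl ?leq_addr.
case: b => /=; last exact: (hc k.+1).
rewrite -(hc k) //; apply: (@pcodes_root k (fun=> 0)).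
by rewrite mem_cat !nil_notin_map.
Qed.

Lemma perm_eq_pair (T : eqType) (a b c d : T) :
  perm_eq [:: a; b] [:: c; d] = (a == c) && (b == d) || (a == d) && (b == c).
Proof.
apply/idP/idP => [h|/orP[/andP[/eqP-> /eqP->]|/andP[/eqP-> /eqP->]] //]; last first.
  by rewrite (perm_catC [:: d] [:: c]).
have := perm_mem h a; rewrite !inE eqxx /= => /esym/orP[]/eqP e; subst a.
  by move: h; rewrite perm_cons => /perm_mem/(_ b); rewrite !inE !eqxx => <-.
move: h; rewrite perm_sym (perm_catC [:: c] [:: d]) perm_cons.
by move=> /perm_mem/(_ c); rewrite !inE !eqxx => /esym/eqP->; rewrite eqxx orbT.
Qed.

Lemma mcode_MN b l r b' l' r' : (mcode (MN b l r) == mcode (MN b' l' r')) =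
  (b == b') && ((mcode l == mcode l') && (mcode r == mcode r') ||
                (mcode l == mcode r') && (mcode r == mcode l')).
Proof. by rewrite node_eq perm_eq_pair; case: b; case: b'. Qed.

Lemma mcode_ML b m : mcode m = mcode (ML b) -> m = ML b.
Proof.
case: m => [b'|b' l r] /eqP; rewrite /= node_eq => /andP[/eqP e] //.
  by case: b b' e => -[].
by move/perm_size.
Qed.

Lemma mcode_shape m m' : mcode m = mcode m' -> tcode (shape m) = tcode (shape m').
Proof.
elim: m m' => [b|b l IHl r IHr] m'.
  by move/esym/mcode_ML => ->.
case: m' => [b'|b' l' r'] /eqP; first by move/eqP/mcode_ML.
rewrite mcode_MN => /andP[_ h]; apply/eqP; rewrite /= node_eq eqxx /= perm_eq_pair.
by case/orP: h => /andP[/eqP h1 /eqP h2];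
  rewrite (IHl _ h1) (IHr _ h2) !eqxx ?orbT.
Qed.

Lemma mcode_fcode m m' : mcode m = mcode m' -> perm_eq (fcode m) (fcode m').
Proof.
elim: m m' => [b|b l IHl r IHr] m'.
  by move/esym/mcode_ML => ->.
case: m' => [b'|b' l' r'] /eqP; first by move/eqP/mcode_ML.
rewrite mcode_MN => /andP[/eqP<- h] /=.
have {}h : perm_eq (fcode l ++ fcode r) (fcode l' ++ fcode r').
  case/orP: h => /andP[/eqP h1 /eqP h2].
    by apply: perm_cat; [exact: IHl|exact: IHr].
  by rewrite perm_sym perm_catC perm_sym; apply: perm_cat; [exact: IHl|exact: IHr].
case: b => //; have /eqP -> // : node 0 (fcode l ++ fcode r) == node 0 (fcode l' ++ fcode r').
by rewrite node_eq eqxx.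
Qed.

Lemma mcode_rootmark m m' : mcode m = mcode m' -> rootmark m = rootmark m'.
Proof.
by case: m => [b|b l r]; case: m' => [b'|b' l' r'] /eqP;
  rewrite /= node_eq => /andP[/eqP e _]; case: b b' e => -[].
Qed.

(* Every isomorphism class of marked trees has exactly one member that is
   canonical in this sense, which turns orbit counting into plain counting. *)
Fixpoint can (m : mtree) : bool :=
  if m is MN _ l r then [&& can l, can r & mcode l <= mcode r] else true.

(** If the branches match crosswise, the order of codes in both trees forces the codes of the two
    branches to be equal, so they also match straight. *)
Lemma can_inj_mcode m m' : can m -> can m' -> mcode m = mcode m' -> m = m'.
Proof.
elim: m m' => [b|b l IHl r IHr] m' cm cm'.
  by move/esym/mcode_ML.
case: m' cm' => [b'|b' l' r'] cm' /eqP; first by move/eqP/mcode_ML.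
rewrite mcode_MN => /andP[/eqP<- h].
case/and3P: cm => cl cr hl; case/and3P: cm' => cl' cr' hl'.
suff /andP[/eqP h1 /eqP h2] : (mcode l == mcode l') && (mcode r == mcode r').
  by rewrite (IHl l') // (IHr r').
case/orP: h => // /andP[/eqP h1 /eqP h2].
rewrite h1 h2 in hl *.
by rewrite (@anti_leq (mcode r') (mcode l')) ?eqxx // hl hl'.
Qed.

Lemma can_exists m : exists2 m', can m' & mcode m' = mcode m.
Proof.
elim: m => [b|b l [l' cl el] r [r' cr er]]; first by exists (ML b).
have [h|h] := leqP (mcode l') (mcode r').
  by exists (MN b l' r'); rewrite /= ?cl ?cr ?h ?el ?er.
exists (MN b r' l'); first by rewrite /= cl cr ltnW.
by apply/eqP; rewrite mcode_MN el er !eqxx orbT.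
Qed.

(** A canonical marked tree may have another plane shape than the tree under consideration; its
    marks can be transported to any plane tree of the same isomorphism type. *)
Lemma mcode_lift m m0 : tcode (shape m) = tcode (shape m0) ->
  exists2 m', shape m' = shape m0 & mcode m' = mcode m.
Proof.
elim: m0 m => [b|b l IHl r IHr] [b'|b' l' r'] /eqP; rewrite /= node_eq eqxx /=.
- by exists (ML b').
- by move/perm_size.
- by move/perm_size.
rewrite perm_eq_pair => /orP[]/andP[/eqP h1 /eqP h2].
  have [l2 sl el] := IHl _ h1; have [r2 sr er] := IHr _ h2.
  by exists (MN b' l2 r2); rewrite /= ?sl ?sr ?el ?er.
have [r2 sr er] := IHr _ h1; have [l2 sl el] := IHl _ h2.
exists (MN b' l2 r2); first by rewrite /= sl sr.
by apply/eqP; rewrite mcode_MN el er !eqxx orbT.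
Qed.

(** * Orbits counted as canonical marked trees *)

Definition mset (T : tree) (U : {set vtx T}) : mtree := mk T (fun a => a \in addrs U).

Fixpoint mtrees_rec (f k : nat) : seq mtree :=
  if f is f'.+1 then
    if k is k'.+1 then
      flatten [seq flatten [seq [seq MN b l r | l <- mtrees_rec f' i, r <- mtrees_rec f' (k' - i)]
                           | i <- iota 0 k'.+1] | b <- [:: true; false]]
    else [:: ML true; ML false]
  else [::].

Definition mtrees (k : nat) : seq mtree := mtrees_rec k.+1 k.

Lemma mtrees_recS f k : mtrees_rec f.+1 k.+1 =
  flatten [seq flatten [seq [seq MN b l r | l <- mtrees_rec f i, r <- mtrees_rec f (k - i)]
                       | i <- iota 0 k.+1] | b <- [:: true; false]].
Proof. by []. Qed.

Lemma mtrees_rec_size f k m : m \in mtrees_rec f k -> msize m = k.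
Proof.
elim: f k m => [|f IH] [|k] m //.
  by rewrite /= !inE => /orP[]/eqP->.
rewrite mtrees_recS => /flatten_mapP[b _ /flatten_mapP[i]].
rewrite mem_iota /= => ik /allpairsP[[l r] /= [/IH sl /IH sr ->]] /=.
by rewrite sl sr; lia.
Qed.

Lemma mtrees_rec_mem f m : msize m < f -> m \in mtrees_rec f (msize m).
Proof.
elim: f m => [|f IH] [b|b l r] // h; first by rewrite /= !inE; case: (b); rewrite eqxx ?orbT.
rewrite [msize _]/= in h *; rewrite mtrees_recS.
apply/flatten_mapP; exists b; first by case: b; rewrite !inE.
apply/flatten_mapP; exists (msize l); first by rewrite mem_iota; lia.
by apply/allpairsP; exists (l, r); split=> //=; rewrite ?addKn; apply: IH; lia.
Qed.

Lemma mem_mtrees k m : (m \in mtrees k) = (msize m == k).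
Proof.
by apply/idP/eqP => [/mtrees_rec_size//|<-]; apply: mtrees_rec_mem.
Qed.

Lemma mtrees_rec_uniq f k : uniq (mtrees_rec f k).
Proof.
elim: f k => [|f IH] [|k] //; first by rewrite /= inE andbT; apply/eqP.
rewrite mtrees_recS; set g := (X in map X _).
have H b : uniq (g b).
  rewrite /g {g}.
  have := iota_uniq 0 k.+1; elim: (iota 0 k.+1) => //= i s IHs /andP[ins us].
  rewrite cat_uniq IHs // andbT; apply/andP; split.
    by apply: allpairs_uniq => // -[l r] [l' r'] _ _ [-> ->].
  apply/hasPn => m /flatten_mapP[j js /allpairsP[[l r] /= [lj _ ->]]].
  apply/allpairsP => -[[l' r'] /= [li _ [e _]]].
  by rewrite -(mtrees_rec_size li) -e (mtrees_rec_size lj) js in ins.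
rewrite [map _ _]/= [flatten _]/= cats0 cat_uniq !H andbT /=; apply/hasPn => m /flatten_mapP[i _ /allpairsP[x [_ _ ->]]].
by apply/negP => /flatten_mapP[j _ /allpairsP[y [_ _]]].
Qed.

Lemma mtrees_uniq k : uniq (mtrees k).
Proof. exact: mtrees_rec_uniq. Qed.

Lemma bt_shape f n T : T \in bt f n -> exists2 m, shape m = T & n = (msize m).*2.+1.
Proof.
elim: f n T => [|f IH] n T //=.
case: eqP => [->|n1]; first by rewrite inE => /eqP->; exists (ML true).
case/flatten_mapP => k; rewrite mem_iota => hk /allpairsP[[l r] /= [/IH[m1 <- e1]]].
by move=> /IH[m2 <- e2] ->; exists (MN true m1 m2) => //=; lia.
Qed.

Lemma shape_bt f m : (msize m).*2.+1 <= f -> shape m \in bt f (msize m).*2.+1.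
Proof.
elim: f m => [|f IH] m //; case: m => [b|b l r] h; first by rewrite /= inE eqxx.
rewrite [msize _]/= in h *.
pose F n := flatten [seq [seq Node [:: l0; r0] | l0 <- bt f k, r0 <- bt f (n.-1 - k)] | k <- iota 1 n.-2].
rewrite -[bt _ _]/(F (msize l + msize r).+1.*2.+1).
apply/flatten_mapP; exists (msize l).*2.+1; first by rewrite mem_iota; lia.
apply/allpairsP; exists (shape l, shape r); split=> //=; first by apply: IH; lia.
have -> : (msize l + msize r).+1.*2 - (msize l).*2.+1 = (msize r).*2.+1 by lia.
by apply: IH; lia.
Qed.

Lemma mem_pbintrees k T : (T \in pbintrees k.*2.+1) <->
  exists2 m, shape m = T & msize m = k.
Proof.
split=> [/bt_shape[m <- e]|[m <- <-]]; first by exists m => //; lia.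
exact: shape_bt.
Qed.

Lemma mset_marked m : exists U : {set vtx (shape m)}, mset U = m.
Proof.
exists [set v | addr v \in marked m]; rewrite -[RHS]mk_marked; apply: eq_mk => a am.
by rewrite -(toVK am) mem_addrs inE.
Qed.

Lemma marked_mset m (U : {set vtx (shape m)}) : perm_eq (marked (mset U)) (addrs U).
Proof.
apply: uniq_perm; [exact: marked_uniq|exact: addrs_uniq|move=> a].
have [h|h] := boolP (a \in verts (shape m)); first by rewrite mem_marked_mk.
apply/idP/idP => [/marked_sub|/addrs_sub]; last by rewrite (negPf h).
by rewrite shape_mk (negPf h).
Qed.

Lemma perm_eq1 (T : eqType) (a b : T) : perm_eq [:: a] [:: b] = (a == b).
Proof.
by apply/idP/eqP => [/perm_mem/(_ a)|->] //; rewrite !inE eqxx => /esym/eqP.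
Qed.

Lemma aut_equiv_mcode m (U U' : {set vtx (shape m)}) :
  aut_equiv U U' = (mcode (mset U) == mcode (mset U')).
Proof. by rewrite (aut_equivP U U' (leqnn _)) !pcodes_shape // perm_eq1. Qed.

Lemma is_emb_fcode S m (U : {set vtx (shape m)}) :
  is_emb S U = perm_eq (fcode (mset U)) [:: tcode S].
Proof.
rewrite (is_embP U (leq_addr (nverts (shape m)) _) (leq_addl _ _)) perm_sym.
rewrite -(permPl (pcodes_perm _ _ (marked_mset U))) pcodes_marked //.
by rewrite shape_mk leq_addl.
Qed.

Lemma card_classes (aT : finType) (A : {set aT}) (f : aT -> nat) :
  #|[set [set y in A | f x == f y] | x in A]| = size (undup [seq f x | x in A]).
Proof.
pose g x := [set y in A | f x == f y].
pose h (B : {set aT}) := if [pick y in B] is Some y then f y else 0.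
have hg x : x \in A -> h (g x) = f x.
  move=> xA; rewrite /h; case: pickP => [y|/(_ x)]; first by rewrite !inE => /andP[_ /eqP].
  by rewrite !inE xA eqxx.
rewrite cardE -(size_map h); apply/perm_size/uniq_perm; last first.
- move=> n; rewrite mem_undup; apply/mapP/fintype.imageP => [[B]|[x xA ->]].
    by rewrite mem_enum => /imsetP[x xA ->] ->; exists x; rewrite // hg.
  by exists (g x); rewrite ?hg // mem_enum imset_f.
- exact: undup_uniq.
rewrite map_inj_in_uniq ?enum_uniq // => B C.
rewrite !mem_enum => /imsetP[x xA ->] /imsetP[y yA ->]; rewrite !hg // => e.
by apply/setP => z; rewrite !inE e.
Qed.

(** Orbits correspond to values of [mcode] on marked copies of the plane tree. Each value is
    attained by exactly one canonical tree ([can_exists], [can_inj_mcode]), and conversely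
    [mcode_lift] brings each canonical tree of this isomorphism type back to the given plane
    tree. *)
Lemma norbits_count m0 (A : {set {set vtx (shape m0)}}) (Q : pred mtree) :
  (forall U, (U \in A) = Q (mset U)) ->
  (forall m m', mcode m = mcode m' -> Q m = Q m') ->
  norbits A = count (fun m => [&& can m, Q m & tcode (shape m) == tcode (shape m0)])
                    (mtrees (msize m0)).
Proof.
move=> AQ Qi; pose f (U : {set vtx (shape m0)}) := mcode (mset U).
have -> : norbits A = #|[set [set U' in A | f U == f U'] | U in A]|.
  rewrite /norbits; congr #|pred_of_set _|; apply: eq_imset => U.
  by apply/setP => U'; rewrite !inE aut_equiv_mcode.
rewrite card_classes -size_filter; set s := [seq m <- _ | _].
rewrite -(size_map mcode s); apply/perm_size/uniq_perm; first exact: undup_uniq.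
  rewrite map_inj_in_uniq ?filter_uniq ?mtrees_uniq // => m m'.
  by rewrite !mem_filter => /andP[/and3P[cm _ _] _] /andP[/and3P[cm' _ _] _]; apply: can_inj_mcode.
move=> n; rewrite mem_undup; apply/fintype.imageP/mapP => [[U UA ->]|[m]].
  have [m cm em] := can_exists (mset U); exists m => //.
  rewrite mem_filter cm (Qi _ _ em) -AQ UA (mcode_shape em) shape_mk eqxx /= mem_mtrees.
  suff : (msize m).*2.+1 = (msize m0).*2.+1 by move=> h; apply/eqP; lia.
  rewrite -!nverts_shape; have : tiso (shape m) (shape m0).
    by rewrite tisoP (mcode_shape em) shape_mk.
  by case/andP => /eqP.
rewrite mem_filter => /andP[/and3P[cm Qm /eqP st] _] ->.
have [m' sm' em'] := mcode_lift st.
subst n || idtac.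
have [U eU] := mset_marked m'.
move: U eU; rewrite sm' => U eU.
by exists U; rewrite /f ?AQ eU ?em' // (Qi _ _ em').
Qed.

(** After exchanging the sums, a marked tree collects the reciprocal of the size of its plane
    isomorphism class once for each member of that class, hence 1 in total. *)
Lemma sumV_count (R : numFieldType) k (N : tree -> nat) (Q : pred mtree) :
  (forall m0, msize m0 = k ->
     N (shape m0) = count (fun m => Q m && (tcode (shape m) == tcode (shape m0))) (mtrees k)) ->
  sumV R k.*2.+1 N = (count Q (mtrees k))%:R%R.
Proof.
move=> H; rewrite /sumV.
transitivity (\sum_(T <- pbintrees k.*2.+1) \sum_(m <- mtrees k | Q m && (tcode (shape m) == tcode T))
   ((count (fun T' => tcode T' == tcode T) (pbintrees k.*2.+1))%:R^-1 : R))%R.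
  rewrite big_seq [RHS]big_seq; apply: eq_bigr => T /mem_pbintrees[m0 sm0 hm0].
  rewrite -{1}sm0 (H _ hm0) sm0 big_const_seq iter_addr_0 mulr_natl.
  congr (_^-1%R *+ _)%R; congr (_%:R)%R; apply: eq_count => T'.
  by rewrite tisoP eq_sym.
rewrite (exchange_big_dep Q) /=; last by move=> T m _ /andP[].
rewrite -sum1_count natr_sum big_seq_cond [RHS]big_seq_cond; apply: eq_bigr => m /andP[].
rewrite mem_mtrees => /eqP hm Qm.
rewrite (eq_bigl (fun T => tcode T == tcode (shape m))); last first.
  by move=> T; rewrite Qm eq_sym.
rewrite (eq_bigr (fun=> (count (fun T' => tcode T' == tcode (shape m)) (pbintrees k.*2.+1))%:R^-1))%R.
  rewrite big_const_seq iter_addr_0 -[LHS]mulr_natr mulVf // pnatr_eq0 -lt0n -has_count.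
  apply/hasP; exists (shape m) => //; apply/mem_pbintrees; by exists m.
move=> T /eqP e; congr (_%:R^-1)%R; apply: eq_count => T'; by rewrite e.
Qed.

Definition cnt (Q : pred mtree) (k : nat) : nat := count (fun m => can m && Q m) (mtrees k).

Lemma aV_cnt (R : numFieldType) k S :
  aV R k.*2.+1 S = (cnt (fun m => perm_eq (fcode m) [:: tcode S]) k)%:R%R.
Proof.
apply: sumV_count => m0 <-.
rewrite [nemb _ _](@norbits_count _ _ (fun m => perm_eq (fcode m) [:: tcode S])).
- by apply: eq_count => m; rewrite andbA.
- by move=> U; rewrite inE is_emb_fcode.
- by move=> m m' /mcode_fcode/permPl.
Qed.

Lemma gV_cnt (R : numFieldType) k S :
  gV R k.*2.+1 S = (cnt (fun m => rootmark m && perm_eq (fcode m) [:: tcode S]) k)%:R%R.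
Proof.
apply: sumV_count => m0 <-.
rewrite [ngood _ _](@norbits_count _ _ (fun m => rootmark m && perm_eq (fcode m) [:: tcode S])).
- by apply: eq_count => m; rewrite -!andbA.
- move=> U; rewrite inE is_emb_fcode andbC rootmark_mk; congr (_ && _).
  apply/existsP/idP => [[v /andP[vU /eqP h]]|h]; first by rewrite -h mem_addrs.
  exists (toV _ [::]); have h' := addrs_sub h.
  by rewrite /is_root -mem_addrs toVK ?eqxx ?andbT.
- by move=> m m' e; rewrite (mcode_rootmark e) (permPl (mcode_fcode e)).
Qed.

(** * Recursion at the root *)

Lemma mtrees_rec_perm f i : i < f -> perm_eq (mtrees_rec f i) (mtrees i).
Proof.
move=> h; apply: uniq_perm; [exact: mtrees_rec_uniq|exact: mtrees_uniq|move=> m].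
rewrite mem_mtrees; apply/idP/eqP => [/mtrees_rec_size//|e].
by rewrite -e; apply: mtrees_rec_mem; rewrite e.
Qed.

Lemma cntE Q k : cnt Q k = \sum_(m <- mtrees k) (can m && Q m : nat).
Proof. by rewrite /cnt -sum1_count big_mkcond; apply: eq_bigr => m _; case: ifP. Qed.

Lemma cnt0 Q : cnt Q 0 = Q (ML true) + Q (ML false).
Proof. by rewrite /cnt /= addn0. Qed.

Lemma cntS Q k : cnt Q k.+1 =
  \sum_(b <- [:: true; false]) \sum_(i < k.+1) \sum_(l <- mtrees i)
     \sum_(r <- mtrees (k - i)) (can (MN b l r) && Q (MN b l r) : nat).
Proof.
rewrite /cnt -sum1_count big_mkcond /mtrees mtrees_recS big_flatten big_map.
apply: eq_bigr => b _; rewrite big_flatten big_map -[iota _ _]/(index_iota 0 k.+1) big_mkord.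
apply: eq_bigr => i _; rewrite big_allpairs_dep.
rewrite (perm_big _ (mtrees_rec_perm (ltn_ord i))) /=; apply: eq_bigr => l _.
have h : k - i < k.+1 by lia.
rewrite (perm_big _ (mtrees_rec_perm h)) /=; apply: eq_bigr => r _.
by case: ifP.
Qed.

(* The numbers of marked non-plane trees with k internal nodes whose marked
   vertices form the forest F: all of them, and those with unmarked root. *)
Definition acnt (F : seq nat) : nat -> nat := cnt (fun m => perm_eq (fcode m) F).
Definition pcnt (F : seq nat) : nat -> nat :=
  cnt (fun m => ~~ rootmark m && perm_eq (fcode m) F).

(** Erasing the mark at the root is a bijection: a marked root is the root of the only tree of the
    induced forest, and canonicity does not see the mark. *)
Lemma gcnt_pcnt L k :
  cnt (fun m => rootmark m && perm_eq (fcode m) [:: node 0 L]) k = pcnt L k.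
Proof.
case: k => [|k].
  by rewrite /pcnt !cnt0 /= perm_eq1 node_eq eqxx addn0.
rewrite /pcnt !cntS !big_cons !big_nil /=.
rewrite [X in _ + (X + _) = _]big1 ?[X in _ = X + _]big1 ?addn0 ?add0n; first last.
- by move=> i _; apply: big1 => l _; apply: big1 => r _; rewrite andbF.
- by move=> i _; apply: big1 => l _; apply: big1 => r _; rewrite andbF.
apply: eq_bigr => i _; apply: eq_bigr => l _; apply: eq_bigr => r _.
by rewrite perm_eq1 node_eq eqxx.
Qed.

Lemma acnt_root F k : acnt F k =
  cnt (fun m => rootmark m && perm_eq (fcode m) F) k + pcnt F k.
Proof.
rewrite /acnt /pcnt /cnt -count_predUI [X in _ + X](_ : _ = 0) ?addn0.
  by apply: eq_count => m /=; case: (rootmark m); rewrite /= ?andbF ?orbF.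
by apply/eqP; rewrite -leqn0 leqNgt -has_count; apply/hasPn => m _ /=;
  case: (rootmark m); rewrite ?andbF.
Qed.

Lemma acnt_node L k : acnt [:: node 0 L] k = pcnt L k + pcnt [:: node 0 L] k.
Proof. by rewrite acnt_root gcnt_pcnt. Qed.

Lemma acnt_pcnt F k : size F != 1 -> acnt F k = pcnt F k.
Proof.
move=> h; rewrite acnt_root /cnt (eq_count (a2 := pred0)) ?count_pred0 // => m /=.
apply/negP => /and3P[_ rm /perm_size e]; rewrite -e in h.
by case: m rm h {e} => [[]|[]].
Qed.

Lemma acnt_perm F F' k : perm_eq F F' -> acnt F k = acnt F' k.
Proof. by move=> h; apply: eq_count => m; rewrite (permPr h). Qed.

(** Sorted lists stand for multisets, so every ordered splitting of the multiset [F] into two parts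
    occurs exactly once. *)
Definition splits (F : seq nat) : seq (seq nat * seq nat) :=
  undup [seq (sort leq (take i s), sort leq (drop i s))
        | s <- permutations F, i <- iota 0 (size F).+1].

Lemma splits_perm F p : p \in splits F -> perm_eq (p.1 ++ p.2) F.
Proof.
rewrite mem_undup => /allpairsP[[s i] /= []]; rewrite mem_permutations => hs _ -> /=.
by rewrite -[s in perm_eq s F](cat_take_drop i) in hs;
   rewrite -(permPr hs); apply: perm_cat; rewrite perm_sort.
Qed.

Lemma mem_splits F G1 G2 :
  ((sort leq G1, sort leq G2) \in splits F) = perm_eq (G1 ++ G2) F.
Proof.
apply/idP/idP => [/splits_perm h|h].
  by rewrite -(permPr h); apply: perm_cat; rewrite perm_sym perm_sort.
rewrite mem_undup; apply/allpairsP; exists (G1 ++ G2, size G1); split.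
- by rewrite mem_permutations.
- by rewrite mem_iota -(perm_size h) size_cat /=; lia.
- by rewrite /= take_size_cat // drop_size_cat.
Qed.

Lemma splits_sorted F p : p \in splits F -> p = (sort leq p.1, sort leq p.2).
Proof.
rewrite mem_undup => /allpairsP[[s i] /= [_ _ ->]] /=.
by congr pair; apply/eqP; rewrite perm_sort_leq perm_sym perm_sort.
Qed.

Lemma sum_eq_mem (T : eqType) (s : seq T) x : uniq s ->
  \sum_(p <- s) (x == p : nat) = (x \in s).
Proof.
by move=> us; rewrite -(count_uniq_mem x us) -sum1_count [RHS]big_mkcond /=;
  apply: eq_bigr => p _; rewrite eq_sym; case: eqP.
Qed.

Lemma split_indicator F l r : (perm_eq (fcode l ++ fcode r) F : nat) =
  \sum_(p <- splits F) perm_eq (fcode l) p.1 * perm_eq (fcode r) p.2.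
Proof.
rewrite -mem_splits -sum_eq_mem ?undup_uniq // big_seq [RHS]big_seq.
apply: eq_bigr => p /splits_sorted ep; rewrite mulnb -!perm_sort_leq {1}ep.
by congr (nat_of_bool _); apply/eqP/andP => [[-> ->]|[/eqP-> /eqP->]].
Qed.

Definition conv_cnt (u v : nat -> nat) (n : nat) := \sum_(i < n.+1) u i * v (n - i).

(** Pairs of root branches below an unmarked root. Canonical trees correspond to [e] being [leq];
    varying [e] allows the order condition to be removed by symmetry. *)
Definition pairs (e : rel nat) (F : seq nat) (k : nat) : nat :=
  \sum_(i < k.+1) \sum_(l <- mtrees i) \sum_(r <- mtrees (k - i))
    ([&& can l, can r, e (mcode l) (mcode r) & perm_eq (fcode l ++ fcode r) F] : nat).

Lemma pairs_leq F k : pairs leq F k = pcnt F k.+1.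
Proof.
rewrite /pcnt cntS !big_cons big_nil /= big1 ?add0n ?addn0; last first.
  by move=> i _; apply: big1 => l _; apply: big1 => r _; rewrite andbF.
by apply: eq_bigr => i _; apply: eq_bigr => l _; apply: eq_bigr => r _; rewrite -!andbA.
Qed.

Lemma pairs_geq F k : pairs geq F k = pairs leq F k.
Proof.
rewrite /pairs (reindex_inj rev_ord_inj) /=; apply: eq_bigr => i _.
rewrite subSS subKn; last by rewrite -ltnS.
rewrite exchange_big; apply: eq_bigr => l _; apply: eq_bigr => r _.
by rewrite perm_catC /geq /= andbCA.
Qed.

(** Pairs with codes in increasing order and pairs in decreasing order are equally many; together
    they cover all pairs and count those with equal codes twice. *)
Lemma pairsD F k : (pairs leq F k).*2 = pairs (fun _ _ => true) F k + pairs eq_op F k.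
Proof.
rewrite -addnn -{2}pairs_geq /pairs -!big_split; apply: eq_bigr => i _.
rewrite -!big_split; apply: eq_bigr => l _.
rewrite -!big_split; apply: eq_bigr => r _ /=.
case: (can l) => //; case: (can r) => //=; case: (perm_eq _ _); rewrite ?andbF //= !andbT.
by rewrite /geq /= eqn_leq; case: leqP => [_|/ltnW->]; rewrite ?andbT ?addn0.
Qed.

Lemma pairsT F k : pairs (fun _ _ => true) F k = \sum_(p <- splits F) conv_cnt (acnt p.1) (acnt p.2) k.
Proof.
rewrite /conv_cnt exchange_big; apply: eq_bigr => i _.
transitivity (\sum_(p <- splits F) \sum_(l <- mtrees i) \sum_(r <- mtrees (k - i))
   (can l && perm_eq (fcode l) p.1) * (can r && perm_eq (fcode r) p.2)); last first.
  by apply: eq_bigr => p _; rewrite /acnt !cntE big_distrlr.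
rewrite [RHS]exchange_big; apply: eq_bigr => l _.
rewrite [RHS]exchange_big; apply: eq_bigr => r _.
case: (can l) => /=; last by rewrite big1.
case: (can r) => /=; last by rewrite big1 // => p _; rewrite muln0.
exact: split_indicator.
Qed.

(** The coefficients of the series A_F'(x^2): two equal branches with [k] internal nodes altogether,
    each carrying one half of [F]. *)
Definition diag (F : seq nat) (k : nat) : nat :=
  if odd k then 0 else cnt (fun m => perm_eq (fcode m ++ fcode m) F) k./2.

Lemma pairs_eq F k : pairs eq_op F k = diag F k.
Proof.
transitivity (\sum_(i < k.+1 | i == k - i :> nat) cnt (fun m => perm_eq (fcode m ++ fcode m) F) i).
  rewrite /pairs [RHS]big_mkcond; apply: eq_bigr => i _.
  rewrite cntE.
  rewrite (_ : (if _ then _ else _) = \sum_(m <- mtrees i)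
     if i == k - i :> nat then (can m && perm_eq (fcode m ++ fcode m) F : nat) else 0); last first.
    by case: ifP => _ //; rewrite big1.
  rewrite big_seq [RHS]big_seq; apply: eq_bigr => l; rewrite mem_mtrees => /eqP sl.
  transitivity (\sum_(r <- mtrees (k - i))
     (l == r : nat) * (can l && perm_eq (fcode l ++ fcode l) F)).
    apply: eq_bigr => r _; have [<-|ne] := eqVneq l r.
      by rewrite eqxx mul1n; case: (can l).
    rewrite mul0n; case cl : (can l) => //; case cr : (can r) => //=.
    by case: eqP => // /(can_inj_mcode cl cr) e; rewrite e eqxx in ne.
  rewrite -big_distrl sum_eq_mem ?mtrees_uniq // mem_mtrees sl /=.
  by case: ifP => _; rewrite ?mul1n.
rewrite /diag; case: ifP => ok.
  by apply: big1 => i /eqP h; exfalso; have := ltn_ord i; move: ok h; lia.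
have h : k./2 < k.+1 by lia.
rewrite (big_pred1 (Ordinal h)) // => i /=; rewrite -val_eqE /=.
by have := ltn_ord i; move: ok; lia.
Qed.

Lemma pcnt0 F : pcnt F 0 = (F == [::]).
Proof. by rewrite /pcnt cnt0 /= perm_sym; case: F => // a F; apply/eqP; rewrite eqb0; apply/negP => /perm_size. Qed.

Lemma pcntS F k : (pcnt F k.+1).*2 =
  \sum_(p <- splits F) conv_cnt (acnt p.1) (acnt p.2) k + diag F k.
Proof. by rewrite -pairs_leq pairsD pairsT pairs_eq. Qed.

Lemma conv_cntC u v n : conv_cnt u v n = conv_cnt v u n.
Proof.
rewrite /conv_cnt (reindex_inj rev_ord_inj) /=; apply: eq_bigr => i _.
by rewrite subSS subKn; [exact: mulnC|rewrite -ltnS].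
Qed.

Definition psplits F := [seq p <- splits F | (p.1 != [::]) && (p.2 != [::])].

(** The two splittings with an empty part are distinct since [F] is nonempty. Both give the product
    of V and A_F, which is the term to be moved to the left side of the functional equation. *)
Lemma pcntS_psplits F k : F != [::] -> (pcnt F k.+1).*2 =
  (conv_cnt (acnt [::]) (acnt F) k).*2 +
  \sum_(p <- psplits F) conv_cnt (acnt p.1) (acnt p.2) k + diag F k.
Proof.
move=> Fn; rewrite pcntS; congr (_ + _).
have h1 : ([::], sort leq F) \in splits F by rewrite -[[::]]/(sort leq [::]) mem_splits.
have h2 : (sort leq F, [::]) \in splits F by rewrite -[X in (_, X)]/(sort leq [::]) mem_splits cats0.
have sn : sort leq F != [::] by apply: contra Fn => /eqP/(congr1 size); rewrite size_sort => /size0nil->.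
have sE : acnt (sort leq F) =1 acnt F by move=> j; apply: acnt_perm; rewrite perm_sort.
rewrite (bigD1_seq _ h1) ?undup_uniq //= -big_filter.
rewrite (bigD1_seq (sort leq F, [::])) /=; first last.
- by rewrite filter_uniq ?undup_uniq.
- by rewrite mem_filter h2 andbT xpair_eqE negb_and sn.
rewrite big_filter_cond addnA.
congr (_ + _).
  rewrite -addnn; congr (_ + _); first by apply: eq_bigr => i _; rewrite sE.
  by rewrite conv_cntC; apply: eq_bigr => i _; rewrite sE.
rewrite big_filter big_seq_cond [RHS]big_seq_cond; apply: eq_bigl => p.
case hp : (p \in splits F) => //=; have ep := splits_sorted hp; have := splits_perm hp.
case: p ep {hp} => p1 p2 /= [e1 e2] hp.
have -> : ((p1, p2) == ([::], sort leq F)) = (p1 == [::]).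
  rewrite xpair_eqE; apply: andb_idr => /eqP p10; rewrite p10 in hp.
  by rewrite e2 perm_sort_leq.
suff -> : ((p1, p2) == (sort leq F, [::])) = (p2 == [::]) by [].
rewrite xpair_eqE; apply: andb_idl => /eqP p20; rewrite p20 cats0 in hp.
by rewrite e1 perm_sort_leq.
Qed.

Lemma psplitsP F p : p \in psplits F ->
  [/\ p.1 != [::], p.2 != [::] & perm_eq (p.1 ++ p.2) F].
Proof. by rewrite mem_filter => /andP[/andP[-> ->] /splits_perm]. Qed.

Lemma perm_double (G H : seq nat) : perm_eq (G ++ G) (H ++ H) -> perm_eq G H.
Proof.
move/seq.permP => h; apply/seq.permP => a; have := h a; rewrite !count_cat; lia.
Qed.

(** A multiset has at most one half, so all trees that contribute carry the same forest [F']. *)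
Lemma diagP F : (forall k, diag F k = 0) \/
  exists2 F', perm_eq (F' ++ F') F &
    forall k, diag F k = if odd k then 0 else acnt F' k./2.
Proof.
have [h|h] := pselect (exists m, perm_eq (fcode m ++ fcode m) F).
  case: h => m hm; right; exists (fcode m) => // k; rewrite /diag; case: ifP => // _.
  apply: eq_count => m' /=; congr (_ && _); apply/idP/idP => [h|h].
    by apply: perm_double; rewrite (permPl h) perm_sym.
  by rewrite -(permPr hm); apply: perm_cat.
left=> k; rewrite /diag; case: ifP => // _; apply/eqP; rewrite -leqn0 leqNgt -has_count.
apply/hasPn => m _ /=; rewrite negb_and; apply/orP; right; apply/negP => hm.
by apply: h; exists m.
Qed.

(** * Monotonicity of the exponent *)

Definition leaves (X : seq address) : seq address :=
  [seq x <- X | all (fun y => prefix x y ==> (y == x)) X].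

Lemma leaves_sub X x : x \in leaves X -> x \in X.
Proof. by rewrite mem_filter => /andP[]. Qed.

Lemma leaves_cat X Y : {in X & Y, forall x y, ~~ prefix x y && ~~ prefix y x} ->
  leaves (X ++ Y) = leaves X ++ leaves Y.
Proof.
move=> H; rewrite /leaves filter_cat; congr (_ ++ _); apply: eq_in_filter => x xX;
  rewrite all_cat.
  by apply: andb_idr => _; apply/allP => y yY; have /andP[/negPf-> _] := H x y xX yY.
by apply: andb_idl => _; apply/allP => y yY; have /andP[_ /negPf->] := H y x yY xX.
Qed.

Lemma leaves_map X (h : address -> address) :
  {in X &, forall x y, prefix (h x) (h y) = prefix x y} ->
  leaves (map h X) = map h (leaves X).
Proof.
move=> hh; rewrite /leaves filter_map; congr map; apply: eq_in_filter => x xX /=.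
rewrite all_map; apply: eq_in_all => y yX /=; rewrite hh //.
by rewrite (inj_in_eq (piso_inj hh)).
Qed.

Lemma leaves_root X : [::] \notin X -> size (leaves ([::] :: X)) =
  if nilp X then 1 else size (leaves X).
Proof.
move=> nX.
pose F := [seq x <- X | all (fun y => prefix x y ==> (y == x)) ([::] :: X)].
have -> : leaves ([::] :: X) =
    if all (fun y => prefix [::] y ==> (y == [::])) X then [::] :: F else F by [].
have -> : all (fun y => prefix [::] y ==> (y == [::])) X = nilp X.
  by case: X nX {F} => [|[|a x] X].
have -> : F = leaves X by apply: eq_in_filter => -[|a x] xX //=; rewrite xX in nX.
by case: X nX {F}.
Qed.

Lemma leaves_perm X Y : perm_eq X Y -> perm_eq (leaves X) (leaves Y).
Proof.
move=> h; rewrite /leaves (eq_filter (a2 := fun x => all (fun y => prefix x y ==> (y == x)) Y)).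
  exact: perm_filter.
by move=> x; apply: perm_all.
Qed.

Lemma leaf_exists X x : x \in X -> exists2 y, y \in leaves X & prefix x y.
Proof.
pose M := \max_(y <- X) size y.
have [n] := ubnP (M - size x); elim: n x => // n IH x xn xX.
have [h|] := boolP (all (fun y => prefix x y ==> (y == x)) X).
  by exists x; [rewrite mem_filter h|exact: prefix_refl].
case/allPn => y yX; rewrite negb_imply => /andP[xy ne].
have sy : size y <= M by exact: leq_bigmax_seq.
have sxy : size x < size y.
  case/prefixP: xy ne => z ->; case: z => [|a z]; rewrite ?cats0 ?eqxx //.
  by rewrite size_cat /= addnS ltnS leq_addr.
have [|z zX yz] := IH y _ yX; first by move: xn; lia.
by exists z => //; apply: prefix_trans yz.
Qed.

(* A leaf of a subset lies above some leaf of the whole set, and no two leaves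
   of the subset lie above the same one, since they would be comparable. *)
Lemma leaves_subset X Y : uniq X -> {subset X <= Y} ->
  size (leaves X) <= size (leaves Y).
Proof.
move=> uX XY.
have hb x : exists y, x \in leaves X -> y \in leaves Y /\ prefix x y.
  have [xX|_] := boolP (x \in leaves X); last by exists [::].
  by have [y yY xy] := leaf_exists (XY x (leaves_sub xX)); exists y.
have [s hs] := choice hb.
rewrite -(size_map s); apply: uniq_leq_size; last first.
  by move=> _ /mapP[x xX ->]; have [] := hs x xX.
rewrite map_inj_in_uniq ?filter_uniq // => x x' xX x'X e.
have [_ h1] := hs x xX; have [_ h2] := hs x' x'X; rewrite -e in h2.
have cmp a b : a \in leaves X -> b \in leaves X -> prefix a b -> a = b.
  by rewrite !mem_filter => /andP[/allP h _] /andP[_ bX] /(implyP (h b bX))/eqP.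
case/orP: (prefix_total h1 h2) => h; first exact: cmp.
by apply/esym/cmp.
Qed.

(** A root adds one vertex to what lies below it, and when nothing lies below it is itself a leaf:
    hence the value 2 in [node]. *)
Lemma wt_tcode t : wt (tcode t) = nverts t + size (leaves (verts t)).
Proof.
elim/tree_nested_ind: t => ts H; rewrite [tcode _]/= wt_node /nverts vertsE.
rewrite leaves_root; last by apply/negP => /vforestP[j [b []]].
have -> : nilp (vforest 0 ts) = nilp (map tcode ts).
  by case: ts {H} => [|[us] ts].
case: ifP => [|_]; first by case: ts {H} => [|[us] ts].
rewrite [size (_ :: _)]/= addSn; congr _.+1.
have : forall i, wts (map tcode ts) = size (vforest i ts) + size (leaves (vforest i ts)).
  elim: ts H => [|t ts IH] //= [ht hts] i.
  rewrite leaves_cat; last by apply: cons_incomparable => y /vforestP.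
  rewrite leaves_map; last by move=> x y _ _; rewrite prefix_cons eqxx.
  rewrite !size_cat !size_map /wts /= -/(wts _) (IH hts i.+1) ht /nverts; lia.
exact.
Qed.

Lemma wt_tcode_mono S1 S2 : subtree S1 S2 -> wt (tcode S1) <= wt (tcode S2).
Proof.
case/existsP => U; pose k := nverts S1 + nverts S2.
have k1 : nverts S1 <= k by exact: leq_addr.
have k2 : nverts S2 <= k by exact: leq_addl.
rewrite (is_embP U k1 k2) -(pcodes_verts k1) => h.
have [f [f1 f2 _]] := pcodes_piso (verts_uniq S1) (addrs_uniq U) k1
  (leq_trans (size_addrs U) k2) h.
rewrite !wt_tcode /nverts -(size_map f) (perm_size f2) -(size_map f (leaves _)) -leaves_map //.
rewrite (perm_size (leaves_perm f2)) leq_add //; first exact: size_addrs.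
by apply: leaves_subset; [exact: addrs_uniq|exact: addrs_sub].
Qed.

(** * Formal power series *)

Local Open Scope ring_scope.

Definition fps (R : comNzRingType) := nat -> R.

Section FormalPowerSeries.
Variable R : comNzRingType.
Implicit Types u v w : fps R.

HB.instance Definition _ := gen_eqMixin (fps R).
HB.instance Definition _ := gen_choiceMixin (fps R).

Definition fps_add u v : fps R := fun n => u n + v n.
Definition fps_opp u : fps R := fun n => - u n.
Definition fps_zero : fps R := fun=> 0.
Definition fps_one : fps R := fun n => (n == 0%N)%:R.
Definition fps_mul u v : fps R := fun n => \sum_(i < n.+1) u i * v (n - i)%N.

Lemma fps_addA : associative fps_add.
Proof. by move=> u v w; apply/funext => n; apply: addrA. Qed.
Lemma fps_addC : commutative fps_add.
Proof. by move=> u v; apply/funext => n; apply: addrC. Qed.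
Lemma fps_add0 : left_id fps_zero fps_add.
Proof. by move=> u; apply/funext => n; apply: add0r. Qed.
Lemma fps_addN : left_inverse fps_zero fps_opp fps_add.
Proof. by move=> u; apply/funext => n; apply: addNr. Qed.

HB.instance Definition _ :=
  GRing.isZmodule.Build (fps R) fps_addA fps_addC fps_add0 fps_addN.

Definition trunc (N : nat) u : {poly R} := \poly_(i < N) u i.

Lemma fps_mul_trunc N u v n : (n < N)%N -> fps_mul u v n = (trunc N u * trunc N v)`_n.
Proof.
move=> nN; rewrite coefM; apply: eq_bigr => i _; rewrite !coef_poly.
have := ltn_ord i; rewrite ltnS => h.
by rewrite (leq_ltn_trans h nN) (leq_ltn_trans (leq_subr _ _) nN).
Qed.

Lemma coefM_eq (p q p' q' : {poly R}) n : (forall i, (i <= n)%N -> p`_i = p'`_i) ->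
  (forall i, (i <= n)%N -> q`_i = q'`_i) -> (p * q)`_n = (p' * q')`_n.
Proof.
by move=> hp hq; rewrite !coefM; apply: eq_bigr => i _; rewrite hp ?hq ?leq_subr // -ltnS.
Qed.

(** The coefficient of index [n] in a product depends only on coefficients up to [n], so
    associativity is inherited from polynomials by truncation. *)
Lemma fps_mulA : associative fps_mul.
Proof.
move=> u v w; apply/funext => n; pose N := n.+1.
have tr x y i : (i <= n)%N -> (trunc N (fps_mul x y))`_i = (trunc N x * trunc N y)`_i.
  by move=> h; rewrite coef_poly ltnS h -fps_mul_trunc.
rewrite !(@fps_mul_trunc N) //.
transitivity (trunc N u * (trunc N v * trunc N w))`_n.
  by apply: coefM_eq => // i h; apply: tr.
by rewrite mulrA; apply: coefM_eq => // i h; rewrite tr.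
Qed.

Lemma fps_mulC : commutative fps_mul.
Proof. by move=> u v; apply/funext => n; rewrite !(@fps_mul_trunc n.+1) // mulrC. Qed.

Lemma fps_mul1 : left_id fps_one fps_mul.
Proof.
move=> u; apply/funext => n; rewrite /fps_mul big_ord_recl big1 ?addr0.
  by rewrite subn0 mul1r.
by move=> i _; rewrite mul0r.
Qed.

Lemma fps_mulDl : left_distributive fps_mul fps_add.
Proof.
move=> u v w; apply/funext => n; rewrite /fps_mul /fps_add -big_split.
by apply: eq_bigr => i _; rewrite mulrDl.
Qed.

Lemma fps_one_neq0 : fps_one != fps_zero.
Proof. by apply/eqP => /(congr1 (fun u => u 0%N)) /eqP; rewrite oner_eq0. Qed.

HB.instance Definition _ := GRing.Zmodule_isComNzRing.Build (fps R)
  fps_mulA fps_mulC fps_mul1 fps_mulDl fps_one_neq0.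

Lemma fpsD u v n : (u + v) n = u n + v n. Proof. by []. Qed.
Lemma fpsN u n : (- u) n = - u n. Proof. by []. Qed.
Lemma fpsB u v n : (u - v) n = u n - v n. Proof. by []. Qed.
Lemma fps0 n : (0 : fps R) n = 0. Proof. by []. Qed.
Lemma fps1 n : (1 : fps R) n = (n == 0%N)%:R. Proof. by []. Qed.
Lemma fpsM u v n : (u * v) n = \sum_(i < n.+1) u i * v (n - i)%N. Proof. by []. Qed.
Lemma fpsM0 u v : (u * v) 0%N = u 0%N * v 0%N. Proof. by rewrite fpsM big_ord1. Qed.

Lemma fps_sum (I : Type) (r : seq I) (F : I -> fps R) n :
  (\sum_(i <- r) F i) n = \sum_(i <- r) F i n.
Proof. by elim/big_rec2: _ => // i y z _ <-; rewrite fpsD. Qed.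

Definition fpsX : fps R := fun n => (n == 1%N)%:R.

Lemma fpsXM0 u : (fpsX * u) 0%N = 0. Proof. by rewrite fpsM0 mul0r. Qed.

Lemma fpsXMS u n : (fpsX * u) n.+1 = u n.
Proof.
rewrite fpsM 2!big_ord_recl big1 => [|i _]; last by rewrite mul0r.
by rewrite /fpsX /= mul0r add0r addr0 mul1r /bump subSS subn0.
Qed.

End FormalPowerSeries.

(** * Coefficient asymptotics *)

Section Asymptotics.
Variable R : realType.
Implicit Types (u v : fps R) (e f : nat).

(* The coefficients of [(1 - x) ^ (- e / 2)]. *)
Definition bin e : fps R := fun n => \prod_(i < n) ((e%:R / 2 + i%:R) / i.+1%:R).

Lemma bin_0 e : bin e 0%N = 1.
Proof. by rewrite /bin big_ord0. Qed.

Lemma bin_S e n : bin e n.+1 = bin e n * ((e%:R / 2 + n%:R) / n.+1%:R).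
Proof. by rewrite /bin big_ord_recr. Qed.

Lemma bin_gt0 e n : (0 < e)%N -> 0 < bin e n.
Proof.
move=> e0; apply: prodr_gt0 => i _; rewrite divr_gt0 ?ltr0n //.
by rewrite ltr_pwDl ?ler0n // divr_gt0 ?ltr0n.
Qed.

Lemma bin_ge0 e n : 0 <= bin e n.
Proof.
by apply: prodr_ge0 => i _; rewrite divr_ge0 ?ler0n // addr_ge0 ?divr_ge0 ?ler0n.
Qed.

Lemma bin2 n : bin 2 n = 1.
Proof.
elim: n => [|n IH]; first exact: bin_0.
rewrite bin_S IH mul1r divff ?mul1r; last by [].
by rewrite -nat1r divff // nat1r pnatr_eq0.
Qed.

(** The derivation x d/dx. *)
Definition theta u : fps R := fun n => n%:R * u n.

Lemma thetaM u v : theta (u * v) = theta u * v + u * theta v.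
Proof.
apply/funext => n; rewrite /theta fpsD !fpsM mulr_sumr -big_split.
apply: eq_bigr => i _ /=; have h : (i <= n)%N by rewrite -ltnS.
by rewrite -{1}(subnKC h) natrD; ring.
Qed.

Definition scale (a : R) : fps R := fun n => a *+ (n == 0%N).

Lemma scaleM a u n : (scale a * u) n = a * u n.
Proof.
rewrite fpsM big_ord_recl big1 ?addr0 ?subn0 // => i _.
by rewrite /scale mul0r.
Qed.

Lemma scale2 u : scale 2 * u = u + u.
Proof. by apply/funext => n; rewrite scaleM fpsD mulr_natl mulr2n. Qed.

Lemma scaleD a b : scale (a + b) = scale a + scale b.
Proof. by apply/funext => n; rewrite fpsD /scale mulrnDl. Qed.

(** The differential equation (1 - x) u' = (e/2) u of (1 - x)^(-e/2), multiplied by x. *)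
Lemma theta_bin e : theta (bin e) = fpsX R * (theta (bin e) + scale (e%:R / 2) * bin e).
Proof.
apply/funext => -[|n]; first by rewrite /theta mul0r fpsXM0.
rewrite fpsXMS fpsD scaleM /theta bin_S.
by field; rewrite nat1r pnatr_eq0.
Qed.

(** Both sides satisfy the same first-order differential equation and have constant term 1; the
    equation determines the coefficients recursively. *)
Lemma bin_mul e f : bin e * bin f = bin (e + f).
Proof.
set w := bin e * bin f.
have hw : theta w = fpsX R * (theta w + scale ((e + f)%:R / 2) * w).
  rewrite /w thetaM {1}(theta_bin e) {1}(theta_bin f).
  by rewrite natrD mulrDl scaleD; ring.
apply/funext; elim=> [|n IH]; first by rewrite /w fpsM0 !bin_0 mulr1.
have := congr1 (fun u : fps R => u n.+1) hw.
rewrite fpsXMS fpsD scaleM /theta IH bin_S => h.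
have n0 : (n.+1%:R : R) != 0 by rewrite pnatr_eq0.
by apply: (mulfI n0); rewrite h; field; rewrite nat1r.
Qed.

Lemma cvg_seqP (u : nat -> R) (l : R) :
  (u @ \oo --> l)%classic <->
  forall eps : R, 0 < eps -> exists N, forall n, (N <= n)%N -> `|u n - l| <= eps.
Proof.
split=> [/cvgrPdist_le h eps /h [N _ hN]|h].
  by exists N => n Nn; rewrite distrC; apply: hN.
apply/cvgrPdist_le => eps /h[N hN]; exists N => // n Nn.
by rewrite distrC; apply: hN.
Qed.

Lemma bounded_cvg (u : nat -> R) (l : R) : (u @ \oo --> l)%classic ->
  exists2 B, 0 <= B & forall n, `|u n| <= B.
Proof.
move=> /cvg_seqP/(_ 1 ltr01)[N hN].
exists (\sum_(i < N) `|u i| + (`|l| + 1)).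
  by rewrite addr_ge0 ?sumr_ge0 // addr_ge0.
move=> n; have [h|h] := leqP N n.
  rewrite ler_wpDl ?sumr_ge0 // -[u n](subrK l) (le_trans (ler_normD _ _)) //.
  by rewrite addrC lerD2l hN.
rewrite (bigD1 (Ordinal h)) //= -addrA ler_wpDr // addr_ge0 ?sumr_ge0 // addr_ge0.
Qed.

(** For [C = 0] this says little-o. It is meaningful for positive [e] only: the coefficients of
    [bin 0] vanish beyond index 0, and division by zero yields 0. *)
Definition asy u e (C : R) : Prop := ((fun n => u n / bin e n) @ \oo --> C)%classic.

Lemma bin_le_S f n : (0 < f)%N -> bin f n <= 2 * bin f n.+1.
Proof.
move=> f0; rewrite bin_S mulrCA ler_peMr ?bin_ge0 // mulrA ler_pdivlMr ?ltr0n //.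
rewrite mul1r -nat1r; have : (1 : R) <= f%:R by rewrite ler1n.
have : 0 <= n%:R :> R by []. lra.
Qed.

Lemma bin_le_sub f n i : (0 < f)%N -> (i <= n)%N -> bin f (n - i)%N <= 2 ^+ i * bin f n.
Proof.
move=> f0; elim: i => [|i IH] h; first by rewrite subn0 mul1r.
apply: le_trans (bin_le_S _ f0) _; rewrite exprS -mulrA ler_pM2l //.
by rewrite -subSn // subSS IH // ltnW.
Qed.

(** A form of c_f(n) / c_(f+1)(n) = O(n^(-1/2)) that is stable under induction: with a = f + 2 n,
    the step is a (a + 2) <= (a + 1)^2. *)
Lemma bin_ratio_sq f n : (0 < f)%N ->
  bin f n ^+ 2 * (f%:R + 2 * n%:R) <= f%:R * bin f.+1 n ^+ 2.
Proof.
move=> f0; elim: n => [|n IH]; first by rewrite !bin_0; lra.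
have F : (1 : R) <= f%:R by rewrite ler1n.
have n0 : 0 <= n%:R :> R by [].
rewrite !bin_S.
set a := f%:R + 2 * n%:R in IH *.
have n1 : 0 < (n.+1%:R : R) by rewrite ltr0n.
have ha : 1 <= a by rewrite /a; lra.
have -> : (f%:R / 2 + n%:R) / n.+1%:R = a / (2 * n.+1%:R) :> R.
  by rewrite /a; field; rewrite nat1r lt0r_neq0.
have -> : (f.+1%:R / 2 + n%:R) / n.+1%:R = (a + 1) / (2 * n.+1%:R) :> R.
  by rewrite /a -natr1; field; rewrite nat1r lt0r_neq0.
have -> : f%:R + 2 * n.+1%:R = a + 2 by rewrite /a -natr1; ring.
set m := n.+1%:R in n1 *; set x := bin f n in IH *; set y := bin f.+1 n in IH *.
have m0 : m != 0 by rewrite lt0r_neq0.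
have -> : (x * (a / (2 * m))) ^+ 2 * (a + 2) = (x ^+ 2 * a) * (a * (a + 2) / (2 * m) ^+ 2).
  by field.
have -> : f%:R * (y * ((a + 1) / (2 * m))) ^+ 2 =
  (f%:R * y ^+ 2) * ((a + 1) ^+ 2 / (2 * m) ^+ 2) by field.
apply: ler_pM => //.
- by rewrite mulr_ge0 ?sqr_ge0 //; lra.
- by rewrite divr_ge0 ?sqr_ge0 // mulr_ge0; lra.
- by rewrite ler_pM2r ?invr_gt0 ?exprn_gt0 ?mulr_gt0 //; nra.
Qed.

Lemma bin_mono e f n : (0 < e <= f)%N -> bin e n <= bin f n.
Proof.
move=> /andP[e0 ef]; rewrite /bin; apply: ler_prod => i _.
rewrite divr_ge0 ?addr_ge0 ?divr_ge0 ?ler0n //=.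
by rewrite ler_pM2r ?invr_gt0 ?ltr0n // lerD2r ler_pM2r ?ler_nat // invr_gt0 ltr0n.
Qed.

Lemma cvg0P (u : nat -> R) :
  (forall eps : R, 0 < eps -> exists N, forall n, (N <= n)%N -> `|u n| <= eps) ->
  (u @ \oo --> (0 : R))%classic.
Proof. by move=> h; apply/cvg_seqP => eps /h[N hN]; exists N => n /hN; rewrite subr0. Qed.

Lemma cvg_inv_nat (a : R) : ((fun n => a / n.+1%:R) @ \oo --> (0 : R))%classic.
Proof.
rewrite -(mulr0 a); apply: cvgM; first exact: cvg_cst.
exact: cvg_harmonic.
Qed.

Lemma bin_littleo e f : (0 < e < f)%N ->
  ((fun n => bin e n / bin f n) @ \oo --> (0 : R))%classic.
Proof.
move=> /andP[e0 ef]; apply: cvg0P => eps eps0.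
have /cvg_seqP/(_ (eps ^+ 2)) := cvg_inv_nat e%:R.
case=> [|N hN]; first exact: exprn_gt0.
exists N => n /hN; rewrite subr0 => h.
have b1 := bin_gt0 n e0; have b2 : 0 < bin e.+1 n by exact: bin_gt0.
have b3 : 0 < bin f n by apply: bin_gt0; lia.
rewrite /= ger0_norm; last by rewrite divr_ge0 ?bin_ge0.
rewrite ler_pdivrMr //.
have h1 : bin e.+1 n <= bin f n by apply: bin_mono; lia.
apply: le_trans (_ : eps * bin e.+1 n <= _); last by rewrite ler_pM2l.
rewrite -(@ler_pXn2r _ 2) ?nnegrE ?mulr_ge0 ?bin_ge0 ?(ltW eps0) // exprMn.
rewrite ger0_norm ?divr_ge0 // in h.
have n1 : 0 < (n.+1%:R : R) by rewrite ltr0n.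
rewrite ler_pdivrMr // in h.
have := bin_ratio_sq n e0.
have F : (1 : R) <= e%:R by rewrite ler1n.
have n0 : 0 <= n%:R :> R by [].
move: h; rewrite -natr1; set x := bin e n ^+ 2; set y := bin e.+1 n ^+ 2.
have x0 : 0 <= x by exact: sqr_ge0.
have y0 : 0 <= y by exact: sqr_ge0.
move=> h h2.
have h3 : x * (n%:R + 1) <= eps ^+ 2 * y * (n%:R + 1).
  apply: le_trans (_ : e%:R * y <= _); last first.
    by rewrite mulrAC ler_wpM2r.
  by apply: le_trans h2; rewrite ler_wpM2l //; lra.
have n1' : 0 < n%:R + 1 :> R by lra.
by rewrite ler_pM2r in h3.
Qed.

(** The convolution is cut at a fixed index [N]. Its first [N] terms are O(c_f(n)), hence negligible
    against c_(e+f)(n); the others are at most [d * B] times the terms of the convolution of c_e and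
    c_f, which sums to c_(e+f)(n). *)
Lemma littleo_mul (a b : fps R) e f B : (0 < e)%N -> (0 < f)%N ->
  ((fun n => a n / bin e n) @ \oo --> (0 : R))%classic ->
  (forall n, `|b n| <= B * bin f n) ->
  ((fun n => (a * b) n / bin (e + f) n) @ \oo --> (0 : R))%classic.
Proof.
move=> e0 f0 ha hb; have B0 : 0 <= B.
  by have := hb 0%N; rewrite bin_0 mulr1; apply: le_trans.
have ef0 : (0 < e + f)%N by lia.
apply: cvg0P => eps eps0.
pose d := eps / 2 / (B + 1).
have d0 : 0 < d by rewrite /d !divr_gt0 // ltr_wpDl.
have /cvg_seqP/(_ d d0)[N hN] := ha.
pose A := \sum_(i < N) `|a i| * 2 ^+ i * B.
have A0 : 0 <= A by apply: sumr_ge0 => i _; rewrite !mulr_ge0 ?exprn_ge0.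
have hf : (0 < f < e + f)%N by lia.
have d1 : 0 < eps / 2 / (A + 1) by rewrite !divr_gt0 // ltr_wpDl.
have /cvg_seqP/(_ _ d1)[M hM] := bin_littleo hf.
exists (N + M)%N => n hn; have bn : 0 < bin (e + f) n by exact: bin_gt0.
rewrite normrM normfV [`|bin _ _|]gtr0_norm // ler_pdivrMr //.
rewrite fpsM (le_trans (ler_norm_sum _ _ _)) //.
have step (i : 'I_n.+1) : true -> `|a i * b (n - i)%N| <=
    (if (i < N)%N then `|a i| * 2 ^+ i * B * bin f n else 0) + d * B * (bin e i * bin f (n - i)%N).
  move=> _; rewrite normrM; have hb' := hb (n - i)%N.
  have bf : 0 <= bin f (n - i)%N by exact: bin_ge0.
  have be : 0 < bin e i by exact: bin_gt0.
  case: ltnP => iN.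
    apply: ler_wpDr; first by apply: mulr_ge0; apply: mulr_ge0 => //; exact: ltW.
    rewrite -!mulrA ler_wpM2l // (le_trans hb') // mulrCA ler_wpM2l //.
    by apply: bin_le_sub => //; rewrite -ltnS.
  rewrite add0r; have := hN i iN; rewrite subr0 normrM normfV [`|bin _ _|]gtr0_norm //.
  rewrite ler_pdivrMr // => h.
  by rewrite [leRHS](_ : _ = (d * bin e i) * (B * bin f (n - i)%N)); [exact: ler_pM|ring].
rewrite (le_trans (ler_sum _ step)) // big_split /= -mulr_sumr -fpsM bin_mul.
have -> : \sum_(i < n.+1) (if (i < N)%N then `|a i| * 2 ^+ i * B * bin f n else 0) =
    A * bin f n.
  rewrite /A mulr_suml (big_ord_widen n.+1 (fun i => `|a i| * 2 ^+ i * B * bin f n)); last by lia.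
  by rewrite [RHS]big_mkcond.
have : A * bin f n <= eps / 2 * bin (e + f) n.
  have := hM n; rewrite subr0 => /(_ ltac:(lia)).
  rewrite ger0_norm ?divr_ge0 ?bin_ge0 // ler_pdivrMr // => h.
  apply: le_trans (_ : (A + 1) * bin f n <= _); first by rewrite ler_wpM2r ?bin_ge0 //; lra.
  apply: le_trans (ler_wpM2l _ h) _; first by lra.
  by rewrite mulrA le_eqVlt; apply/orP; left; apply/eqP; congr (_ * _); field; lra.
have : d * B * bin (e + f) n <= eps / 2 * bin (e + f) n.
  rewrite ler_wpM2r ?(ltW bn) // /d mulrAC ler_pdivrMr ?ltr_wpDl //.
  by rewrite ler_wpM2l ?divr_ge0 ?(ltW eps0) //; lra.
lra.
Qed.

Lemma asy_bounded u e C : (0 < e)%N -> asy u e C ->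
  exists2 B, 0 <= B & forall n, `|u n| <= B * bin e n.
Proof.
move=> e0 /bounded_cvg[B B0 hB]; exists B => // n; have := hB n.
have b := bin_gt0 n e0.
by rewrite normrM normfV [`|bin _ _|]gtr0_norm // ler_pdivrMr.
Qed.

Lemma asy_littleo u e f B : (0 < e < f)%N -> (forall n, `|u n| <= B * bin e n) -> asy u f 0.
Proof.
move=> ef hB; have /andP[e0 ef'] := ef; have f0 : (0 < f)%N by lia.
apply: (@squeeze_cvgr _ _ _ _ (fun n => - (B * (bin e n / bin f n))) (fun n => B * (bin e n / bin f n))).
- near=> n; rewrite -ler_norml normrM normfV [`|bin f n|]gtr0_norm ?bin_gt0 //.
  by rewrite mulrA ler_pM2r ?invr_gt0 ?bin_gt0.
- by rewrite -oppr0 -(mulr0 B); apply: cvgN; apply: cvgM; [exact: cvg_cst|exact: bin_littleo].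
- by rewrite -[X in (_ --> X)%classic](mulr0 B); apply: cvgM; [exact: cvg_cst|exact: bin_littleo].
Unshelve. all: by end_near.
Qed.

Lemma asy_self e : (0 < e)%N -> asy (bin e) e 1.
Proof.
move=> e0; rewrite /asy (_ : (fun n => _) = fun=> 1); first exact: cvg_cst.
by apply/funext => n; rewrite divff // lt0r_neq0 // bin_gt0.
Qed.

Lemma asyD u v e C D : asy u e C -> asy v e D -> asy (u + v) e (C + D).
Proof.
move=> hu hv; rewrite /asy (_ : (fun n => _) = fun n => u n / bin e n + v n / bin e n).
  exact: cvgD.
by apply/funext => n; rewrite fpsD mulrDl.
Qed.

Lemma asy_scale u e C a : asy u e C -> asy (scale a * u) e (a * C).
Proof.
move=> hu; rewrite /asy (_ : (fun n => _) = fun n => a * (u n / bin e n)).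
  by apply: cvgM; [exact: cvg_cst|exact: hu].
by apply/funext => n; rewrite scaleM mulrA.
Qed.

Lemma asyB u v e C D : asy u e C -> asy v e D -> asy (u - v) e (C - D).
Proof.
move=> hu hv; rewrite /asy (_ : (fun n => _) = fun n => u n / bin e n - v n / bin e n).
  exact: cvgB.
by apply/funext => n; rewrite fpsB mulrBl.
Qed.

(** Each factor is its main term plus a negligible remainder; the main terms multiply exactly by
    [bin_mul], and products with a remainder are negligible by [littleo_mul]. *)
Lemma asyM u v e f C D : (0 < e)%N -> (0 < f)%N -> asy u e C -> asy v f D ->
  asy (u * v) (e + f) (C * D).
Proof.
move=> e0 f0 hu hv.
have hu' : asy (u - scale C * bin e) e 0.
  by rewrite -(subrr C) -{3}(mulr1 C); apply: asyB => //; apply: asy_scale; exact: asy_self.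
have hv' : asy (v - scale D * bin f) f 0.
  by rewrite -(subrr D) -{3}(mulr1 D); apply: asyB => //; apply: asy_scale; exact: asy_self.
have [B _ hB] := asy_bounded f0 hv.
have h1 := littleo_mul e0 f0 hu' hB.
have hb n : `|bin e n| <= 1 * bin e n by rewrite mul1r ger0_norm // bin_ge0.
have h2 := littleo_mul f0 e0 hv' hb.
have -> : u * v = (u - scale C * bin e) * v +
   (scale C * ((v - scale D * bin f) * bin e) + scale (C * D) * bin (e + f)).
  have -> : scale (C * D) = scale C * scale D.
    by apply/funext => n; rewrite scaleM /scale mulrnAr.
  by rewrite -bin_mul; ring.
have ef0 : (0 < e + f)%N by lia.
have h3 : asy (scale C * ((v - scale D * bin f) * bin e)) (e + f) 0.
  by rewrite -(mulr0 C); apply: asy_scale; rewrite addnC.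
have := asyD h1 (asyD h3 (@asy_scale _ _ _ (C * D) (asy_self ef0))).
by rewrite mulr1 !add0r.
Qed.

Lemma bin_shift e : (0 < e)%N ->
  ((fun n => bin e n / bin e n.+1) @ \oo --> (1 : R))%classic.
Proof.
move=> e0; apply/cvg_seqP => eps eps0.
have /cvg_seqP/(_ eps eps0)[N hN] := cvg_inv_nat (`|1 - e%:R / 2| * 2).
exists N => n /hN; rewrite subr0.
have E : (1 : R) <= e%:R by rewrite ler1n.
have n0 : 0 <= n%:R :> R by [].
have n1 : 0 < (n.+1%:R : R) by rewrite ltr0n.
rewrite ger0_norm ?divr_ge0 ?mulr_ge0 //; apply: le_trans.
have -> : bin e n / bin e n.+1 - 1 = (1 - e%:R / 2) / (e%:R / 2 + n%:R).
  rewrite bin_S; have := bin_gt0 n e0; move: n1; rewrite -natr1 => n1 b.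
  by field; apply/and3P; split; apply: lt0r_neq0 => //; lra.
rewrite normrM normfV -mulrA ler_wpM2l // ger0_norm; last by lra.
rewrite ler_pdivlMr // mulrC ler_pdivrMr; last by lra.
by rewrite -natr1; lra.
Qed.

Lemma asyX u e C : (0 < e)%N -> asy u e C -> asy (fpsX R * u) e C.
Proof.
move=> e0 hu; rewrite /asy -(cvg_shiftS (fun n => (fpsX R * u) n / bin e n)).
rewrite (_ : (fun n => _) = fun n => u n / bin e n * (bin e n / bin e n.+1)).
  by rewrite -[C]mulr1; apply: cvgM => //; exact: bin_shift.
apply/funext => n; rewrite fpsXMS mulrA; congr (_ / _).
by rewrite mulfVK // lt0r_neq0 // bin_gt0.
Qed.

End Asymptotics.

(** * Truncated weighted l^1 norms *)

Section WeightedNorm.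
Variable R : realType.
Implicit Types (u v : fps R).

Definition ones : fps R := fun=> 1.

Lemma bin2E : bin R 2 = ones.
Proof. by apply/funext => n; rewrite bin2. Qed.

Lemma onesM u n : (u * ones) n = \sum_(i < n.+1) u i.
Proof. by rewrite fpsM; apply: eq_bigr => i _; rewrite mulr1. Qed.

Lemma ones_inv : (1 - fpsX R) * ones = 1.
Proof.
apply/funext => -[|n]; rewrite mulrBl mul1r fpsB; first by rewrite fpsXM0 subr0.
by rewrite fpsXMS subrr.
Qed.

(** Truncation at [N] makes the norm finite for every series; a bound uniform in [N] plays the role
    of membership in the Banach algebra. *)
Definition wnorm (w : nat -> R) (N : nat) u : R := \sum_(i < N) `|u i| * w i.

Variable w : nat -> R.
Hypothesis w_ge0 : forall i, 0 <= w i.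
Hypothesis wM : forall i j, w (i + j)%N <= w i * w j.

Lemma wnorm_ge0 N u : 0 <= wnorm w N u.
Proof. by apply: sumr_ge0 => i _; rewrite mulr_ge0. Qed.

Lemma wnormD N u v : wnorm w N (u + v) <= wnorm w N u + wnorm w N v.
Proof.
rewrite /wnorm -big_split; apply: ler_sum => i _ /=.
by rewrite -mulrDl ler_wpM2r // fpsD ler_normD.
Qed.

Lemma wnormM N u v : wnorm w N (u * v) <= wnorm w N u * wnorm w N v.
Proof.
case: N => [|N]; first by rewrite /wnorm !big_ord0 mul0r.
pose a : fps R := fun i => `|u i| * w i; pose b : fps R := fun i => `|v i| * w i.
have b0 i : 0 <= b i by rewrite /b mulr_ge0.
apply: le_trans (_ : ((a * b) * ones) N <= _).
  rewrite onesM; apply: ler_sum => i _; rewrite !fpsM.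
  apply: le_trans (ler_wpM2r (w_ge0 i) (ler_norm_sum _ _ _)) _.
  rewrite mulr_suml; apply: ler_sum => j _; rewrite normrM /a /b mulrACA ler_wpM2l ?mulr_ge0 //.
  have ji : (j <= i)%N by rewrite -ltnS.
  by rewrite -{1}(subnKC ji).
rewrite -mulrA fpsM /wnorm mulr_suml; apply: ler_sum => i _.
rewrite ler_wpM2l ?mulr_ge0 // onesM.
rewrite (big_ord_widen N.+1 b); last by rewrite ltnS leq_subr.
rewrite big_mkcond; apply: ler_sum => j _; case: ifP => _; first exact: lexx.
by rewrite mulr_ge0.
Qed.

(* With y_0 = 0, the coefficients of y^2 up to N only involve those of y below N. *)
Lemma wnorm_sq N u : u 0%N = 0 -> wnorm w N.+1 (u * u) <= wnorm w N u ^+ 2.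
Proof.
move=> u0; case: N => [|N].
  by rewrite /wnorm big_ord_recl big_ord0 fpsM0 u0 mul0r normr0 mul0r addr0 big_ord0 expr0n.
pose u' : fps R := fun i => if (i <= N)%N then u i else 0.
have e : wnorm w N.+2 (u * u) = wnorm w N.+2 (u' * u').
  apply: eq_bigr => -[i /= hi] _; congr (`|_| * _); rewrite !fpsM.
  apply: eq_bigr => -[j /= hj] _; rewrite /u'.
  have [->|j0] := posnP j; first by rewrite u0 !mul0r.
  have [->|ji] := eqVneq j i; first by rewrite subnn /= u0 !mulr0.
  rewrite !ifT //; lia.
have en : wnorm w N.+2 u' = wnorm w N.+1 u.
  rewrite /wnorm big_ord_recr /= {2}/u' ltnn normr0 mul0r addr0.
  by apply: eq_bigr => -[i /= hi] _; rewrite /u' -ltnS hi.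
by rewrite e expr2 -en; exact: wnormM.
Qed.

(* [t] is a supersolution of 2 t = W + t^2, so it bounds the truncated norms by
   induction on the truncation order. *)
Lemma wnorm_quadratic (W t : R) (y v : fps R) : y 0%N = 0 -> 0 <= t ->
  (forall n, 2 * `|y n| <= `|v n| + `|(y * y) n|) ->
  (forall N, wnorm w N v <= W) -> W + t ^+ 2 <= 2 * t -> forall N, wnorm w N y <= t.
Proof.
move=> y0 t0 hy hv ht; elim=> [|N IH]; first by rewrite /wnorm big_ord0.
suff : 2 * wnorm w N.+1 y <= W + t ^+ 2 by lra.
apply: le_trans (_ : wnorm w N.+1 v + wnorm w N.+1 (y * y) <= _).
  rewrite /wnorm mulr_sumr -big_split; apply: ler_sum => i _ /=.
  by rewrite mulrA -mulrDl ler_wpM2r.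
apply: lerD => //; apply: le_trans (wnorm_sq _ y0) _.
by rewrite ler_pXn2r // nnegrE ?wnorm_ge0.
Qed.

End WeightedNorm.

(** * Dominated convergence and transfer to coefficients *)

Section AbsoluteConvergence.
Variable R : realType.
Implicit Types (u v : fps R).

Lemma bounded_series_cauchy (b : nat -> R) B : (forall i, 0 <= b i) ->
  (forall N, \sum_(i < N) b i <= B) ->
  forall eps, 0 < eps -> exists N, forall M, (N <= M)%N -> \sum_(N <= i < M) b i <= eps.
Proof.
move=> b0 hB eps eps0.
pose E := [set x : R | exists N, x = \sum_(i < N) b i]%classic.
have hs : has_sup E by split; [exists 0, 0%N; rewrite big_ord0|exists B => x [N ->]].
have [x [N ->] hx] := sup_adherent eps0 hs.
exists N => M NM; have : \sum_(i < M) b i <= sup E by apply: sup_upper_bound => //; exists M.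
rewrite -(big_mkord xpredT b) (@big_cat_nat _ _ _ N) //= big_mkord; lra.
Qed.

(** Dominated convergence for finite sums of growing length. The comparison is with the partial sums
    of [l], so that the sum of the limits need not be named. *)
Lemma tannery (a : nat -> nat -> R) (l b : nat -> R) B :
  (forall i, ((a i : nat -> R) @ \oo --> (l i : R))%classic) ->
  (forall i n, (i <= n)%N -> `|a i n| <= b i) ->
  (forall N, \sum_(i < N) b i <= B) ->
  ((fun n => \sum_(i < n.+1) a i n - \sum_(i < n.+1) l i) @ \oo --> (0 : R))%classic.
Proof.
move=> ha hab hB.
have b0 i : 0 <= b i by apply: le_trans (hab i i (leqnn i)).
have hl i : `|l i| <= b i.
  apply/ler_addgt0Pr => eps eps0; have /cvg_seqP/(_ eps eps0)[N hN] := ha i.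
  have h1 := hN (maxn N i) (leq_maxl _ _); have h2 := hab i (maxn N i) (leq_maxr _ _).
  rewrite distrC in h1; have := ler_normB (l i - a i (maxn N i)) (- a i (maxn N i)).
  by rewrite opprK subrK normrN; lra.
apply: cvg0P => eps eps0.
have e4 : 0 < eps / 4 by rewrite divr_gt0.
have [N hN] := bounded_series_cauchy b0 hB e4.
have eN : 0 < eps / 2 / N.+1%:R by rewrite !divr_gt0 // ltr0n.
have [M hM] : exists M, forall i n, (i < N)%N -> (M <= n)%N -> `|a i n - l i| <= eps / 2 / N.+1%:R.
  move: (_ / _) eN => c c0; elim: (N) => [|K [M hM]]; first by exists 0%N.
  have /cvg_seqP/(_ _ c0)[M' hM'] := ha K.
  exists (maxn M M') => i n; rewrite ltnS leq_eqVlt geq_max => /orP[/eqP->|iK] /andP[h1 h2].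
    exact: hM'.
  exact: hM.
exists (N + M)%N => n hn.
rewrite -sumrB -(big_mkord xpredT (fun i => a i n - l i)) (@big_cat_nat _ _ _ N) //=; last by lia.
have h1 : `|\sum_(0 <= i < N) (a i n - l i)| <= eps / 2.
  rewrite big_mkord (le_trans (ler_norm_sum _ _ _)) //.
  apply: le_trans (_ : \sum_(i < N) eps / 2 / N.+1%:R <= _).
    by apply: ler_sum => i _; apply: hM => //; lia.
  rewrite sumr_const card_ord -[_ *+ N]mulr_natr mulrAC ler_pdivrMr ?ltr0n //.
  by rewrite ler_wpM2l ?divr_ge0 ?(ltW eps0) // ler_nat.
have h2 : `|\sum_(N <= i < n.+1) (a i n - l i)| <= 2 * (eps / 4).
  rewrite (le_trans (ler_norm_sum _ _ _)) //.
  apply: le_trans (_ : 2 * \sum_(N <= i < n.+1) b i <= _).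
    rewrite mulr_sumr big_nat_cond [leRHS]big_nat_cond; apply: ler_sum => i.
    rewrite andbT => /andP[_ hi]; have := hab i n hi; have := hl i; have := ler_normB (a i n) (l i).
    by lra.
  by rewrite ler_pM2l // hN //; lia.
by have := ler_normD (\sum_(0 <= i < N) (a i n - l i)) (\sum_(N <= i < n.+1) (a i n - l i)); lra.
Qed.

Lemma series_cvg (u : fps R) B : (forall N, \sum_(i < N) `|u i| <= B) ->
  exists l : R, ((fun n => \sum_(i < n.+1) u i) @ \oo --> l)%classic.
Proof.
move=> hB.
have : cvgn (series (fun i => `|u i|)).
  apply: nondecreasing_is_cvgn.
    by apply/nondecreasing_seqP => n; rewrite !seriesEord /= big_ord_recr lerDl.
  by exists B => _ [n _ <-]; rewrite seriesEord; exact: hB.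
move/normed_cvg/cvg_ex => [l hl]; exists l.
rewrite -(cvg_shiftS (series u)) in hl.
by apply: cvg_trans hl; apply: near_eq_cvg; near=> n; rewrite seriesEord.
Unshelve. all: by end_near.
Qed.

Lemma conv_to0 u v B : (forall N, \sum_(i < N) `|u i| <= B) ->
  (v @ \oo --> (0 : R))%classic -> ((u * v) @ \oo --> (0 : R))%classic.
Proof.
move=> hu hv; have [D D0 hD] := bounded_cvg hv.
rewrite (_ : u * v = fun n => \sum_(i < n.+1) u i * v (n - i)%N - \sum_(i < n.+1) 0); last first.
  by apply/funext => n; rewrite fpsM [X in _ - X]big1 ?subr0.
apply: (@tannery (fun i n => u i * v (n - i)%N) (fun=> 0) (fun i => `|u i| * D) (B * D)).
- move=> i; rewrite -(mulr0 (u i)); apply: cvgM; first exact: cvg_cst.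
  by rewrite (cvg_centern i v).
- by move=> i n _; rewrite normrM ler_wpM2l.
- by move=> N; rewrite -mulr_suml ler_wpM2r.
Qed.

(** The factors (i + 1/2) / (i + 1) increase with [i], so shifting them by [m] only enlarges the
    product. *)
Lemma bin1_submul i m : bin R 1 i * bin R 1 m <= bin R 1 (i + m)%N.
Proof.
elim: i => [|i IH]; first by rewrite bin_0 mul1r.
rewrite addSn !bin_S mulrAC; apply: ler_pM => //.
  by rewrite mulr_ge0 ?bin_ge0.
have i0 : 0 <= i%:R :> R by []. have m0 : 0 <= m%:R :> R by [].
rewrite ler_pdivrMr ?ltr0n // mulrAC ler_pdivlMr ?ltr0n //.
rewrite -(natr1 (i + m)) -(natr1 i) natrD; nra.
Qed.

Lemma bin1_ge i : 1 <= (2 * i%:R + 1) * bin R 1 i.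
Proof.
elim: i => [|i IH]; first by rewrite bin_0; lra.
apply: le_trans IH _; rewrite bin_S mulrCA [leLHS]mulrC ler_wpM2l ?bin_ge0 //.
have i0 : 0 <= i%:R :> R by [].
by rewrite mulrA ler_pdivlMr ?ltr0n // -(natr1 i); nra.
Qed.

(** The bound does not depend on [n], so it can serve as the dominating factor in [tannery]. *)
Lemma bin1_ratio n i : (i <= n)%N -> bin R 1 (n - i)%N / bin R 1 n <= 2 * i%:R + 1.
Proof.
move=> h; have bn : 0 < bin R 1 n by exact: bin_gt0.
rewrite ler_pdivrMr //; apply: le_trans (_ : (2 * i%:R + 1) * (bin R 1 i * bin R 1 (n - i)%N) <= _).
  by rewrite mulrA ler_peMl ?bin_ge0 ?bin1_ge.
rewrite ler_wpM2l ?addr_ge0 ?mulr_ge0 //.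
by have := bin1_submul i (n - i)%N; rewrite subnKC.
Qed.

Lemma bin1_ratio_cvg i : ((fun n => bin R 1 (n - i)%N / bin R 1 n) @ \oo --> (1 : R))%classic.
Proof.
rewrite -(cvg_shiftn i) (_ : (fun n => _) = fun n => bin R 1 n / bin R 1 (n + i)%N); last first.
  by apply/funext => n; rewrite addnK.
elim: i => [|i IH].
  rewrite (_ : (fun n => _) = fun=> 1); first exact: cvg_cst.
  by apply/funext => n; rewrite addn0 divff // lt0r_neq0 // bin_gt0.
rewrite (_ : (fun n => _) = fun n => (bin R 1 n / bin R 1 (n + i)%N) * (bin R 1 (n + i)%N / bin R 1 (n + i).+1)).
  have h : ((fun n => bin R 1 (n + i)%N / bin R 1 (n + i).+1) @ \oo --> (1 : R))%classic.
    by rewrite (cvg_shiftn i (fun n => bin R 1 n / bin R 1 n.+1)); exact: bin_shift.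
  have := cvgM IH h; rewrite mulr1; exact.
apply/funext => n; rewrite addnS mulrA; congr (_ / _).
by rewrite mulfVK // lt0r_neq0 // bin_gt0.
Qed.

(** In both conclusions [K] is the sum u(1) of the coefficients. The second one, about u/(1 - x), is
    there to identify the constant: it will give k(1) g(1) = 1 for mutually inverse series. *)
Lemma asy_summable_mul u B : (forall N, \sum_(i < N) `|u i| * (2 * i%:R + 1) <= B) ->
  exists2 K : R, asy (u * bin R 1) 1 K & asy (u * ones R) 2 K.
Proof.
move=> hB; have hB' N : \sum_(i < N) `|u i| <= B.
  by apply: le_trans (hB N); apply: ler_sum => i _; rewrite ler_peMr // lerDr mulr_ge0.
have [K hK] := series_cvg hB'.
have h2 : asy (u * ones R) 2 K.
  rewrite /asy (_ : (fun n => _) = fun n => \sum_(i < n.+1) u i) //.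
  by apply/funext => n; rewrite bin2 divr1 onesM.
exists K => //.
have h : ((fun n => \sum_(i < n.+1) u i * (bin R 1 (n - i)%N / bin R 1 n) -
    \sum_(i < n.+1) u i) @ \oo --> (0 : R))%classic.
  apply: (@tannery (fun i n => u i * (bin R 1 (n - i)%N / bin R 1 n)) u
    (fun i => `|u i| * (2 * i%:R + 1)) B _ _ hB).
    by move=> i; have := cvgM (cvg_cst (u i)) (bin1_ratio_cvg i); rewrite mulr1; exact.
  move=> i n ni; rewrite normrM ler_wpM2l // ger0_norm ?divr_ge0 ?bin_ge0 //.
  exact: bin1_ratio.
rewrite /asy (_ : (fun n => _) = fun n => (\sum_(i < n.+1) u i * (bin R 1 (n - i)%N / bin R 1 n) -
    \sum_(i < n.+1) u i) + \sum_(i < n.+1) u i).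
  by have := cvgD h hK; rewrite add0r; exact.
apply/funext => n; rewrite subrK fpsM mulr_suml; apply: eq_bigr => i _.
by rewrite mulrA.
Qed.

End AbsoluteConvergence.

(** * The series of binary trees *)

Section BinaryTreeSeries.
Variable R : realType.

Definition natser (u : nat -> nat) : fps R := fun n => (u n)%:R.

Definition vcnt : fps R := natser (acnt [::]).

Lemma vcnt_ge0 n : 0 <= vcnt n. Proof. exact: ler0n. Qed.

Lemma vcnt0 : vcnt 0 = 1.
Proof. by rewrite /vcnt /natser acnt_pcnt // pcnt0. Qed.

Lemma diag_nil k : diag [::] k = if odd k then 0%N else acnt [::] k./2.
Proof.
rewrite /diag; case: ifP => // _; apply: eq_count => m; congr (_ && _).
by apply/perm_nilP/perm_nilP => [|->] //; case: (fcode m).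
Qed.

Lemma natr_conv (u v : nat -> nat) n : (conv_cnt u v n)%:R = (natser u * natser v) n.
Proof. by rewrite fpsM natr_sum; apply: eq_bigr => i _; rewrite natrM. Qed.

Definition dil (t : R) (u : fps R) : fps R := fun n => u n * t ^+ n.

Lemma dilM t (u v : fps R) : dil t u * dil t v = dil t (u * v).
Proof.
apply/funext => n; rewrite /dil !fpsM mulr_suml; apply: eq_bigr => i _.
have h : (i <= n)%N by rewrite -ltnS.
have -> : t ^+ n = t ^+ i * t ^+ (n - i) by rewrite -exprD subnKC.
ring.
Qed.

Lemma vcntS k : 2 * vcnt k.+1 = (vcnt * vcnt) k +
  if odd k then 0 else vcnt k./2.
Proof.
have := congr1 (fun n => n%:R : R) (pcntS [::] k).
rewrite -[splits [::]]/[:: ([::], [::])] big_seq1 diag_nil -muln2 natrM natrD natr_conv.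
by rewrite -acnt_pcnt // mulrC => ->; congr (_ + _); case: ifP.
Qed.

(* With V the generating function of the binary trees by internal nodes, these
   are p(x) = t x V(t x) and f(x) = 2 t x + t^2 x^2 V(t^2 x^2), so that the
   functional equation of V reads (1 - p)^2 = 1 - f. *)
Definition pser (t : R) : fps R := scale t * (fpsX R * dil t vcnt).

Lemma pser0 t : pser t 0%N = 0.
Proof. by rewrite /pser scaleM fpsXM0 mulr0. Qed.

Lemma pserS t n : pser t n.+1 = vcnt n * t ^+ n.+1.
Proof. by rewrite /pser scaleM fpsXMS /dil exprS mulrCA. Qed.

Lemma pser_ge0 t n : 0 <= t -> 0 <= pser t n.
Proof. by move=> t0; case: n => [|n]; rewrite ?pser0 // pserS mulr_ge0 ?vcnt_ge0 ?exprn_ge0. Qed.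

(** The series F(x^2). *)
Definition evenser (F : nat -> R) : fps R := fun n => if odd n then 0 else F n./2.

Definition fser (t : R) : fps R :=
  scale (2 * t) * fpsX R + evenser (fun m => pser t m * t ^+ m).

Lemma pser_quadratic t : scale 2 * pser t = fser t + pser t * pser t.
Proof.
apply/funext => n; rewrite /fser !fpsD !scaleM /evenser.
have -> : pser t * pser t = scale t * (scale t * (fpsX R * (fpsX R * (dil t vcnt * dil t vcnt)))).
  by rewrite /pser; ring.
rewrite !scaleM dilM; case: n => [|[|n]].
- by rewrite pser0 fpsXM0 /= ?pser0 /fpsX /= !mulr0 !mul0r !addr0.
- by rewrite pserS fpsXMS fpsXM0 vcnt0 /fpsX /=; ring.
rewrite !fpsXMS pserS [2 * (_ * _)]mulrA vcntS /= negbK; rewrite /fpsX /= mulr0 add0r /dil.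
case: ifP => on; first by rewrite addr0 add0r exprS exprS; ring.
rewrite pserS mulrDl -mulrA -exprD addrC; congr (_ + _); last by rewrite exprS exprS; ring.
by congr (_ * _ ^+ _); move: on; lia.
Qed.

Lemma evenser_sum F N : \sum_(i < N.+1) evenser F i = \sum_(j < (N./2).+1) F j.
Proof.
elim: N => [|N IH]; first by rewrite !big_ord_recl !big_ord0.
rewrite big_ord_recr IH /evenser [nat_of_ord ord_max]/=; case: ifP => on.
  have -> : (N.+1)./2 = N./2 by move: on; rewrite /=; lia.
  by rewrite /= addr0.
have -> : (N.+1)./2 = (N./2).+1 by move: on; rewrite /=; lia.
by rewrite [RHS]big_ord_recr.
Qed.

Lemma sum_mono (F : nat -> R) N M : (forall i, 0 <= F i) -> (N <= M)%N ->
  \sum_(i < N) F i <= \sum_(i < M) F i.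
Proof.
move=> F0 NM; rewrite (big_ord_widen M F) // big_mkcond; apply: ler_sum => i _.
by case: ifP.
Qed.

Lemma evenser_sum_le F N : (forall i, 0 <= F i) -> F 0%N = 0 ->
  \sum_(i < N.+1) evenser F i <= \sum_(j < N) F j.
Proof.
move=> h F0; rewrite evenser_sum; case: N => [|N]; first by rewrite big_ord_recl !big_ord0 F0 addr0.
by apply: sum_mono => //; lia.
Qed.

Lemma evenser_sum_le' F N : (forall i, 0 <= F i) ->
  \sum_(i < N) evenser F i <= \sum_(j < N) F j.
Proof.
move=> h; case: N => [|N]; first by rewrite !big_ord0.
by rewrite evenser_sum; apply: sum_mono => //; lia.
Qed.

Lemma fserS t N : \sum_(i < N.+2) fser t i = 2 * t + \sum_(j < (N.+1)./2) vcnt j * t ^+ (j.+1).*2.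
Proof.
rewrite /fser big_split /= evenser_sum; congr (_ + _).
  rewrite 2!big_ord_recl big1 ?addr0 => [|i _]; rewrite scaleM /fpsX /=.
    by rewrite !scaleM /fpsX /= mulr0 add0r mulr1.
  by rewrite mulr0.
rewrite big_ord_recl pser0 mul0r add0r; apply: eq_bigr => j _.
by rewrite pserS -mulrA -exprD addnn.
Qed.

Lemma fser_ge0 t n : 0 <= t -> 0 <= fser t n.
Proof.
move=> t0; rewrite /fser fpsD scaleM addr_ge0 //.
  by rewrite !mulr_ge0 // /fpsX ler0n.
by rewrite /evenser; case: ifP => // _; rewrite mulr_ge0 ?exprn_ge0 ?pser_ge0.
Qed.

(** * The radius of convergence *)

Definition wone (n : nat) : R := 1.

Lemma wnorm1 (u : fps R) N : (forall n, 0 <= u n) -> wnorm wone N u = \sum_(i < N) u i.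
Proof. by move=> h; apply: eq_bigr => i _; rewrite mulr1 ger0_norm. Qed.

(** For t = 1/4, a partial sum s of p(1) gives the next one the bound 2 s' <= 1/2 + s/4 + s^2, where
    the first two terms bound f(1). With s <= 1/2 the right side is at most 7/8. *)
Lemma pser_quarter N : \sum_(i < N) pser 4^-1 i <= 2^-1.
Proof.
have q0 : 0 <= 4^-1 :> R by rewrite invr_ge0.
have hp n := pser_ge0 n q0.
elim: N => [|N IH]; first by rewrite big_ord0 invr_ge0.
suff : 2 * \sum_(i < N.+1) pser 4^-1 i <= 1 by lra.
have e : 2 * \sum_(i < N.+1) pser 4^-1 i =
    \sum_(i < N.+1) fser 4^-1 i + wnorm wone N.+1 (pser 4^-1 * pser 4^-1).
  rewrite wnorm1; last by move=> n; rewrite fpsM sumr_ge0 // => i _; rewrite mulr_ge0.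
  rewrite mulr_sumr -big_split; apply: eq_bigr => i _ /=.
  by rewrite -fpsD -pser_quadratic scaleM.
have h1 : wnorm wone N.+1 (pser 4^-1 * pser 4^-1) <= (\sum_(i < N) pser 4^-1 i) ^+ 2.
  rewrite -wnorm1 //; apply: wnorm_sq; rewrite ?pser0 // => *; rewrite /wone ?mulr1 //.
have h2 : \sum_(i < N.+1) fser 4^-1 i <= 2^-1 + 4^-1 * \sum_(i < N) pser 4^-1 i.
  rewrite /fser big_split /=; apply: lerD.
    apply: le_trans (_ : \sum_(i < N.+2) (scale (2 * 4^-1) * fpsX R : fps R) i <= _).
      by apply: sum_mono => // i; rewrite scaleM !mulr_ge0 // /fpsX ler0n.
    rewrite 2!big_ord_recl big1 ?addr0 => [|i _]; rewrite ?scaleM /fpsX /= ?mulr0 //.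
    lra.
  apply: le_trans (evenser_sum_le _ _ _) _.
  - by move=> i; rewrite mulr_ge0 ?exprn_ge0.
  - by rewrite pser0 mul0r.
  rewrite mulr_sumr; apply: ler_sum => -[[|i] hi] _ /=; first by rewrite pser0 mul0r mulr0.
  rewrite mulrC ler_wpM2r // exprS ler_piMr // exprn_ile1 //; lra.
have s0 : 0 <= \sum_(i < N) pser 4^-1 i by apply: sumr_ge0.
rewrite e; move: h1 h2 s0 IH; set s := \sum_(i < N) _; set a := wnorm _ _ _; set b := \sum_(i < _) _.
by move=> *; nra.
Qed.

(** Partial sum of 2 x + x^2 V(x^2), which is the value at 1 of [fser x], seen as a function of the
    parameter. *)
Definition gpol (N : nat) (x : R) : R := 2 * x + \sum_(j < N) vcnt j * x ^+ (j.+1).*2.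

(** At x = 1/2 the series V(x^2) is evaluated at 1/4, where [pser_quarter] controls it: the bound is
    1 + 1/2. *)
Lemma gpol_half N : gpol N 2^-1 <= 3 / 2.
Proof.
rewrite /gpol; have := pser_quarter N.+1.
rewrite big_ord_recl pser0 add0r => h.
have e : \sum_(j < N) vcnt j * 2^-1 ^+ (j.+1).*2 = \sum_(j < N) pser 4^-1 j.+1.
  apply: eq_bigr => j _; rewrite pserS -mul2n exprM; congr (_ * _ ^+ _); lra.
by rewrite e; move: h; under eq_bigr do rewrite lift0; lra.
Qed.

Lemma gpol_mono N M x : 0 <= x -> (N <= M)%N -> gpol N x <= gpol M x.
Proof.
move=> x0 NM; rewrite lerD2l.
by apply: (@sum_mono (fun j => vcnt j * x ^+ (j.+1).*2)) => // i; rewrite mulr_ge0 ?vcnt_ge0 ?exprn_ge0.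
Qed.

Lemma expr_lipschitz (a b : R) n : 0 <= a -> a <= b -> b <= 1 -> b ^+ n - a ^+ n <= n%:R * (b - a).
Proof.
move=> a0 ab b1; elim: n => [|n IH]; first by rewrite !expr0 subrr mul0r.
rewrite !exprS -natr1 mulrDl mul1r.
have -> : b * b ^+ n - a * a ^+ n = b * (b ^+ n - a ^+ n) + (b - a) * a ^+ n by ring.
apply: lerD.
  apply: le_trans IH; rewrite ler_piMl // subr_ge0 lerXn2r // nnegrE //; lra.
by rewrite ler_piMr ?subr_ge0 // exprn_ile1 //; lra.
Qed.

Lemma expr_convex (t a b : R) n : 0 <= t -> t <= 1 -> 0 <= a -> a <= b ->
  ((1 - t) * a + t * b) ^+ n <= (1 - t) * a ^+ n + t * b ^+ n.
Proof.
move=> t0 t1 a0 ab; have b0 : 0 <= b by lra.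
elim: n => [|n IH]; first by rewrite !expr0; lra.
rewrite exprS; set x := _ + _ in IH *.
have x0 : 0 <= x by rewrite /x; nra.
apply: le_trans (ler_wpM2l x0 IH) _; rewrite !exprS /x.
have : a ^+ n <= b ^+ n by rewrite lerXn2r // nnegrE.
set A := a ^+ n; set B := b ^+ n => AB.
have h : 0 <= (1 - t) * t * ((b - a) * (B - A)) by rewrite !mulr_ge0 //; lra.
by nra.
Qed.

Lemma gpol_convex N (t a b : R) : 0 <= t -> t <= 1 -> 0 <= a -> a <= b ->
  gpol N ((1 - t) * a + t * b) <= (1 - t) * gpol N a + t * gpol N b.
Proof.
move=> t0 t1 a0 ab; rewrite /gpol.
set s := \sum_(j < N) _; set sa := \sum_(j < N) _; set sb := \sum_(j < N) _.
have : s <= (1 - t) * sa + t * sb.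
  rewrite /s /sa /sb !mulr_sumr -big_split; apply: ler_sum => j _ /=.
  have := expr_convex (j.+1).*2 t0 t1 a0 ab; have := vcnt_ge0 j; nra.
by lra.
Qed.

(* [r] is the dominant singularity of V, the point where f(1) = 1. *)
Lemma radius_exists : exists r : R, [/\ 4^-1 <= r, r <= 2^-1,
  forall N, gpol N r <= 1 & forall eps, 0 < eps -> exists N, 1 - eps <= gpol N r].
Proof.
pose E := [set x : R | 0 <= x /\ forall N, gpol N x <= 1]%classic.
(* By [gpol_half] the nonlinear part is at most 1/2 at the point 1/2, hence also at 1/4, where the
   linear part is 1/2. *)
have Eq : E 4^-1.
  split; first by rewrite invr_ge0.
  move=> N; have := gpol_half N; rewrite /gpol.
  set a := \sum_(j < N) _; set b := \sum_(j < N) _.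
  have : b <= a; last by lra.
  apply: ler_sum => j _; rewrite ler_wpM2l ?vcnt_ge0 // lerXn2r ?nnegrE //; lra.
have ub x : E x -> x <= 2^-1.
  by move=> [_ /(_ 0%N)]; rewrite /gpol big_ord0; lra.
have hs : has_sup E by split; [exists 4^-1|exists 2^-1 => x /ub].
pose r := sup E.
have r4 : 4^-1 <= r by apply: sup_upper_bound.
have r2 : r <= 2^-1 by apply: ge_sup; [exists 4^-1|move=> x /ub].
(* Each partial sum is Lipschitz on [0, 1], so the inequality passes to the supremum. *)
have hr N : gpol N r <= 1.
  apply/ler_addgt0Pr => eps eps0.
  pose L := 2 + \sum_(j < N) vcnt j * (j.+1).*2%:R.
  have L0 : 0 < L by rewrite ltr_wpDr // sumr_ge0 // => j _; rewrite mulr_ge0 ?vcnt_ge0.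
  have d0 : 0 < eps / L by rewrite divr_gt0.
  have [x [x0 hx] xr] := sup_adherent d0 hs.
  have xr' : x <= r by apply: sup_upper_bound.
  have : gpol N r - gpol N x <= L * (r - x).
    have -> : gpol N r - gpol N x = 2 * (r - x) +
      \sum_(j < N) vcnt j * (r ^+ (j.+1).*2 - x ^+ (j.+1).*2).
      rewrite /gpol; under [X in _ = _ + X]eq_bigr do rewrite mulrBr.
      by rewrite sumrB; ring.
    rewrite /L [leRHS]mulrDl lerD2l mulr_suml; apply: ler_sum => j _.
    rewrite -mulrA ler_wpM2l ?vcnt_ge0 // expr_lipschitz //; lra.
  have : L * (r - x) <= eps.
    by rewrite mulrC -ler_pdivlMr //; rewrite -/r in xr; lra.
  have := hx N; lra.
exists r; split=> // eps eps0.
have [//|h] := pselect (exists N, 1 - eps <= gpol N r).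
have {}h N : gpol N r < 1 - eps.
  by rewrite ltNge; apply/negP => hN; apply: h; exists N.
have e1 : eps < 1.
  by have := h 0%N; rewrite /gpol big_ord0; lra.
(* If all values at [r] stayed below 1 - eps, convexity would bound the values at this larger point
   by (1 - eps/2)(1 - eps) + (eps/2)(3/2) <= 1, uniformly in [N], contradicting the choice of
   [r]. *)
pose x := (1 - eps / 2) * r + eps / 2 * 2^-1.
have xr : r < x.
  by have := h 0%N; rewrite /gpol big_ord0 /x; nra.
have : E x.
  split=> [|N]; first by lra.
  have g0 : 0 <= gpol N r by rewrite addr_ge0 ?mulr_ge0 ?sumr_ge0 //; [lra|move=> j _; rewrite mulr_ge0 ?vcnt_ge0 ?exprn_ge0 //; lra].
  have := @gpol_convex N (eps / 2) r 2^-1; rewrite -/x.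
  have := gpol_half N; have := h N; set a := gpol N r in g0 *; set b := gpol N _.
  move=> h1 h2 /(_ _ _ _ _)/le_trans; apply; try lra.
  by nra.
by move=> /(sup_upper_bound hs); rewrite -/r leNgt xr.
Qed.
End BinaryTreeSeries.

(** * The square-root singularity of the rescaled series *)

Section SingularExpansion.
Variable R : realType.
Variable r : R.
Hypothesis r_ge : 4^-1 <= r.
Hypothesis r_le : r <= 2^-1.
Hypothesis gpol_le : forall N, gpol N r <= 1.
Hypothesis gpol_sup : forall eps, 0 < eps -> exists N, 1 - eps <= gpol N r.

Let p := pser r.
Let f := fser r.

Lemma r_ge0 : 0 <= r.
Proof. by apply: le_trans r_ge; rewrite invr_ge0. Qed.
Let r0 := r_ge0.

Let p0 n : 0 <= p n. Proof. exact: pser_ge0. Qed.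
Let f0 n : 0 <= f n. Proof. exact: fser_ge0. Qed.

Lemma fser_gpol N : \sum_(i < N.+2) f i = gpol (N.+1)./2 r.
Proof. exact: fserS. Qed.

Lemma fser_sum_le N : \sum_(i < N) f i <= 1.
Proof.
apply: le_trans (_ : \sum_(i < N.+2) f i <= _); last by rewrite fser_gpol.
by apply: sum_mono => //; lia.
Qed.

Lemma fser_sum_ge eps : 0 < eps -> exists N, forall M, (N <= M)%N ->
  1 - eps <= \sum_(i < M) f i.
Proof.
move=> /gpol_sup[N hN]; exists (N.*2).+2 => M hM.
apply: le_trans (_ : \sum_(i < (N.*2).+2) f i <= _); last exact: sum_mono.
by rewrite fser_gpol; apply: le_trans hN _; apply: gpol_mono => //; lia.
Qed.

Lemma pser_sum_le N : \sum_(i < N) p i <= 1.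
Proof.
rewrite -wnorm1 //.
(* The value 1 is the double root of t^2 - 2 t + 1, so the argument is at its limit here. *)
apply: (@wnorm_quadratic _ (@wone R) _ _ 1 1 p f) => //.
- by move=> *; rewrite /wone mulr1.
- exact: pser0.
- move=> n; have -> : 2 * `|p n| = `|(scale 2 * p) n| by rewrite scaleM normrM ger0_norm.
  by rewrite pser_quadratic fpsD ler_normD.
- by move=> N'; rewrite wnorm1 //; exact: fser_sum_le.
- by lra.
Qed.

(** The quotient (1 - f)/(1 - x). Since f(1) = 1, its coefficients are the tails of f. *)
Let q : fps R := (1 - f) * ones R.

Lemma qE n : q n = 1 - \sum_(i < n.+1) f i.
Proof.
rewrite /q mulrBl mul1r fpsB onesM /ones.
by [].
Qed.

(** Linear, so as to dominate 2 n + 1 up to the factor 20; the small slope keeps the norm of q - 1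
    below 1. *)
Definition wlin (n : nat) : R := 1 + n%:R / 10.

Lemma wlin_ge0 n : 0 <= wlin n.
Proof. by rewrite addr_ge0 ?divr_ge0. Qed.

Lemma wlinM i j : wlin (i + j) <= wlin i * wlin j.
Proof.
rewrite /wlin natrD; have : 0 <= i%:R * j%:R :> R by rewrite mulr_ge0.
lra.
Qed.

Lemma wlin0 : wlin 0 = 1. Proof. by rewrite /wlin mul0r addr0. Qed.

(** The total weight with which the coefficient f_k enters the norm of q - 1: it occurs in the tails
    of positive index n < k. *)
Definition wsum (k : nat) : R := \sum_(n < k) (if n == 0%N :> nat then 0 else wlin n).

Lemma wsum_closed k : wsum k.+1 = k%:R + k%:R * k.+1%:R / 20.
Proof.
elim: k => [|k IH]; first by rewrite /wsum big_ord_recl big_ord0 /= mul0r mul0r !addr0.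
by rewrite /wsum big_ord_recr /= -/(wsum k.+1) IH /wlin -(natr1 k.+1) -(natr1 k); field.
Qed.

(* Equality holds for m = 2 and r = 1/2. *)
Lemma wsum_bound m : r ^+ m * wsum m.*2 <= 9 / 10.
Proof.
case: m => [|m]; first by rewrite /wsum big_ord0 mulr0; lra.
rewrite doubleS wsum_closed.
have h : ((m.*2.+1 * (11 + m)) <= 9 * 2 ^ m.+1)%N.
  case: m => [|[|[|m]]] //.
  elim: m => [|m IH] //; rewrite expnS; move: IH; set x := (2 ^ _)%N; lia.
have {h} : (m.*2.+1%:R * (11 + m%:R) <= 9 * 2 ^+ m.+1 :> R).
  by move: h; rewrite -(ler_nat R) !natrM natrD natrX.
have -> : m.*2.+1%:R + m.*2.+1%:R * m.*2.+2%:R / 20 = m.*2.+1%:R * (11 + m%:R) / 10 :> R.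
  by rewrite -(natr1 m.*2.+1) -(natr1 m.*2) -mul2n natrM; field.
move=> h; have rm : r ^+ m.+1 <= 2^-1 ^+ m.+1 by rewrite lerXn2r ?nnegrE //; lra.
apply: le_trans (_ : 2^-1 ^+ m.+1 * (9 * 2 ^+ m.+1 / 10) <= _).
  apply: ler_pM => //; first exact: exprn_ge0.
  by rewrite ler_pM2r ?invr_gt0.
by rewrite exprVn; have : (2 : R) ^+ m.+1 != 0 by []; move=> ?; rewrite le_eqVlt; apply/orP; left; apply/eqP; field.
Qed.

(** The coefficient f_(2m) is p_m r^m, to which [wsum_bound] applies. The linear term 2 r x, the
    largest part of f, is harmless because it only enters the constant coefficient of q, and
    [wsum 1] is 0. *)
Lemma f_wsum k : f k * wsum k <= evenser (fun m => 9 / 10 * p m) k.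
Proof.
rewrite /f /fser fpsD scaleM /evenser; case: ifP => ok.
  rewrite addr0 /fpsX; case: eqP => [->|_]; last by rewrite mulr0 mul0r.
  by rewrite /wsum big_ord_recl big_ord0 /= addr0 mulr0.
have -> : fpsX R k = 0 by rewrite /fpsX; case: k ok => [|[]].
rewrite mulr0 add0r -mulrA mulrC ler_wpM2r // -{2}(odd_double_half k) ok.
exact: wsum_bound.
Qed.

Lemma q0 : q 0%N = 1.
Proof.
rewrite qE big_ord1 /f /fser fpsD scaleM /fpsX mulr0 add0r /evenser /= pser0 mul0r subr0 //.
Qed.

(** Exchanging the sums over n and over the tails turns the norm into the sum of f_k [wsum k], at
    most 9/10 p(1) <= 9/10. *)
Lemma wnorm_q N : wnorm wlin N (q - 1) <= 9 / 10.
Proof.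
apply/ler_addgt0Pr => eps eps0.
pose W := \sum_(n < N) wlin n + 1.
have W0 : 0 < W by rewrite ltr_wpDl // sumr_ge0 // => i _; exact: wlin_ge0.
(* Past [M0] the partial sums of f are within [eps / W] of 1, so cutting all tails at [M] changes
   the norm by at most [eps]. *)
have [M0 hM] := fser_sum_ge (divr_gt0 eps0 W0).
pose M := (M0 + N)%N.
have hq (n : 'I_N) : `|(q - 1) n| * wlin n <=
   eps / W * wlin n + \sum_(k < M) (if ((n : nat) != 0%N) && (n < k)%N then f k * wlin n else 0).
  have [e|n0] := eqVneq (n : nat) 0%N.
    by rewrite e fpsB q0 fps1 subrr normr0 mul0r addr_ge0 ?sumr_ge0 // mulr_ge0 ?wlin_ge0 ?divr_ge0 ?(ltW eps0) ?(ltW W0).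
  rewrite fpsB fps1 (negPf n0) subr0 qE ger0_norm ?subr_ge0 ?fser_sum_le //.
  have -> : \sum_(k < M) (if true && (n < k)%N then f k * wlin n else 0) =
      (\sum_(k < M) f k - \sum_(k < n.+1) f k) * wlin n.
    have nM : (n.+1 <= M)%N by rewrite /M; have := ltn_ord n; lia.
    rewrite (big_ord_widen M f nM) [X in _ - X]big_mkcond -sumrB mulr_suml.
    by apply: eq_bigr => k _ /=; rewrite ltnS [(k <= n)%N]leqNgt; case: (n < k)%N;
      rewrite /= ?subr0 ?subrr ?mul0r.
  rewrite -mulrDl ler_wpM2r ?wlin_ge0 //.
  by have := hM M (leq_addr _ _); lra.
apply: le_trans (ler_sum _ (fun n _ => hq n)) _.
rewrite big_split /= -mulr_sumr addrC; apply: lerD; last first.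
  rewrite mulrAC ler_pdivrMr // ler_pM2l // /W; lra.
rewrite exchange_big /=.
apply: le_trans (_ : \sum_(k < M) f k * wsum k <= _).
  apply: ler_sum => k _; rewrite /wsum mulr_sumr.
  have [kN|Nk] := leqP k N.
    rewrite (big_ord_widen N (fun n => f k * (if n == 0%N then 0 else wlin n)) kN).
    rewrite [leRHS]big_mkcond; apply: ler_sum => n _ /=.
    by case: ifP => [/andP[/negPf-> ->]|] //; case: ifP => // _ _; rewrite mulr_ge0 //; case: ifP => // _; exact: wlin_ge0.
  rewrite (big_ord_widen k (fun n => if (n != 0%N) && (n < k)%N then f k * wlin n else 0) (ltnW Nk)).
  rewrite big_mkcond; apply: ler_sum => n _ /=.
  have h : 0 <= f k * (if n == 0%N :> nat then 0 else wlin n).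
    by rewrite mulr_ge0 //; case: ifP => // _; exact: wlin_ge0.
  case: ifP => // _; case: ifP => // /andP[/negPf n0 _].
  by rewrite n0.
apply: le_trans (ler_sum _ (fun (k : 'I_M) _ => f_wsum k)) _.
apply: le_trans (evenser_sum_le' _ _) _; first by move=> i; rewrite mulr_ge0 // divr_ge0.
rewrite -mulr_sumr -[leRHS]mulr1 ler_wpM2l ?divr_ge0 //; exact: pser_sum_le.
Qed.

(** The square root of q, already available as (1 - p)(1 - x)^(-1/2). *)
Let g : fps R := (1 - p) * bin R 1.
Let y : fps R := g - 1.

Lemma p_quadratic : (1 - p) * (1 - p) = 1 - f.
Proof.
have := pser_quadratic r; rewrite -/p -/f scale2.
by move=> h; rewrite -[f](addrK (p * p)) -h; ring.
Qed.

Lemma bin11 : bin R 1 * bin R 1 = ones R.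
Proof. by rewrite bin_mul bin2E. Qed.

Lemma g_sq : g * g = q.
Proof. by rewrite /q -p_quadratic -bin11 /g; ring. Qed.

(** From g^2 = q one gets 2 y = (q - 1) - y^2, and 9/10 + (7/10)^2 = 1.39 <= 2 * 7/10. *)
Lemma wnorm_y N : wnorm wlin N y <= 7 / 10.
Proof.
apply: (@wnorm_quadratic _ wlin wlin_ge0 wlinM (9 / 10) (7 / 10) y (q - 1)) => //.
- by rewrite /y fpsB /g fpsM0 fpsB /p pser0 bin_0 fps1 subr0 mulr1 subrr.
- move=> n; have -> : 2 * `|y n| = `|(scale 2 * y) n| by rewrite scaleM normrM ger0_norm.
  have -> : scale 2 * y = (q - 1) - y * y.
    by rewrite scale2 -g_sq /y; ring.
  by rewrite fpsB ler_normB.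
- exact: wnorm_q.
- by lra.
Qed.

Variable D : fps R.
Hypothesis D_ge0 : forall n, 0 <= D n.
Hypothesis D_inv : D * (1 - p) = 1.

(** The inverse of g, that is D (1 - x)^(1/2); the positive power is written as (1 - x)(1 -
    x)^(-1/2). *)
Let k : fps R := D * bin R 1 * (1 - fpsX R).

Lemma kg : k * g = 1.
Proof.
have -> : k * g = (D * (1 - p)) * ((1 - fpsX R) * (bin R 1 * bin R 1)) by rewrite /k /g; ring.
by rewrite D_inv bin11 ones_inv mulr1.
Qed.

Lemma k_bin : k * bin R 1 = D.
Proof.
have -> : k * bin R 1 = D * ((1 - fpsX R) * (bin R 1 * bin R 1)) by rewrite /k; ring.
by rewrite bin11 ones_inv mulr1.
Qed.

Lemma wnorm_one (u : fps R) N : u = 1 -> wnorm wlin N u <= 1.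
Proof.
move=> ->; case: N => [|N]; first by rewrite /wnorm big_ord0.
rewrite /wnorm big_ord_recl big1 ?addr0 => [|i _]; first by rewrite fps1 normr1 wlin0 mul1r.
by rewrite fps1 normr0 mul0r.
Qed.

(** As k = 1 - y k, the norm satisfies |k| <= 1 + 7/10 |k|, which can be solved because truncated
    norms are finite. *)
Lemma wnorm_k N : wnorm wlin N k <= 10 / 3.
Proof.
have e : k = 1 + - (y * k).
  by rewrite /y -[X in X + _]kg; ring.
have h1 : wnorm wlin N k <= 1 + wnorm wlin N (y * k).
  rewrite {1}e; apply: le_trans (wnormD wlin_ge0 _ _ _) _; apply: lerD; first exact: wnorm_one.
  by rewrite /wnorm; apply: ler_sum => i _; rewrite fpsN normrN.
have := wnormM wlin_ge0 wlinM N y k; have := wnorm_y N.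
have := wnorm_ge0 wlin_ge0 N k.
move: h1; set a := wnorm _ _ _; set b := wnorm _ _ _; set c := wnorm _ _ _.
by nra.
Qed.

Lemma wlin_dominates (u : fps R) B : (forall N, wnorm wlin N u <= B) ->
  forall N, \sum_(i < N) `|u i| * (2 * i%:R + 1) <= 20 * B.
Proof.
move=> h N; apply: le_trans (_ : 20 * wnorm wlin N u <= _); last by rewrite ler_pM2l.
rewrite /wnorm mulr_sumr; apply: ler_sum => i _; rewrite mulrCA ler_wpM2l // /wlin.
by lra.
Qed.

(** Since D = k (1 - x)^(-1/2), the constant is K = k(1). It is nonzero because k g = 1 forces K G =
    1, read off the coefficients of (k/(1 - x))(g/(1 - x)) = (1 - x)^(-2), and it is nonnegative
    because the coefficients of D are. *)
Lemma asy_D : exists2 K : R, 0 < K & asy D 1 K.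
Proof.
have [K hK1 hK2] := asy_summable_mul (wlin_dominates wnorm_k).
have hg N : wnorm wlin N g <= 17 / 10.
  have -> : g = 1 + y by rewrite /y; ring.
  apply: le_trans (wnormD wlin_ge0 _ _ _) _; have := wnorm_y N; have := @wnorm_one 1 N erefl; lra.
have [G _ hG2] := asy_summable_mul (wlin_dominates hg).
have := asyM (isT : (0 < 2)%N) (isT : (0 < 2)%N) hK2 hG2.
have -> : k * ones R * (g * ones R) = bin R 4.
  have -> : k * ones R * (g * ones R) = (k * g) * (ones R * ones R) by ring.
  by rewrite kg mul1r -bin2E bin_mul.
move=> h; have KG : K * G = 1.
  exact: (cvg_unique (@Rhausdorff R) h (@asy_self R 4 isT)).
rewrite k_bin in hK1; exists K => //.
rewrite lt_neqAle; apply/andP; split.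
  by apply/eqP => K0; move: KG; rewrite -K0 mul0r => /eqP; rewrite eq_sym oner_eq0.
rewrite leNgt; apply/negP => K0.
have /cvg_seqP/(_ (- K / 2))[|N hN] := hK1; first by rewrite divr_gt0 // oppr_gt0.
have := hN N (leqnn N); have : 0 <= D N / bin R 1 N by rewrite divr_ge0 ?bin_ge0.
by move=> h1; rewrite ger0_norm; lra.
Qed.

Lemma theta1B (u : fps R) : theta (1 - u) = - theta u.
Proof.
apply/funext => n; rewrite fpsN /theta fpsB fps1 mulrBr.
by case: n => [|n]; rewrite ?mul0r ?mulr0 ?sub0r ?oppr0 ?addr0 // subr0.
Qed.

(** The derivative of (1 - p)^2 = 1 - f, divided by 1 - p. *)
Lemma theta_p : theta p + theta p = theta f * D.
Proof.
have := congr1 (@theta R) p_quadratic; rewrite thetaM !theta1B => h.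
have {}h : theta f = (theta p + theta p) * (1 - p).
  by rewrite -[theta f]opprK -h; ring.
by rewrite h -mulrA [_ * D]mulrC D_inv mulr1.
Qed.

(** In degree 2 m the coefficient is 2 m r^m p_m, and 2 m <= 2^m for m >= 1 while r <= 1/2: f still
    converges beyond the singularity of p. *)
Lemma theta_f_le n : `|theta f n| <= (scale (2 * r) * fpsX R) n + evenser p n.
Proof.
rewrite /theta ger0_norm ?mulr_ge0 // /f /fser fpsD mulrDr; apply: lerD.
  by rewrite scaleM /fpsX; case: eqP => [->|_]; rewrite ?mul1r // !mulr0.
rewrite /evenser; case: ifP => on; first by rewrite mulr0.
rewrite mulrCA ler_piMr // -{1}(odd_double_half n) on add0n.
move: (n./2) => m; case: m => [|m]; first by rewrite mul0r.
have rm : r ^+ m.+1 <= 2^-1 ^+ m.+1 by rewrite lerXn2r ?nnegrE //; lra.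
apply: le_trans (ler_wpM2l _ rm) _ => //.
rewrite exprVn ler_pdivrMr ?exprn_gt0 // mul1r -natrX ler_nat.
by elim: m {rm} => // m IH; rewrite expnS doubleS; move: IH; rewrite !expnS; lia.
Qed.

Lemma theta_f_sum N : \sum_(i < N) `|theta f i| <= 2.
Proof.
apply: le_trans (ler_sum _ (fun (i : 'I_N) _ => theta_f_le i)) _.
rewrite big_split /= -[2]/(1 + 1); apply: lerD; last first.
  by apply: le_trans (evenser_sum_le' _ _) _ => //; exact: pser_sum_le.
apply: le_trans (_ : \sum_(i < N.+2) (scale (2 * r) * fpsX R : fps R) i <= _).
  apply: sum_mono; last by lia.
  by move=> i; rewrite scaleM !mulr_ge0 // /fpsX ler0n.
rewrite 2!big_ord_recl big1 ?addr0 => [|i _]; rewrite ?scaleM /fpsX /= ?mulr0 //.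
by have := r_le; lra.
Qed.

(** An absolutely summable series, theta f, convolved with the null sequence D. This is the o(1/n)
    bound on the coefficients of p. *)
Lemma theta_p_to0 : (theta p @ \oo --> (0 : R))%classic.
Proof.
have [K _ hD] := asy_D.
have D0 : (D @ \oo --> (0 : R))%classic.
  have h := cvgM hD (@bin_littleo R 1 2 isT); rewrite mulr0 in h.
  rewrite (_ : D = fun n => D n / bin R 1 n * (bin R 1 n / bin R 2 n)); first exact: h.
  apply/funext => n; rewrite bin2 divr1 mulfVK //.
  by apply: lt0r_neq0; exact: bin_gt0.
have := conv_to0 theta_f_sum D0; rewrite -theta_p => h.
have h2 := cvgM (cvg_cst (2^-1 : R)) h; rewrite mulr0 in h2.
rewrite (_ : theta p = fun n => 2^-1 * (theta p + theta p) n); first exact: h2.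
by apply/funext => n; rewrite fpsD; lra.
Qed.

End SingularExpansion.

(** All analytic information on V that the induction on forests relies on. [D] is kept abstract: its
    nonnegativity will come from a combinatorial formula. *)
Lemma binary_tree_series (R : realType) : exists r : R,
  [/\ 0 < r, r <= 2^-1 &
   forall D : fps R, (forall n, 0 <= D n) -> D * (1 - pser r) = 1 ->
     (theta (pser r) @ \oo --> (0 : R))%classic /\ exists2 K : R, 0 < K & asy D 1 K].
Proof.
have [r [r4 r2 h1 h2]] := radius_exists R.
exists r; split=> //; first by apply: lt_le_trans r4; rewrite invr_gt0.
move=> D D0 D1; split.
  exact: (theta_p_to0 r4 r2 h1 h2 D0 D1).
exact: (asy_D r4 r2 h1 h2 D0 D1).
Qed.

(** * Quotients of consecutive binomial coefficients *)

Section BinomialRatios.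
Variable R : realType.
Implicit Types e : nat.

(** Squared in order to avoid square roots until the end. *)
Definition sqratio e (k : nat) : R := (2 * k%:R + 1) * (bin R e k / bin R e.+1 k) ^+ 2.

(** Factor by factor this is a (a + 2) <= (a + 1)^2 with a = e + 2 i. It makes the quotient c_e /
    c_(e+1) nondecreasing in [e]. *)
Lemma bin_log_concave e k : bin R e k * bin R e.+2 k <= bin R e.+1 k ^+ 2.
Proof.
elim: k => [|k IH]; first by rewrite !bin_0 mulr1 expr1n.
have e0 : 0 <= e%:R :> R by []. have k0 : 0 <= k%:R :> R by [].
have k1 : 0 < k.+1%:R :> R by rewrite ltr0n.
rewrite !bin_S mulrACA exprMn; apply: ler_pM => //.
  by rewrite mulr_ge0 ?bin_ge0.
rewrite mulrACA -expr2 [leRHS]exprMn ler_pM2r ?exprn_gt0 ?invr_gt0 //.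
rewrite -(natr1 e.+1) -(natr1 e); nra.
Qed.

Lemma sqratio_mono e e' k : (e <= e')%N -> sqratio e k <= sqratio e' k.
Proof.
elim: e' => [|e' IH]; first by rewrite leqn0 => /eqP->.
rewrite leq_eqVlt => /orP[/eqP->//|/IH h]; apply: le_trans h _.
rewrite /sqratio ler_wpM2l ?addr_ge0 ?mulr_ge0 // lerXn2r ?nnegrE ?divr_ge0 ?bin_ge0 //.
have b1 : 0 < bin R e'.+1 k by exact: bin_gt0.
have b2 : 0 < bin R e'.+2 k by exact: bin_gt0.
by rewrite ler_pdivrMr // mulrAC ler_pdivlMr // -expr2 bin_log_concave.
Qed.

Lemma sqratio0 k : sqratio 0 k.+1 = 0.
Proof.
rewrite /sqratio; have -> : bin R 0 k.+1 = 0.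
  by rewrite /bin big_ord_recl mul0r addr0 mul0r mul0r.
by rewrite mul0r expr0n mulr0.
Qed.

Lemma sqratio_cvg e : exists l : R, ((sqratio e : nat -> R) @ \oo --> l)%classic.
Proof.
case: e => [|e].
  exists 0; rewrite -cvg_shiftS (_ : (fun n => _) = fun=> 0); first exact: cvg_cst.
  by apply/funext => k; exact: sqratio0.
(* Replacing 2 k + 1 by 2 k plus the exponent makes the sequence monotone: with a this new factor,
   consecutive terms have quotient a (a + 2) / (a + 1)^2. The limit thus exists without the Gamma
   function. *)
pose z (k : nat) : R := (2 * k%:R + e.+1%:R) * (bin R e.+1 k / bin R e.+2 k) ^+ 2.
have zd : nonincreasing_seq z.
  apply/nonincreasing_seqP => k; rewrite /z.
  have b1 : 0 < bin R e.+1 k by exact: bin_gt0.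
  have b2 : 0 < bin R e.+2 k by exact: bin_gt0.
  have e0 : 0 <= e%:R :> R by []. have k0 : 0 <= k%:R :> R by [].
  have k1 : k.+1%:R != 0 :> R by rewrite pnatr_eq0.
  rewrite !bin_S; set x := bin R e.+1 k in b1 *; set y := bin R e.+2 k in b2 *.
  have E1 : e.+1%:R = e%:R + 1 :> R by rewrite natr1.
  have E2 : e.+2%:R = e%:R + 2 :> R by rewrite -(natr1 e.+1) E1; ring.
  have K1 : k.+1%:R = k%:R + 1 :> R by rewrite natr1.
  rewrite K1 in k1 *; rewrite E1 E2.
  set a := 2 * k%:R + (e%:R + 1).
  have a0 : 0 < a by rewrite /a; lra.
  have -> : (2 * (k%:R + 1) + (e%:R + 1)) *
     (x * (((e%:R + 1) / 2 + k%:R) / (k%:R + 1)) / (y * (((e%:R + 2) / 2 + k%:R) / (k%:R + 1)))) ^+ 2 =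
     (a * (a + 2) / (a + 1) ^+ 2) * (a * (x / y) ^+ 2).
    by rewrite /a; field; rewrite k1 !lt0r_neq0 //; lra.
  apply: ler_piMl; first by rewrite mulr_ge0 ?sqr_ge0 // ltW.
  by rewrite ler_pdivrMr ?exprn_gt0; nra.
have z0 k : 0 <= z k by rewrite mulr_ge0 ?sqr_ge0 // addr_ge0 ?mulr_ge0.
have /cvg_ex[l hl] : cvgn z.
  by apply: nonincreasing_is_cvgn => //; exists 0 => _ [k _ <-].
exists l; rewrite (_ : (sqratio _ : nat -> R) = fun k => z k * ((2 * k%:R + 1) / (2 * k%:R + e.+1%:R))).
  rewrite -[l]mulr1; apply: cvgM => //; apply/cvg_seqP => eps eps0.
  have /cvg_seqP/(_ eps eps0)[N hN] := cvg_inv_nat (e%:R : R).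
  exists N => k /hN; rewrite subr0 => h; apply: le_trans h.
  have e0 : 0 <= e%:R :> R by []. have k0 : 0 <= k%:R :> R by [].
  rewrite -(natr1 e) -(natr1 k) [leRHS]ger0_norm ?divr_ge0 ?addr_ge0 //.
  have d0 : 0 < 2 * k%:R + (e%:R + 1) :> R by lra.
  have -> : (2 * k%:R + 1) / (2 * k%:R + (e%:R + 1)) - 1 = - (e%:R / (2 * k%:R + (e%:R + 1))) :> R.
    by field; apply: lt0r_neq0.
  rewrite normrN ger0_norm ?divr_ge0 ?(ltW d0) // ler_wpM2l // lef_pV2 ?posrE //; lra.
apply/funext => k; rewrite /sqratio /z; have : 2 * k%:R + e.+1%:R != 0 :> R.
  by rewrite lt0r_neq0 // ltr_wpDl ?mulr_ge0 // ltr0n.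
set x := bin _ _ _ / _; by move=> h; field.
Qed.

Lemma bin1_sq k : 1 <= (4 * k%:R + 1) * bin R 1 k ^+ 2.
Proof.
elim: k => [|k IH]; first by rewrite bin_0 expr1n; lra.
apply: le_trans IH _; have k0 : 0 <= k%:R :> R by [].
rewrite bin_S exprMn [leRHS]mulrCA [leLHS]mulrC ler_wpM2l ?sqr_ge0 //.
rewrite exprMn exprVn mulrA ler_pdivlMr ?exprn_gt0 ?ltr0n //.
by rewrite -(natr1 k); nra.
Qed.

(** For the one-vertex pattern: it trades the square root for 2 k + 1 times a coefficient of (1 -
    x)^(-1/2). *)
Lemma sqrt_le_bin1 k : Num.sqrt (2 * k%:R + 1) <= 2 * (2 * k%:R + 1) * bin R 1 k.
Proof.
have k0 : 0 <= k%:R :> R by [].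
have h0 : 0 <= 2 * (2 * k%:R + 1) * bin R 1 k by rewrite !mulr_ge0 ?bin_ge0 // addr_ge0 ?mulr_ge0.
rewrite -[leRHS](ger0_norm h0) -sqrtr_sqr ler_wsqrtr //.
have := bin1_sq k; rewrite !exprMn; set b := _ ^+ 2; have b0 : 0 <= b by exact: sqr_ge0.
by nra.
Qed.

(** For the series A_F'(x^2): after rescaling, its coefficient of index 2 m keeps an extra factor
    r^m <= 2^(-m). *)
Lemma bin_geometric e : ((fun m => bin R e m / 2 ^+ m) @ \oo --> (0 : R))%classic.
Proof.
pose q (m : nat) : R := bin R e m / 2 ^+ m.
have q0 m : 0 <= q m by rewrite divr_ge0 ?bin_ge0 // exprn_ge0.
have hq m : (e <= m)%N -> q m.+1 <= 3 / 4 * q m.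
  move=> em; have k0 : 0 <= m%:R :> R by []. have e0 : 0 <= e%:R :> R by [].
  have em' : e%:R <= m%:R :> R by rewrite ler_nat.
  have -> : q m.+1 = ((e%:R / 2 + m%:R) / (2 * m.+1%:R)) * q m.
    by rewrite /q bin_S exprS; field; rewrite nat1r pnatr_eq0 /= expf_neq0.
  rewrite ler_wpM2r // ler_pdivrMr ?mulr_gt0 ?ltr0n // -(natr1 m); lra.
have hq2 m : q (m + e)%N <= q e * (3 / 4) ^+ m.
  elim: m => [|m IH]; first by rewrite mulr1.
  rewrite addSn exprS mulrCA; apply: le_trans (hq _ (leq_addl _ _)) _.
  by rewrite ler_pM2l // divr_gt0.
rewrite -(cvg_shiftn e q).
apply: (@squeeze_cvgr _ _ _ _ (fun=> 0) (fun m => q e * (3 / 4) ^+ m)).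
- by near=> m; rewrite q0 hq2.
- exact: cvg_cst.
- by apply: cvg_geometric; rewrite ger0_norm ?divr_ge0 //; lra.
Unshelve. all: by end_near.
Qed.

End BinomialRatios.

(** * Marked forests *)

Section ForestAsymptotics.
Variable R : realType.
Variable r : R.
Hypothesis r_gt0 : 0 < r.
Hypothesis r_le : r <= 2^-1.
Hypothesis series_r : forall D : fps R, (forall n, 0 <= D n) -> D * (1 - pser r) = 1 ->
     (theta (pser r) @ \oo --> (0 : R))%classic /\ exists2 K : R, 0 < K & asy D 1 K.

Let p := pser r.
Let a (F : seq nat) : fps R := dil r (natser R (acnt F)).
Let b (F : seq nat) : fps R := dil r (natser R (pcnt F)).
Let d (F : seq nat) : fps R := dil r (natser R (diag F)).

Lemma dil_natser_ge0 u n : 0 <= dil r (natser R u) n.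
Proof. by rewrite mulr_ge0 ?ler0n // exprn_ge0 // ltW. Qed.

Lemma pE : p = scale r * (fpsX R * a [::]). Proof. by []. Qed.

Lemma a_size F : size F != 1%N -> a F = b F.
Proof. by move=> h; apply/funext => n; rewrite /a /b /dil /natser acnt_pcnt. Qed.

Lemma a_node L : a [:: node 0 L] = b L + b [:: node 0 L].
Proof. by apply/funext => n; rewrite fpsD /a /b /dil /natser acnt_node natrD mulrDl. Qed.

Lemma aa_conv F G n : (a F * a G) n = (conv_cnt (acnt F) (acnt G) n)%:R * r ^+ n.
Proof. by rewrite dilM /dil -natr_conv. Qed.

Lemma b_eq F : F != [::] -> b F = p * a F +
  scale (r / 2) * (fpsX R * (\sum_(s <- psplits F) a s.1 * a s.2 + d F)).
Proof.
move=> Fn; apply/funext => n; rewrite fpsD scaleM pE.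
have -> : scale r * (fpsX R * a [::]) * a F = scale r * (fpsX R * (a [::] * a F)) by ring.
rewrite scaleM; case: n => [|n].
  by rewrite !fpsXM0 /b /dil /natser pcnt0 (negPf Fn) mul0r !mulr0 addr0.
rewrite !fpsXMS fpsD aa_conv fps_sum.
under eq_bigr do rewrite aa_conv.
rewrite -mulr_suml -natr_sum /d /b /dil /natser.
have := congr1 (fun m => m%:R : R) (pcntS_psplits n Fn).
rewrite /= -!muln2 !natrD !natrM => h.
have {h} -> : (pcnt F n.+1)%:R = (((conv_cnt (acnt [::]) (acnt F) n)%:R * 2 +
  (\sum_(s <- psplits F) conv_cnt (acnt s.1) (acnt s.2) n)%:R + (diag F n)%:R) / 2) :> R.
  by rewrite -h mulfK.
by rewrite exprS; field.
Qed.

Let leaf := node 0 [::].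

(** The inverse of 1 - p in a form with visibly nonnegative coefficients: for the one-vertex pattern
    (1 - x V) A = V, whence (1 - x V)(1 + x A) = 1. *)
Let D : fps R := 1 + scale r * (fpsX R * a [:: leaf]).

Lemma size1_psplits F : size F = 1%N -> psplits F = [::].
Proof.
move=> sF; case E : (psplits F) => [//|s l].
have /psplitsP[h1 h2 /perm_size] : s \in psplits F by rewrite E inE eqxx.
rewrite size_cat sF; move: h1 h2; rewrite -!size_eq0; lia.
Qed.

Lemma size1_d F : size F = 1%N -> d F = 0.
Proof.
move=> sF; apply/funext => n; rewrite /d /dil /natser; have [->|[F' /perm_size]] := diagP F.
  by rewrite mul0r.
by rewrite size_cat sF; lia.
Qed.

Lemma tree_eq L : (1 - p) * a [:: node 0 L] = b L.
Proof.
have h := @b_eq [:: node 0 L] isT.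
rewrite size1_psplits // size1_d // big_nil add0r !mulr0 addr0 in h.
by rewrite mulrBl mul1r {1}a_node h; ring.
Qed.

Lemma D_inv : D * (1 - p) = 1.
Proof.
have -> : D * (1 - p) = 1 - p + scale r * (fpsX R * ((1 - p) * a [:: leaf])) by rewrite /D; ring.
by rewrite tree_eq -a_size // -pE subrK.
Qed.

Lemma D_ge0 n : 0 <= D n.
Proof.
rewrite /D fpsD scaleM fps1 addr_ge0 //; case: n => [|n]; first by rewrite fpsXM0 mulr0.
by rewrite fpsXMS mulr_ge0 ?dil_natser_ge0 // ltW.
Qed.

Lemma tree_eqD L : a [:: node 0 L] = D * b L.
Proof. by rewrite -tree_eq mulrA D_inv mul1r. Qed.

Lemma forest_eqD F : F != [::] -> size F != 1%N ->
  a F = D * (scale (r / 2) * (fpsX R * (\sum_(s <- psplits F) a s.1 * a s.2 + d F))).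
Proof.
move=> Fn F1; have h := b_eq Fn; rewrite -a_size // in h.
set E := scale _ * _ in h *.
have -> : E = (1 - p) * a F by rewrite mulrBl mul1r {1}h; ring.
by rewrite mulrA D_inv mul1r.
Qed.

Lemma empty_small : ((fun n => (2 * n%:R + 1) * a [::] n) @ \oo --> (0 : R))%classic.
Proof.
have [h _] := series_r D_ge0 D_inv.
have h2 : ((fun n => 2 / r * theta (pser r) n.+1) @ \oo --> (0 : R))%classic.
  rewrite (cvg_shiftS (fun n => 2 / r * theta (pser r) n)).
  by have h2 := cvgM (cvg_cst (2 / r : R)) h; rewrite mulr0 in h2; exact: h2.
apply: (@squeeze_cvgr _ _ _ _ (fun=> 0) (fun n => 2 / r * theta (pser r) n.+1)) => //.
  near=> n; have k0 : 0 <= n%:R :> R by [].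
  have a0 : 0 <= a [::] n by exact: dil_natser_ge0.
  rewrite mulr_ge0 //= ?addr_ge0 ?mulr_ge0 // /theta -/p pE scaleM fpsXMS.
  have -> : 2 / r * (n.+1%:R * (r * a [::] n)) = 2 * n.+1%:R * a [::] n.
    by field; apply: lt0r_neq0.
  by rewrite ler_wpM2r // -(natr1 n); lra.
exact: cvg_cst.
Unshelve. all: by end_near.
Qed.

Lemma empty_asy e : (0 < e)%N -> asy (a [::]) e 0.
Proof.
move=> e0; apply: (@squeeze_cvgr _ _ _ _ (fun=> 0) (fun n => (2 * n%:R + 1) * a [::] n)).
- near=> n; have a0 : 0 <= a [::] n by exact: dil_natser_ge0.
  have b0 : 0 < bin R e n by exact: bin_gt0.
  rewrite divr_ge0 ?(ltW b0) //= ler_pdivrMr // mulrAC ler_peMl //.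
  apply: le_trans (bin1_ge R n) _; rewrite ler_wpM2l ?addr_ge0 ?mulr_ge0 //.
  by apply: bin_mono; lia.
- exact: cvg_cst.
- exact: empty_small.
Unshelve. all: by end_near.
Qed.

Lemma asy_weaken (u : fps R) e f : (0 < e <= f)%N -> asy u e 0 -> asy u f 0.
Proof.
move=> /andP[e0]; rewrite leq_eqVlt => /orP[/eqP<-//|ef] hu.
have [B _ hB] := asy_bounded e0 hu; apply: asy_littleo hB; lia.
Qed.

Lemma asy_sum (I : eqType) (s : seq I) (u : I -> fps R) e :
  (forall i, i \in s -> exists2 C : R, 0 < C & asy (u i) e C) ->
  exists2 C : R, if s is [::] then C = 0 else 0 < C & asy (\sum_(i <- s) u i) e C.
Proof.
elim: s => [|i s IH] h.
  exists 0 => //; rewrite big_nil /asy (_ : (fun n => _) = fun=> 0); first exact: cvg_cst.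
  by apply/funext => n; rewrite fps0 mul0r.
have [|C hC aC] := IH; first by move=> j js; apply: h; rewrite inE js orbT.
have [C' C0 aC'] := h i (mem_head _ _).
exists (C' + C); last by rewrite big_cons; exact: asyD.
by case: s hC {IH h aC} => [->|j s]; [rewrite addr0|exact: addr_gt0].
Qed.

(** Forests are lists of arbitrary numbers; for codes of trees the weight is at least 2, on which
    the induction on weights rests. *)
Definition is_tcode (n : nat) : Prop := exists S, tcode S = n.

Lemma is_tcode_node n : is_tcode n -> exists2 L, n = node 0 L & forall m, m \in L -> is_tcode m.
Proof.
case=> -[ts] <-; exists (map tcode ts) => // m.
elim: ts => //= t ts IH; rewrite inE => /orP[/eqP->|/IH//]; by exists t.
Qed.

Lemma is_tcode_wt n : is_tcode n -> (2 <= wt n)%N.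
Proof.
case=> S <-; elim/tree_nested_ind: S => -[|t ts] H; rewrite [tcode _]/= wt_node //.
by case: H => ht _; rewrite /= /wts /=; lia.
Qed.

Lemma wts_perm F G : perm_eq F G -> wts F = wts G.
Proof. by move=> h; apply/perm_sumn/perm_map. Qed.

Lemma wts_cat F G : wts (F ++ G) = (wts F + wts G)%N.
Proof. by rewrite /wts map_cat sumn_cat. Qed.

Lemma wts_ge2 (F : seq nat) : (forall n, n \in F -> is_tcode n) -> F != [::] -> (2 <= wts F)%N.
Proof.
case: F => // n F h _; rewrite /wts /= (leq_trans (is_tcode_wt (h n (mem_head _ _)))) //.
exact: leq_addr.
Qed.

(** With F twice F', the coefficient of index 2 m is that of A_F' at m times r^m: polynomial growth
    against 2^(-m). *)
Lemma diag_small (F : seq nat) : (forall F' : seq nat, F' != [::] -> perm_eq (F' ++ F') F ->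
    exists B e, forall n, a F' n <= B * bin R e n) -> F != [::] ->
  (d F @ \oo --> (0 : R))%classic.
Proof.
move=> h Fn; have [h0|[F' hF hd]] := diagP F.
  rewrite (_ : d F = fun=> 0); first exact: cvg_cst.
  by apply/funext => n; rewrite /d /dil /natser h0 mul0r.
have F'n : F' != [::] by apply: contra Fn => /eqP F'0; rewrite F'0 in hF; apply/eqP/perm_nilP; rewrite perm_sym.
have [B [e hB]] := h F' F'n hF.
have /cvg_seqP hg : ((fun m => B * (bin R e m / 2 ^+ m)) @ \oo --> (0 : R))%classic.
  by have h2 := cvgM (cvg_cst B) (@bin_geometric R e); rewrite mulr0 in h2; exact: h2.
apply: cvg0P => eps /hg[N hN]; exists N.*2 => n hn.
rewrite /d /dil /natser hd; case: ifP => on; first by rewrite mul0r normr0; apply: le_trans (hN N (leqnn N)).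
have hn2 : (N <= n./2)%N by lia.
have en : n = (n./2).*2 by rewrite -{1}(odd_double_half n) on.
have := hN _ hn2; rewrite subr0; apply: le_trans.
set m := n./2 in en *; rewrite en -addnn exprD [_%:R * _]mulrA.
have am := hB m; have a0 : 0 <= a F' m by exact: dil_natser_ge0.
have -> : (acnt F' m)%:R * r ^+ m = a F' m by [].
have rm0 : 0 <= r ^+ m by rewrite exprn_ge0 // ltW.
have B0 : 0 <= B * bin R e m by exact: le_trans am.
rewrite [B * _]mulrA ger0_norm ?mulr_ge0 // ger0_norm; last by rewrite divr_ge0 ?exprn_ge0.
rewrite -exprVn; apply: ler_pM => //.
by rewrite lerXn2r ?nnegrE ?(ltW r_gt0).
Qed.

(** Induction on the weight. For a tree, A = D B_L adds 1 to the exponent of the forest [L] below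
    its root. For a larger forest, a product over a splitting has exponent [(wts F).-2], the same
    for all splittings, and D adds 1. The constants are positive, so nothing cancels. *)
Lemma forest_asy (F : seq nat) : (forall n, n \in F -> is_tcode n) -> F != [::] ->
  exists2 C : R, 0 < C & asy (a F) (wts F).-1 C /\ asy (b F) (wts F).-1 C.
Proof.
have [_ [K K0 hD]] := series_r D_ge0 D_inv.
have [n] := ubnP (wts F); elim: n F => // n IH F hn hF Fn.
have [F1|F1] := eqVneq (size F) 1%N.
  case: F F1 hF Fn hn => [//|c [|//]] _ hF _ hn.
  have [L eL hL] := is_tcode_node (hF c (mem_head _ _)).
  have wL : wts [:: c] = wt c by rewrite /wts /= addn0.
  rewrite wL in hn *; rewrite eL wt_node in hn *.
  have bE : b [:: node 0 L] = a [:: node 0 L] - b L by rewrite a_node; ring.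
  have [L0|Ln] := eqVneq L [::].
    rewrite L0 /= in bE *.
    (* Here D = 1 + r x A is read backwards: the coefficients of A are those of D, shifted and
       divided by r. *)
    have ha : asy (a [:: node 0 [::]]) 1 (K / r).
      have h := hD; rewrite /asy -(cvg_shiftS (fun n => D n / bin R 1 n)) in h.
      have h2 : ((fun n => (bin R 1 n / bin R 1 n.+1)^-1) @ \oo --> (1 : R))%classic.
        have h2 := cvgV (oner_neq0 R) (@bin_shift R 1 isT).
        by rewrite invr1 in h2; exact: h2.
      rewrite /asy (_ : (fun n => _) = fun n => D n.+1 / bin R 1 n.+1 * (bin R 1 n / bin R 1 n.+1)^-1 * r^-1).
        have h3 := cvgM (cvgM h h2) (cvg_cst (r^-1 : R)).
        by rewrite mulr1 in h3; exact: h3.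
      apply/funext => m; rewrite /D fpsD scaleM fps1 fpsXMS add0r.
      have b1 := bin_gt0 R m (isT : (0 < 1)%N); have b2 := bin_gt0 R m.+1 (isT : (0 < 1)%N).
      by field; rewrite !lt0r_neq0.
    exists (K / r); first exact: divr_gt0.
    split=> //; rewrite bE -[K / r]subr0; apply: asyB => //.
    by rewrite -a_size //; exact: empty_asy.
  have wL2 := wts_ge2 hL Ln.
  have Lnil : nilp L = false by apply/negbTE; rewrite /nilp size_eq0.
  rewrite Lnil /= in hn *.
  have [|C C0 [_ hb]] := IH L _ hL Ln; first by lia.
  have ha : asy (a [:: node 0 L]) (wts L) (K * C).
    rewrite tree_eqD (_ : wts L = 1 + (wts L).-1)%N; last by lia.
    by apply: asyM => //; lia.
  exists (K * C); first exact: mulr_gt0.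
  split=> //; rewrite bE -[K * C]subr0; apply: asyB => //.
  have e0 : (0 < (wts L).-1)%N by lia.
  have [B _ hB] := asy_bounded e0 hb; apply: asy_littleo hB; lia.
have sub G H : perm_eq (G ++ H) F -> G != [::] -> H != [::] ->
    [/\ (wts F = wts G + wts H)%N, (2 <= wts G)%N, (2 <= wts H)%N,
     (forall n, n \in G -> is_tcode n) & (forall n, n \in H -> is_tcode n)].
  move=> hp Gn Hn.
  have hG m : m \in G -> is_tcode m by move=> mG; apply: hF; rewrite -(perm_mem hp) mem_cat mG.
  have hH m : m \in H -> is_tcode m by move=> mH; apply: hF; rewrite -(perm_mem hp) mem_cat mH orbT.
  by split=> //; [rewrite -(wts_perm hp) wts_cat|exact: wts_ge2|exact: wts_ge2].
pose e := (wts F).-2.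
have w4 : (4 <= wts F)%N.
  case: F F1 Fn hF {IH sub hn e} => [|c [|c' F]] // _ _ hF.
  have := is_tcode_wt (hF c (mem_head _ _)).
  have : is_tcode c' by apply: hF; rewrite !inE eqxx orbT.
  by move/is_tcode_wt; rewrite /wts /=; lia.
have [C hC aC] : exists2 C : R, if psplits F is [::] then C = 0 else 0 < C &
    asy (\sum_(s <- psplits F) a s.1 * a s.2) e C.
  apply: asy_sum => s /psplitsP[h1 h2 h].
  have [ew wG wH hG hH] := sub _ _ h h1 h2.
  have [|C1 C10 [aC1 _]] := IH s.1 _ hG h1; first by lia.
  have [|C2 C20 [aC2 _]] := IH s.2 _ hH h2; first by lia.
  exists (C1 * C2); first exact: mulr_gt0.
  rewrite (_ : e = (wts s.1).-1 + (wts s.2).-1)%N; last by rewrite /e; lia.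
  by apply: asyM => //; lia.
(* The sum is not empty: the first tree can be split off from the others. *)
have C0 : 0 < C.
  case E : (psplits F) hC => [|s l] // _.
  case: F F1 Fn {hF hn sub w4 aC e} E => [|c [|c' F]] // _ _ E.
  have : (sort leq [:: c], sort leq (c' :: F)) \in splits [:: c, c' & F] by rewrite mem_splits.
  have s1 : sort leq [:: c] != [::] by rewrite -size_eq0 size_sort.
  have s2 : sort leq (c' :: F) != [::] by rewrite -size_eq0 size_sort.
  move=> h; suff : (sort leq [:: c], sort leq (c' :: F)) \in psplits [:: c, c' & F] by rewrite E.
  by rewrite mem_filter h andbT; apply/andP.
have ha : asy (a F) (wts F).-1 (K * (r / 2 * C)).
  rewrite forest_eqD // mulrDr mulrDr mulrDr.
  rewrite -[K * _]addr0; apply: asyD.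
    rewrite (_ : (wts F).-1 = 1 + e)%N; last by rewrite /e; lia.
    apply: asyM => //; first by rewrite /e; lia.
    apply: asy_scale; apply: asyX => //; by rewrite /e; lia.
  (* The diagonal part tends to 0, so it is negligible against [bin 2], and its product with D
     against [bin 3]. Weight at least 4 puts this within the exponent [(wts F).-1]. *)
  have -> : D * (scale (r / 2) * (fpsX R * d F)) = scale (r / 2) * (fpsX R * (d F * D)) by ring.
  rewrite -(mulr0 (r / 2)); apply: asy_scale; apply: asyX; first by lia.
  apply: (@asy_weaken _ 3); first by lia.
  have [B _ hB] := asy_bounded (isT : (0 < 1)%N) hD.
  apply: (@littleo_mul R (d F) D 2 1 B) => //.
  rewrite (_ : (fun n => _) = d F); last by apply/funext => m; rewrite bin2 divr1.
  apply: diag_small => // F' F'n hF'.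
  have [ew wG _ hG _] := sub _ _ hF' F'n F'n.
  have [|C1 C10 [aC1 _]] := IH F' _ hG F'n; first by lia.
  have e0 : (0 < (wts F').-1)%N by lia.
  have [B' _ hB'] := asy_bounded e0 aC1.
  by exists B', (wts F').-1 => m; apply: le_trans (hB' m); exact: ler_norm.
exists (K * (r / 2 * C)); first by rewrite !mulr_gt0 // divr_gt0.
by rewrite -(a_size F1).
Qed.

Lemma ratio_oddE ts k : ratio_odd R (Node ts) k =
  Num.sqrt (2 * k%:R + 1) * (b (map tcode ts) k / a [:: node 0 (map tcode ts)] k).
Proof.
rewrite /ratio_odd gV_cnt aV_cnt -/(acnt _ k) [tcode _]/= gcnt_pcnt.
rewrite /a /b /dil /natser -mulf_div divff ?mulr1; last by rewrite expf_neq0 // lt0r_neq0.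
by congr (Num.sqrt _ * _); rewrite -natr1 -muln2 natrM mulrC.
Qed.

Lemma sqrt_sqratio e k : Num.sqrt (sqratio R e k) =
  Num.sqrt (2 * k%:R + 1) * (bin R e k / bin R e.+1 k).
Proof.
rewrite /sqratio sqrtrM ?addr_ge0 ?mulr_ge0 // sqrtr_sqr ger0_norm //.
by rewrite divr_ge0 ?bin_ge0.
Qed.

(** As A_S = D G_S, the constant of G_S cancels and only that of D remains. It is essential that [K]
    does not depend on [S]: limits for different patterns then compare through [sqratio] alone. *)
Lemma ratio_odd_cvg : exists2 K : R, 0 < K & forall S (l : R),
  ((sqratio R (wt (tcode S) - 2) : nat -> R) @ \oo --> l)%classic ->
  ((ratio_odd R S : nat -> R) @ \oo --> (Num.sqrt l / K : R))%classic.
Proof.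
have [_ [K K0 hD]] := series_r D_ge0 D_inv.
exists K => // -[ts] l; set L := map tcode ts.
have hL m : m \in L -> is_tcode m.
  by rewrite /L; elim: (ts) => //= t l' IH; rewrite inE => /orP[/eqP->|/IH//]; exists t.
rewrite [tcode _]/= -/L wt_node.
have rE : (ratio_odd R (Node ts) : nat -> R) =
    fun k => Num.sqrt (2 * k%:R + 1) * (b L k / a [:: node 0 L] k).
  by apply/funext => k; rewrite ratio_oddE.
(* For a single vertex the exponent of G_S is 0, outside the range of [asy], and the limit 0 has to
   be found directly. *)
have [L0|Ln] := eqVneq L [::].
  rewrite L0 /= subnn => hl.
  have -> : l = 0.
    rewrite -(cvg_shiftS (sqratio R 0)) in hl.
    have h0 : ((fun n => sqratio R 0 n.+1) @ \oo --> (0 : R))%classic.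
      by rewrite (_ : (fun n => _) = fun=> 0); [exact: cvg_cst|apply/funext => k; exact: sqratio0].
    exact: (cvg_unique (@Rhausdorff R) hl h0).
  rewrite sqrtr0 mul0r rE L0.
  have [|//|C C0 [aC _]] := @forest_asy [:: node 0 [::]].
    by move=> m; rewrite inE => /eqP->; exists (Node [::]).
  have w1 : (wts [:: node 0 [::]]).-1 = 1%N.
    have -> : wts [:: node 0 [::]] = wt (node 0 [::]) by exact: addn0.
    by rewrite wt_node.
  rewrite w1 in aC.
  (* An upper bound for the ratio, by [sqrt_le_bin1]: a null sequence by [empty_small], divided by
     one with positive limit. *)
  have h : ((fun k => 2 * ((2 * k%:R + 1) * a [::] k) * (a [:: node 0 [::]] k / bin R 1 k)^-1)
      @ \oo --> (0 : R))%classic.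
    have h2 := cvgM (cvgM (cvg_cst (2 : R)) empty_small) (cvgV (lt0r_neq0 C0) aC).
    by rewrite mulr0 mul0r in h2; exact: h2.
  apply: (squeeze_cvgr _ (cvg_cst (0 : R)) h).
  near=> k; have a0 : 0 <= a [::] k by exact: dil_natser_ge0.
  have l0 : 0 <= a [:: node 0 [::]] k by exact: dil_natser_ge0.
  rewrite -a_size // mulr_ge0 ?sqrtr_ge0 ?divr_ge0 //=.
  rewrite invf_div; set ia := (a [:: _] k)^-1.
  rewrite [leRHS](_ : _ = (2 * (2 * k%:R + 1) * bin R 1 k) * (a [::] k * ia)); last by ring.
  by rewrite ler_wpM2r ?sqrt_le_bin1 // mulr_ge0 // invr_ge0.
have Lnil : nilp L = false by apply/negbTE; rewrite /nilp size_eq0.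
have wL2 := wts_ge2 hL Ln.
have [C C0 [_ hb]] := forest_asy hL Ln.
set e := (wts L).-1 in hb.
have e0 : (0 < e)%N by rewrite /e; lia.
have ha : asy (a [:: node 0 L]) e.+1 (K * C).
  by rewrite tree_eqD -add1n; apply: asyM.
rewrite Lnil (_ : (wts L).+1 - 2 = e)%N; last by rewrite /e; lia.
move=> hl; have KC : K * C != 0 by rewrite mulf_neq0 // lt0r_neq0.
have hs : ((fun k => Num.sqrt (sqratio R e k)) @ \oo --> (Num.sqrt l : R))%classic.
  by apply: continuous_cvg => //; exact: sqrt_continuous.
have h := cvgM hs (cvgM hb (cvgV KC ha)).
rewrite rE (_ : (fun k => _) = fun k => Num.sqrt (sqratio R e k) *
  (b L k / bin R e k * (a [:: node 0 L] k / bin R e.+1 k)^-1)).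
  have -> : Num.sqrt l / K = Num.sqrt l * (C * (K * C)^-1).
    by field; rewrite !lt0r_neq0.
  exact: h.
apply/funext => k; rewrite sqrt_sqratio invf_div.
have b1 := bin_gt0 R k e0; have b2 := bin_gt0 R k (ltn0Sn e).
set ia := (a _ k)^-1; by field; rewrite !lt0r_neq0.
Unshelve. all: by end_near.
Qed.

End ForestAsymptotics.

Unset Implicit Arguments.
Local Open Scope classical_set_scope.

Theorem theorem7 (R : realType) (S1 S2 : tree) :
  subtree S1 S2 ->
  exists l1 l2 : R,
    [/\ (ratio_odd R S1 : R^nat) @ \oo --> l1, (ratio_odd R S2 : R^nat) @ \oo --> l2 & l1 <= l2].
Proof.
move=> /wt_tcode_mono le_wt.
have [r [r_gt0 r_le series_r]] := binary_tree_series R.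
have [K K0 hK] := ratio_odd_cvg r_gt0 r_le series_r.
have [l1 hl1] := sqratio_cvg R (wt (tcode S1) - 2).
have [l2 hl2] := sqratio_cvg R (wt (tcode S2) - 2).
exists (Num.sqrt l1 / K), (Num.sqrt l2 / K); split; [exact: hK|exact: hK|].
rewrite ler_pM2r ?invr_gt0 // ler_wsqrtr //.
apply: (ler_cvg_to hl1 hl2); apply: nearW => k.
by apply: sqratio_mono; apply: leq_sub2r.
Qed.
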